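(* Let $X$ be an elliptic curve and $p\in X$. The bundle $E=\mathcal{O}\oplus\mathcal{O}$ on $X$ is strictly semistable with instability degree 0, all lines $\ell_p\in\mathbb{P}(E_p)$ are bad, and every Hecke modification $\alpha:F\to E$ at $p$ (for every line $\ell_p=\mathrm{im}(\alpha_p)$) has $F\cong\mathcal{O}\oplus\mathcal{O}(-p)$.
   Context: Let $E$ be a rank 2 holomorphic vector bundle over a curve $C$. A Hecke modification of $E$ at $p\in C$ is a rank 2 holomorphic bundle $F$ with a bundle map $\alpha:F\to E$ that is an isomorphism on fibers away from $p$ and that, in a local coordinate $z$ centered at $p$ and suitable local trivializations of $E$ and $F$ near $p$, is given by the matrix $\mathrm{diag}(1,z)$. Two Hecke modifications $\alpha:F\to E$, $\alpha':F'\to E$ at $p$ are equivalent if there is an isomorphism $\phi:F\to F'$ with $\alpha=\alpha'\circ\phi$. Equivalence classes correspond bijectively to lines $\ell_p\in\mathbb{P}(E_p)$ via $\ell_p=\mathrm{im}(\alpha_p:F_p\to E_p)$; the bundle $F$ for $\ell_p$ is the one whose sheaf of sections consists of the sections of $E$ whose value at $p$ lies in $\ell_p$. The instability degree of $E$ is $\deg M-\deg(E/M)$, where $M\subset E$ is a line subbundle of maximal degree. A line $\ell_p\in\mathbb{P}(E_p)$ is bad if there is a line subbundle $M\subset E$ of maximal degree with $M_p=\ell_p$, and good otherwise. *)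

(* Defs.v *)
From HB Require Import structures.
From mathcomp Require Import all_boot all_order all_algebra.
From mathcomp Require Import complex.
From mathcomp Require Import all_classical all_reals all_analysis.

Set Implicit Arguments.
Unset Strict Implicit.
Unset Printing Implicit Defensive.

Import Order.TTheory GRing.Theory Num.Theory.
Import numFieldNormedType.Exports.

Local Open Scope classical_set_scope.
Local Open Scope ring_scope.

(* The complex numbers, as a normed and one-dimensional vector space over
   themselves: in MathComp-Analysis R[i] alone carries no topology. *)
Local Notation "''CC_' R" := (R[i]^o) (at level 8, R at level 2).

(* Only the restrictions of [cmap] to [cdom] and of [cinv] to [ccod] matter:
   they are mutually inverse homeomorphisms. *)
Record chart (R : realType) (T : topologicalType) := Chart {
  cdom : set T;
  ccod : set 'CC_R;
  cmap : T -> 'CC_R;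
  cinv : 'CC_R -> T;
  cdom_open : open cdom;
  ccod_open : open ccod;
  cmap_ccod : forall x, cdom x -> ccod (cmap x);
  cinv_cdom : forall z, ccod z -> cdom (cinv z);
  cmapK : forall x, cdom x -> cinv (cmap x) = x;
  cinvK : forall z, ccod z -> cmap (cinv z) = z;
  cmap_cts : forall x, cdom x -> {for x, continuous cmap};
  cinv_cts : forall z, ccod z -> {for z, continuous cinv}
}.

(* The change of coordinates from [c] to [d] is complex differentiable at
   every point of the open set where it is defined. *)
Definition compatible (R : realType) (T : topologicalType) (c d : chart R T) :=
  forall z, ccod c z -> cdom d (cinv c z) -> derivable (cmap d \o cinv c) z 1.

Record curve (R : realType) := Curve {
  cpt :> topologicalType;
  cpt_hausdorff : hausdorff_space cpt;
  cpt_compact : compact [set: cpt];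
  cpt_connected : connected [set: cpt];
  atlas_ix : Type;
  atlas : atlas_ix -> chart R cpt;
  atlas_cover : forall x : cpt, exists a, cdom (atlas a) x;
  atlas_compatible : forall a b, compatible (atlas a) (atlas b)
}.

Arguments atlas {R} X a : rename.
Arguments atlas_cover {R} X x : rename.
Arguments atlas_compatible {R} X a b : rename.

(* Membership in the maximal atlas. *)
Definition local_coordinate (R : realType) (X : curve R) (c : chart R X) :=
  forall a, compatible c (atlas X a) /\ compatible (atlas X a) c.

(* To be used for open [U] only. *)
Definition holomorphic_on (R : realType) (X : curve R) (U : set X)
    (f : X -> 'CC_R) :=
  forall x a, U x -> cdom (atlas X a) x ->
    derivable (f \o cinv (atlas X a)) (cmap (atlas X a) x) 1.

Definition holomorphic_mx_on (R : realType) (X : curve R) (m n : nat)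
    (U : set X) (M : X -> 'M[R[i]]_(m, n)) :=
  forall i j, holomorphic_on U (fun x => M x i j).

Definition holomorphic_from_plane (R : realType) (X : curve R)
    (f : 'CC_R -> X) :=
  continuous f /\
  forall z a, cdom (atlas X a) (f z) -> derivable (cmap (atlas X a) \o f) z 1.

(* X is isomorphic to a complex torus C / (Z w1 + Z w2): the map [f] below
   factors through a holomorphic bijection from the torus to X, and these are
   biholomorphic. *)
Definition elliptic (R : realType) (X : curve R) :=
  exists (w1 w2 : 'CC_R) (f : 'CC_R -> X),
    [/\ forall a b : R, (a%:C)%C * w1 + (b%:C)%C * w2 = 0 -> a = 0 /\ b = 0,
        holomorphic_from_plane f,
        forall x : X, exists z, f z = x
      & forall z w : 'CC_R,
          f z = f w <-> exists m n : int, z - w = m%:~R * w1 + n%:~R * w2].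

(* [btrans i j] is the transition function g_ij, going from the trivialization
   [i] to the trivialization [j]. *)
Record bundle (R : realType) (X : curve R) (r : nat) := Bundle {
  fib : X -> vectType R[i];
  bix : Type;
  bdom : bix -> set X;
  btriv : bix -> forall x, 'Hom(fib x, 'cV[R[i]]_r);
  btrans : bix -> bix -> X -> 'M[R[i]]_r;
  bdom_open : forall i, open (bdom i);
  bdom_cover : forall x, exists i, bdom i x;
  btriv_bij : forall i x, bdom i x -> bijective (btriv i x);
  btransE : forall i j x (v : fib x), bdom i x -> bdom j x ->
    btriv j x v = btrans i j x *m btriv i x v;
  btrans_hol : forall i j, holomorphic_mx_on (bdom i `&` bdom j) (btrans i j)
}.

Arguments bix {R X r} E : rename.
Arguments bdom {R X r} E i _ : rename.
Arguments btriv {R X r} E i x : rename.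
Arguments btrans {R X r} E i j x : rename.

Definition local_trivialization (R : realType) (X : curve R) (r : nat)
    (E : bundle X r) (V : set X) (t : forall x, 'Hom(fib E x, 'cV[R[i]]_r)) :=
  (forall x, V x -> bijective (t x)) /\
  forall i, exists g : X -> 'M[R[i]]_r,
    holomorphic_mx_on (V `&` bdom E i) g /\
    forall x (v : fib E x), V x -> bdom E i x ->
      t x v = g x *m btriv E i x v.

Definition bundle_map (R : realType) (X : curve R) (r s : nat)
    (E : bundle X r) (F : bundle X s)
    (f : forall x, 'Hom(fib E x, fib F x)) :=
  forall i j, exists M : X -> 'M[R[i]]_(s, r),
    holomorphic_mx_on (bdom E i `&` bdom F j) M /\
    forall x (v : fib E x), bdom E i x -> bdom F j x ->
      btriv F j x (f x v) = M x *m btriv E i x v.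

(* The fibrewise inverse of a holomorphic isomorphism is holomorphic, by
   Cramer's rule. *)
Definition bundle_iso (R : realType) (X : curve R) (r : nat)
    (E F : bundle X r) :=
  exists f : forall x, 'Hom(fib E x, fib F x),
    bundle_map f /\ forall x, bijective (f x).

Definition subbundle (R : realType) (X : curve R) (r s : nat)
    (M : bundle X s) (E : bundle X r) (f : forall x, 'Hom(fib M x, fib E x)) :=
  bundle_map f /\ forall x, injective (f x).

(* 0 -> M -> E -> Q -> 0 is exact, i.e. Q is E / M. *)
Definition quotient_bundle (R : realType) (X : curve R) (r s t : nat)
    (M : bundle X s) (E : bundle X r) (Q : bundle X t)
    (f : forall x, 'Hom(fib M x, fib E x))
    (q : forall x, 'Hom(fib E x, fib Q x)) :=
  [/\ subbundle f, bundle_map q, forall x, limg (q x) = fullv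
    & forall x, lker (q x) = limg (f x)].

(* f = (z - z(x))^k u near x, with z a local coordinate and u holomorphic and
   nonzero at x; the value of f at x itself is irrelevant. *)
Definition has_order (R : realType) (X : curve R) (f : X -> 'CC_R) (x : X)
    (k : int) :=
  exists a (V : set X) (u : X -> 'CC_R),
    [/\ open V /\ V x, V `<=` cdom (atlas X a),
        holomorphic_on V u, u x != 0
      & forall y, V y -> y != x ->
          f y = (cmap (atlas X a) y - cmap (atlas X a) x) ^ k * u y].

(* [s] is a nonzero meromorphic section of the line bundle det E, i.e. of the
   line bundle with transition functions det g_ij; [D] is its divisor, and deg E
   is the degree of D.  For r = 1, det E = E. *)
Definition has_degree (R : realType) (X : curve R) (r : nat) (E : bundle X r)
    (d : int) :=
  exists (s : bix E -> X -> 'CC_R) (D : X -> int),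
    [/\ forall i j x, bdom E i x -> bdom E j x ->
          s j x = \det (btrans E i j x) * s i x,
        finite_set [set x | D x != 0],
        forall i x, bdom E i x -> has_order (s i) x (D x)
      & \sum_(x \in [set: X]) D x = d].

(* slope F <= slope E, resp. slope F < slope E, for all proper nonzero
   subbundles F, with denominators cleared. *)
Definition semistable (R : realType) (X : curve R) (r : nat)
    (E : bundle X r) :=
  forall s (F : bundle X s) (f : forall x, 'Hom(fib F x, fib E x)) (dF dE : int),
    (0 < s < r)%N -> subbundle f -> has_degree F dF -> has_degree E dE ->
    dF * r%:Z <= dE * s%:Z.

Definition stable (R : realType) (X : curve R) (r : nat) (E : bundle X r) :=
  forall s (F : bundle X s) (f : forall x, 'Hom(fib F x, fib E x)) (dF dE : int),
    (0 < s < r)%N -> subbundle f -> has_degree F dF -> has_degree E dE ->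
    dF * r%:Z < dE * s%:Z.

Definition strictly_semistable (R : realType) (X : curve R) (r : nat)
    (E : bundle X r) :=
  semistable E /\ ~ stable E.

Definition maximal_line_subbundle (R : realType) (X : curve R) (r : nat)
    (M : bundle X 1) (E : bundle X r) (f : forall x, 'Hom(fib M x, fib E x))
    (d : int) :=
  [/\ subbundle f, has_degree M d
    & forall (M' : bundle X 1) (f' : forall x, 'Hom(fib M' x, fib E x)) d',
        subbundle f' -> has_degree M' d' -> d' <= d].

Definition has_instability_degree (R : realType) (X : curve R)
    (E : bundle X 2) (n : int) :=
  exists (M Q : bundle X 1) (f : forall x, 'Hom(fib M x, fib E x))
      (q : forall x, 'Hom(fib E x, fib Q x)) (dM dQ : int),
    [/\ maximal_line_subbundle f dM, quotient_bundle f q, has_degree Q dQ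
      & n = dM - dQ].

Definition bad_line (R : realType) (X : curve R) (E : bundle X 2) (p : X)
    (l : {vspace fib E p}) :=
  exists (M : bundle X 1) (f : forall x, 'Hom(fib M x, fib E x)) (d : int),
    maximal_line_subbundle f d /\ limg (f p) = l.

Definition hecke_modification (R : realType) (X : curve R) (p : X)
    (F E : bundle X 2) (f : forall x, 'Hom(fib F x, fib E x)) :=
  [/\ bundle_map f,
      forall x, x != p -> bijective (f x)
    & exists (z : chart R X) (V : set X)
        (tF : forall x, 'Hom(fib F x, 'cV[R[i]]_2))
        (tE : forall x, 'Hom(fib E x, 'cV[R[i]]_2)),
        [/\ local_coordinate z /\ cmap z p = 0,
            [/\ open V, V p & V `<=` cdom z],
            local_trivialization V tF, local_trivialization V tE
          & forall x (v : fib F x), V x ->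
              tE x (f x v) =
              diag_mx (\row_(k < 2) if k == ord0 then 1 else cmap z x)
                *m tF x v]].

Section Constructions.
Variables (R : realType) (X : curve R).

Lemma holomorphic_on_cst (U : set X) (c : 'CC_R) :
  holomorphic_on U (fun=> c).
Proof. by move=> x a _ _; apply: derivable_cst. Qed.

Lemma holomorphic_on_cmap (U : set X) a :
  U `<=` cdom (atlas X a) -> holomorphic_on U (cmap (atlas X a)).
Proof.
move=> Ua x b Ux bx; apply: atlas_compatible; first exact: cmap_ccod.
by rewrite cmapK //; exact: Ua.
Qed.

Lemma holomorphic_on_subr (U : set X) (f : X -> 'CC_R) (c : 'CC_R) :
  holomorphic_on U f -> holomorphic_on U (fun x => f x - c).
Proof.
move=> hf x a Ux ax.
by apply: (derivableB (hf x a Ux ax)); apply: derivable_cst.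
Qed.

Lemma holomorphic_on_inv (U : set X) (f : X -> 'CC_R) :
  holomorphic_on U f -> (forall x, U x -> f x != 0) ->
  holomorphic_on U (fun x => (f x)^-1).
Proof.
move=> hf f0 x a Ux ax.
by apply: (derivableV _ (hf x a Ux ax)); rewrite /= cmapK // f0.
Qed.

Definition scale_cV (c : R[i]) : 'Hom('CC_R, 'cV[R[i]]_1) :=
  linfun (fun v : 'CC_R => (c * v)%:M : 'cV[R[i]]_1).

Lemma scale_cVE c v : scale_cV c v = (c * v)%:M.
Proof.
pose f (v : 'CC_R) : 'cV[R[i]]_1 := (c * v)%:M.
have lin : linear f.
  move=> k u w; rewrite /f mulrDr raddfD /=; congr (_ + _).
  by rewrite scale_scalar_mx; congr (_%:M); exact: mulrCA.
pose h := GRing.isLinear.Build _ _ _ _ _ lin.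
pose g : {linear 'CC_R -> 'cV[R[i]]_1} := HB.pack f h.
by rewrite /scale_cV (lfunE g).
Qed.

Lemma scale_cV_bij c : c != 0 -> bijective (scale_cV c).
Proof.
move=> c0; exists (fun v : 'cV[R[i]]_1 => c^-1 * v ord0 ord0 : 'CC_R).
  by move=> v; rewrite scale_cVE mxE eqxx mulr1n mulKf.
by move=> v; rewrite scale_cVE mulrA divff // mul1r -mx11_scalar.
Qed.

Program Definition trivial_line : bundle X 1 :=
  @Bundle R X 1 (fun=> 'CC_R) unit (fun=> setT) (fun _ _ => scale_cV 1)
    (fun _ _ _ => 1%:M) _ _ _ _ _.
Next Obligation. by move=> *; exact: openT. Qed.
Next Obligation. by move=> x; exists tt. Qed.
Next Obligation. by move=> *; apply: scale_cV_bij; rewrite oner_eq0. Qed.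
Next Obligation. by move=> *; rewrite mul1mx. Qed.
Next Obligation. by move=> i j k l; exact: holomorphic_on_cst. Qed.

(* With z the coordinate of a chart around p, O(-p) is trivialized by the
   section 1 away from p, and by the section z - z(p) near p.  The fibre at
   x != p is identified with C by the former, the fibre at p by the latter. *)
Definition chart_at (p : X) : atlas_ix X := projT1 (cid (atlas_cover X p)).

Lemma chart_atP (p : X) : cdom (atlas X (chart_at p)) p.
Proof. exact: projT2 (cid (atlas_cover X p)). Qed.

Definition centered (p x : X) : 'CC_R :=
  cmap (atlas X (chart_at p)) x - cmap (atlas X (chart_at p)) p.

Lemma centered_neq0 p x :
  cdom (atlas X (chart_at p)) x -> x != p -> centered p x != 0.
Proof.
move=> dx; apply: contra_neq => /subr0_eq e.
by rewrite -(cmapK dx) e cmapK //; exact: chart_atP.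
Qed.

Definition ideal_dom (p : X) (b : bool) : set X :=
  if b then cdom (atlas X (chart_at p)) else ~` [set p].

Definition ideal_triv (p : X) (b : bool) (x : X) : 'Hom('CC_R, 'cV[R[i]]_1) :=
  scale_cV (if b && (x != p) then (centered p x)^-1 else 1).

Definition ideal_trans (p : X) (b c : bool) (x : X) : 'CC_R :=
  match b, c with
  | false, true => (centered p x)^-1
  | true, false => centered p x
  | _, _ => 1
  end.

Lemma holomorphic_on_centered p (U : set X) :
  U `<=` ideal_dom p true -> holomorphic_on U (centered p).
Proof.
by move=> Up; apply/holomorphic_on_subr/holomorphic_on_cmap.
Qed.

Lemma holomorphic_mx_on_scalar1 (U : set X) (f : X -> 'CC_R) :
  holomorphic_on U f -> holomorphic_mx_on U (fun x => (f x)%:M : 'M[R[i]]_1).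
Proof.
move=> hf i j; suff -> : (fun x => ((f x)%:M : 'M[R[i]]_1) i j) = f by [].
by apply/funext => x; rewrite !ord1 mxE eqxx mulr1n.
Qed.

Program Definition ideal_line (p : X) : bundle X 1 :=
  @Bundle R X 1 (fun=> 'CC_R) bool (ideal_dom p) (ideal_triv p)
    (fun b c x => (ideal_trans p b c x)%:M) _ _ _ _ _.
Next Obligation.
move=> p [] /=; first exact: cdom_open.
apply: closed_openC; apply: accessible_closed_set1.
exact: hausdorff_accessible (@cpt_hausdorff _ X).
Qed.
Next Obligation.
move=> p x; have [->|/eqP xp] := eqVneq x p; last by exists false.
by exists true; exact: chart_atP.
Qed.
Next Obligation.
move=> p b x bx; apply: scale_cV_bij.
case: b bx => /= bx; last by rewrite oner_eq0.
have [_|xp] := eqVneq x p; first by rewrite oner_eq0.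
by rewrite invr_eq0 centered_neq0.
Qed.
Next Obligation.
move=> p b c x v bx cx.
rewrite !scale_cVE -scalar_mxM; congr (_%:M); rewrite mulrA; congr (_ * _).
case: b bx => /= bx; case: c cx => /= cx; rewrite ?mul1r ?mulr1 //.
- have xp : x != p by apply/eqP.
  by rewrite xp divff // centered_neq0.
- by have -> : x != p by apply/eqP.
Qed.
Next Obligation.
move=> p b c; apply: (@holomorphic_mx_on_scalar1 _ (ideal_trans p b c)).
case: b; case: c.
- exact: holomorphic_on_cst.
- by apply: holomorphic_on_centered => x [].
- apply: holomorphic_on_inv; first by apply: holomorphic_on_centered => x [].
  by move=> x [/eqP xp dx]; exact: centered_neq0.
- exact: holomorphic_on_cst.
Qed.

Definition pair_cV (r s : nat) (U V : vectType R[i])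
    (f : 'Hom(U, 'cV[R[i]]_r)) (g : 'Hom(V, 'cV[R[i]]_s)) :
    'Hom((U * V)%type, 'cV[R[i]]_(r + s)) :=
  linfun (fun v : (U * V)%type => col_mx (f v.1) (g v.2)).

Lemma pair_cVE r s (U V : vectType R[i]) (f : 'Hom(U, 'cV[R[i]]_r))
  (g : 'Hom(V, 'cV[R[i]]_s)) v : pair_cV f g v = col_mx (f v.1) (g v.2).
Proof.
pose p (v : (U * V)%type) := col_mx (f v.1) (g v.2).
have lin : linear p.
  by move=> k u w; rewrite /p !linearP scale_col_mx add_col_mx.
pose h := GRing.isLinear.Build _ _ _ _ _ lin.
pose l : {linear (U * V)%type -> 'cV[R[i]]_(r + s)} := HB.pack p h.
by rewrite /pair_cV (lfunE l).
Qed.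

Program Definition direct_sum (r s : nat) (E : bundle X r) (F : bundle X s) :
    bundle X (r + s) :=
  @Bundle R X (r + s) (fun x => (fib E x * fib F x)%type)
    (bix E * bix F)%type (fun k => bdom E k.1 `&` bdom F k.2)
    (fun k x => pair_cV (btriv E k.1 x) (btriv F k.2 x))
    (fun k l x => block_mx (btrans E k.1 l.1 x) 0 0 (btrans F k.2 l.2 x))
    _ _ _ _ _.
Next Obligation.
by move=> r s E F k; apply: openI; exact: bdom_open.
Qed.
Next Obligation.
move=> r s E F x.
by have [i ix] := bdom_cover E x; have [j jx] := bdom_cover F x; exists (i, j).
Qed.
Next Obligation.
move=> r s E F [i j] x [/= ix jx].
have [f fK Kf] := btriv_bij ix; have [g gK Kg] := btriv_bij jx.
exists (fun v : 'cV[R[i]]_(r + s) => (f (usubmx v), g (dsubmx v))) => [[u v]|v]; rewrite pair_cVE.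
  by rewrite col_mxKu col_mxKd fK gK.
by rewrite Kf Kg vsubmxK.
Qed.
Next Obligation.
move=> r s E F k l x v [ix jx] [ix' jx'].
rewrite !pair_cVE mul_block_col !mul0mx addr0 add0r.
by rewrite (btransE _ ix ix') (btransE _ jx jx').
Qed.
Next Obligation.
move=> r s E F k l i j.
have -> : (fun x => block_mx (btrans E k.1 l.1 x) 0 0 (btrans F k.2 l.2 x) i j)
    = (fun x => match fintype.split i, fintype.split j with
                | inl i', inl j' => btrans E k.1 l.1 x i' j'
                | inr i', inr j' => btrans F k.2 l.2 x i' j'
                | _, _ => 0
                end).
  apply/funext => x; rewrite mxE; case: (fintype.split i) => i'; rewrite mxE;
  by case: (fintype.split j) => j'; rewrite ?mxE.
case: (fintype.split i) => i'; case: (fintype.split j) => j'.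
- by move=> x a [[? _] [? _]]; exact: btrans_hol.
- exact: holomorphic_on_cst.
- exact: holomorphic_on_cst.
- by move=> x a [[_ ?] [_ ?]]; exact: btrans_hol.
Qed.

End Constructions.

Arguments trivial_line {R} X.

(* Main.v *)
Require Import Defs.
From HB Require Import structures.
From mathcomp Require Import all_boot all_order all_algebra.
From mathcomp Require Import complex.
From mathcomp Require Import all_classical all_reals all_analysis.
From mathcomp Require Import ring lra zify.

Set Implicit Arguments.
Unset Strict Implicit.
Unset Printing Implicit Defensive.

Import Order.TTheory GRing.Theory Num.Theory.
Import numFieldNormedType.Exports.

Local Open Scope classical_set_scope.
Local Open Scope ring_scope.

Local Notation "''CC_' R" := (R[i]^o) (at level 8, R at level 2).
Local Notation Re := complex.Re.
Local Notation Im := complex.Im.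

(** The first three claims come down to one fact about the elliptic curve
    [X = C / L]: a nonzero meromorphic function on [X] has a divisor of degree 0
    ([degree_of_principal_divisor]).  The fourth is local at [p].

    A meromorphic function on [X] is a doubly periodic function on the plane, and
    its degree is the integral of its logarithmic derivative along the boundary
    of a fundamental parallelogram, up to the nonzero integral of [1 / z]
    ([argument_principle]); opposite sides cancel ([doubly_periodic_degree]).
    The complex analysis needed for this is developed for contours that are
    parallelograms: Goursat's theorem, Cauchy's formula, removable
    singularities, and the dichotomy between functions that vanish identically
    near a point and functions that have a finite order there.  The integral of
    [1 / (z - w)] is shown to be nonzero and independent of [w], and is never
    evaluated.  The orders on [X] refer to its charts; they agree with the orders
    in the plane because the uniformisation, read in a chart, is locally
    injective and hence has a nonzero derivative ([injective_derivative_neq0]).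

    Let [M] be a line subbundle of the trivial bundle [E] of rank 2.  One of the
    two projections of [E] restricts to a nonzero map from [M] to the trivial
    line bundle.  It takes a meromorphic section of [M] to a meromorphic function
    whose divisor is at least that of the section, so [M] has degree at most 0
    ([degree_le0]).  This makes [E] semistable.  A line in the plane spans a
    constant line subbundle of degree 0 with that line as its fibre at [p]; such
    subbundles are maximal, so every line is bad, [E] is not stable, and the
    instability degree is 0.

    Let [alpha : F -> E] be a Hecke modification at [p], and let [lambda] be a
    nonzero linear form on the plane that kills the image of [alpha] at [p].
    Completing [lambda] to a basis [mu, lambda] of constant forms, the pair
    [(mu alpha, lambda alpha)] maps [F] to the direct sum of the trivial bundle
    and the ideal sheaf [O(-p)], since [lambda alpha] vanishes at [p].  It is
    invertible off [p] along with [alpha].  At [p] it is invertible because the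
    determinant of [alpha] has a simple zero there, exactly cancelled by the
    division of [lambda alpha] by the local coordinate ([reduced_matrix]). *)

(** * The modulus, and limits in terms of it *)
Section Modulus.
Variable R : realType.
Local Notation C := 'CC_R.

Definition modulus (z : C) : R := Normc.normc z.

Lemma normC_modulus (z : C) : `|z| = ((modulus z)%:C)%C.
Proof. by []. Qed.

Lemma modulus_ge0 (z : C) : 0 <= modulus z.
Proof. by case: z => a b; exact: sqrtr_ge0. Qed.

Lemma modulusM (z w : C) : modulus (z * w) = modulus z * modulus w.
Proof. exact: Normc.normcM. Qed.

Lemma modulusV (z : C) : modulus z^-1 = (modulus z)^-1.
Proof. exact: Normc.normcV. Qed.

Lemma modulusD (z w : C) : modulus (z + w) <= modulus z + modulus w.
Proof. exact: le_normcD. Qed.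

Lemma modulusN (z : C) : modulus (- z) = modulus z.
Proof. exact: normcN. Qed.

Lemma modulus0 : modulus 0 = 0.
Proof. exact: Normc.normc0. Qed.

Lemma modulus1 : modulus 1 = 1.
Proof. exact: Normc.normc1. Qed.

Lemma modulus_eq0 (z : C) : (modulus z == 0) = (z == 0).
Proof.
apply/eqP/eqP => [|->]; last exact: modulus0.
exact: Normc.eq0_normc.
Qed.

Lemma modulus_gt0 (z : C) : (0 < modulus z) = (z != 0).
Proof. by rewrite lt_neqAle modulus_ge0 andbT eq_sym modulus_eq0. Qed.

Lemma modulusB (z w : C) : modulus (z - w) = modulus (w - z).
Proof. by rewrite -modulusN opprB. Qed.

Lemma modulusX (z : C) n : modulus (z ^+ n) = modulus z ^+ n.
Proof.
by elim: n => [|n IH]; rewrite ?expr0 ?modulus1// !exprS modulusM IH.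
Qed.

Lemma modulus_real (a : R) : modulus (a%:C)%C = `|a|.
Proof. by rewrite /modulus /= expr0n /= addr0 sqrtr_sqr. Qed.

Lemma Re_le_modulus (z : C) : `|Re z| <= modulus z.
Proof.
by case: z => a b /=; rewrite /modulus /= -sqrtr_sqr ler_wsqrtr// lerDl sqr_ge0.
Qed.

Lemma Im_le_modulus (z : C) : `|Im z| <= modulus z.
Proof.
by case: z => a b /=; rewrite /modulus /= -sqrtr_sqr ler_wsqrtr// lerDr sqr_ge0.
Qed.

Lemma modulus_le (z : C) : modulus z <= `|Re z| + `|Im z|.
Proof.
have -> : modulus z = modulus ((Re z)%:C%C + (Im z)%:C%C * ('i)%C).
  by congr modulus; case: z => a b; apply/eqP; rewrite eq_complex /=; apply/andP; split; apply/eqP; ring.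
apply: le_trans (modulusD _ _) _; rewrite modulusM !modulus_real.
have -> : modulus ('i)%C = 1 by rewrite /modulus /= expr0n expr1n add0r sqrtr1.
by rewrite mulr1.
Qed.

Lemma modulusBle (z w : C) : modulus z - modulus w <= modulus (z - w).
Proof. by rewrite lerBlDr -{1}(subrK w z) modulusD. Qed.

Lemma nbhsCP (z : C) (P : set C) :
  nbhs z P <-> exists2 e : R, 0 < e & forall y, modulus (y - z) < e -> P y.
Proof.
split.
  move/nbhs_ballP => [[e f] /=]; rewrite ltcE /= => /andP[/eqP f0 e0] h.
  rewrite f0 in h => {f f0}.
  exists e => // y yz; apply: h.
  by rewrite -ball_normE /= distrC normC_modulus ltcR.
move=> [e e0 h]; apply/nbhs_ballP; exists (e%:C)%C => /=; first by rewrite ltcR.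
by move=> y; rewrite -ball_normE /= distrC normC_modulus ltcR => /h.
Qed.

Lemma continuousCP (T : topologicalType) (f : T -> C) (x : T) :
  {for x, continuous f} <->
  forall e : R, 0 < e -> \forall y \near x, modulus (f y - f x) < e.
Proof.
split => [cf e e0|h].
  by apply: (cf [set y | modulus (y - f x) < e]); apply/nbhsCP; exists e.
move=> P /nbhsCP[e e0 eP]; rewrite nbhs_filterE.
by near=> y; apply: eP; near: y; exact: h.
Unshelve. all: by end_near.
Qed.

Lemma continuousRP (T : topologicalType) (f : T -> R) (x : T) :
  {for x, continuous f} <->
  forall e : R, 0 < e -> \forall y \near x, `|f y - f x| < e.
Proof.
split => [/cvgrPdist_lt cf e e0|h].
  by apply: filterS (cf e e0) => y; rewrite distrC.
apply/cvgrPdist_lt => e e0.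
by apply: filterS (h e e0) => y; rewrite distrC.
Qed.

Lemma continuous_modulus (z : C) : {for z, continuous modulus}.
Proof.
apply/continuousRP => e e0; apply/nbhsCP; exists e => // y; apply: le_lt_trans.
by rewrite ler_norml modulusBle andbT lerNl opprB modulusB modulusBle.
Qed.

Lemma continuous_Re (z : C) : {for z, continuous (@Re R : C -> R)}.
Proof.
apply/continuousRP => e e0; apply/nbhsCP; exists e => // y; apply: le_lt_trans.
by rewrite -raddfB; exact: Re_le_modulus.
Qed.

Lemma continuous_Im (z : C) : {for z, continuous (@Im R : C -> R)}.
Proof.
apply/continuousRP => e e0; apply/nbhsCP; exists e => // y; apply: le_lt_trans.
by rewrite -raddfB; exact: Im_le_modulus.
Qed.

(** * Complex derivatives *)

Definition complex_derivative (f : C -> C) (z l : C) :=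
  forall e : R, 0 < e -> exists2 d : R, 0 < d &
    forall h, modulus h < d -> modulus (f (z + h) - f z - l * h) <= e * modulus h.

Lemma diff_quotientE (f : C -> C) (z l k : C) : k != 0 ->
  k^-1 *: (f (k *: (1 : C) + z) - f z) - l = k^-1 * (f (z + k) - f z - l * k).
Proof.
move=> k0; have -> : k *: (1 : C) + z = z + k by rewrite [k *: _]mulr1 addrC.
have -> (a b : C) : a *: b = a * b by [].
by field.
Qed.

Lemma complex_derivativeP (f : C -> C) (z l : C) :
  complex_derivative f z l <-> is_derive z (1 : C) f l.
Proof.
split => [h|[df <-]].
  have cv : h^-1 *: ((f \o shift z) (h *: (1 : C)) - f z) @[h --> (0 : C)^'] --> l.
    move=> P /nbhsCP[e e0 eP]; rewrite /= nbhs_filterE.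
    have e20 : 0 < e / 2 by rewrite divr_gt0.
    have [d d0 dh] := h _ e20.
    apply/nbhsCP; exists d => // k; rewrite subr0 => kd k0; apply: eP => /=.
    rewrite diff_quotientE//.
    rewrite modulusM modulusV mulrC ltr_pdivrMr ?modulus_gt0//.
    apply: le_lt_trans (dh _ kd) _; rewrite ltr_pM2r ?modulus_gt0//.
    by rewrite ltr_pdivrMr// ltr_pMr// ltr1n.
  split; first by apply/cvg_ex; exists l.
  exact: cvg_lim.
move=> e e0.
have /= := df; move/cvg_ex => -[l' cv].
have -> : 'D_1 f z = l' by apply: cvg_lim.
have : nbhs l' [set y : C | modulus (y - l') < e] by apply/nbhsCP; exists e.
move/cv; rewrite /= nbhs_filterE => /nbhsCP[d d0 dP]; exists d => // k kd.
have [->|k0] := eqVneq k 0; first by rewrite addr0 subrr mulr0 subrr modulus0 mulr0.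
have := dP k; rewrite subr0 => /(_ kd k0) /=.
rewrite diff_quotientE//.
by rewrite modulusM modulusV mulrC ltr_pdivrMr ?modulus_gt0// => /ltW.
Qed.

Lemma derivableCP (f : C -> C) (z : C) :
  derivable f z 1 <-> exists l, complex_derivative f z l.
Proof.
split => [df|[l /complex_derivativeP[]//]].
by exists ('D_1 f z); apply/complex_derivativeP/derivableP.
Qed.

Lemma complex_derivativeE (f : C -> C) (z l : C) :
  complex_derivative f z l -> 'D_1 f z = l.
Proof. by move/complex_derivativeP => -[]. Qed.

Lemma derivative_derivable (f : C -> C) (z l : C) :
  complex_derivative f z l -> derivable f z 1.
Proof. by move/complex_derivativeP => -[]. Qed.

Lemma derivable_derivative (f : C -> C) (z : C) :
  derivable f z 1 -> complex_derivative f z ('D_1 f z).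
Proof. by move=> df; apply/complex_derivativeP/derivableP. Qed.

Lemma derivative_unique (f : C -> C) (z l l' : C) :
  complex_derivative f z l -> complex_derivative f z l' -> l = l'.
Proof. by move=> /complex_derivativeE <- /complex_derivativeE <-. Qed.

Lemma derivative_cst (c z : C) : complex_derivative (fun=> c) z 0.
Proof. by apply/complex_derivativeP; exact: is_derive_cst. Qed.

Lemma derivative_id (z : C) : complex_derivative id z 1.
Proof. by apply/complex_derivativeP; exact: is_derive_id. Qed.

Lemma derivativeD (f g : C -> C) (z a b : C) :
  complex_derivative f z a -> complex_derivative g z b ->
  complex_derivative (fun y => f y + g y) z (a + b).
Proof.
by move=> /complex_derivativeP ? /complex_derivativeP ?; apply/complex_derivativeP; exact: is_deriveD.
Qed.

Lemma derivativeB (f g : C -> C) (z a b : C) :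
  complex_derivative f z a -> complex_derivative g z b ->
  complex_derivative (fun y => f y - g y) z (a - b).
Proof.
by move=> /complex_derivativeP ? /complex_derivativeP ?; apply/complex_derivativeP; exact: is_deriveB.
Qed.

Lemma derivativeM (f g : C -> C) (z a b : C) :
  complex_derivative f z a -> complex_derivative g z b ->
  complex_derivative (fun y => f y * g y) z (f z * b + g z * a).
Proof.
by move=> /complex_derivativeP ? /complex_derivativeP ?; apply/complex_derivativeP; exact: is_deriveM.
Qed.

Lemma derivativeV (f : C -> C) (z a : C) : f z != 0 ->
  complex_derivative f z a ->
  complex_derivative (fun y => (f y)^-1) z (- (f z)^-2 * a).
Proof.
move=> f0 /complex_derivativeP[df <-]; apply/complex_derivativeP.
by split; [exact: derivableV|exact: deriveV].
Qed.

Lemma derivative_near_eq (f g : C -> C) (z a : C) :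
  (\forall y \near z, f y = g y) ->
  complex_derivative f z a -> complex_derivative g z a.
Proof.
move=> /nbhsCP[r r0 fg] hf e e0; have [d d0 dh] := hf e e0.
exists (Num.min d r) => [|h]; first by rewrite lt_min d0.
rewrite lt_min => /andP[hd hr].
rewrite -!fg ?subrr ?modulus0//; first exact: dh.
by rewrite addrC addKr.
Qed.

Lemma derivative_continuous (f : C -> C) (z a : C) :
  complex_derivative f z a -> {for z, continuous f}.
Proof.
move=> hf; apply/continuousCP => e e0.
have [d d0 dh] := hf 1 ltr01.
pose k := 1 + modulus a.
have k0 : 0 < k by rewrite ltr_wpDr// modulus_ge0.
apply/nbhsCP; exists (Num.min d (e / k)) => [|y]; first by rewrite lt_min d0 divr_gt0.
rewrite lt_min => /andP[yd]; rewrite ltr_pdivlMr// => ye.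
apply: le_lt_trans ye.
have := dh _ yd; rewrite [z + _]addrC subrK => H.
have -> : f y - f z = (f y - f z - a * (y - z)) + a * (y - z) by rewrite subrK.
apply: le_trans (modulusD _ _) _; rewrite modulusM /k [leRHS]mulrDr mulr1.
by rewrite mul1r in H; rewrite [_ * modulus a]mulrC lerD2r.
Qed.

Lemma derivable_continuousC (f : C -> C) (z : C) :
  derivable f z 1 -> {for z, continuous f}.
Proof. by move=> /derivableCP[l]; exact: derivative_continuous. Qed.

Lemma derivative_comp (f g : C -> C) (z a b : C) :
  complex_derivative f z a -> complex_derivative g (f z) b ->
  complex_derivative (g \o f) z (b * a).
Proof.
move=> hf hg e e0.
have ka := modulus_ge0 a; have kb := modulus_ge0 b.
pose e1 := e / (2 * (1 + modulus a)); pose e2 := Num.min 1 (e / (2 * (1 + modulus b))).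
have a0 : 0 < 1 + modulus a by rewrite ltr_wpDr.
have b0 : 0 < 1 + modulus b by rewrite ltr_wpDr.
have e10 : 0 < e1 by rewrite divr_gt0// mulr_gt0.
have e20 : 0 < e2 by rewrite lt_min ltr01 divr_gt0// mulr_gt0.
have [dg dg0 hdg] := hg _ e10; have [df df0 hdf] := hf _ e20.
exists (Num.min df (dg / (1 + modulus a))) => [|h].
  by rewrite lt_min df0 divr_gt0.
rewrite lt_min => /andP[hd]; rewrite ltr_pdivlMr// => hd2.
pose k := f (z + h) - f z.
have H1 := hdf _ hd; rewrite -/k in H1.
have kh : modulus k <= modulus h * (1 + modulus a).
  have -> : k = (k - a * h) + a * h by rewrite subrK.
  apply: le_trans (modulusD _ _) _; rewrite modulusM [leRHS]mulrDr mulr1.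
  rewrite [modulus a * _]mulrC lerD2r; apply: le_trans H1 _.
  by rewrite ler_piMl ?modulus_ge0// ge_min lexx.
have := hdg k (le_lt_trans kh hd2).
have -> : f z + k = f (z + h) by rewrite /k addrC subrK.
move=> H2 /=.
have -> : g (f (z + h)) - g (f z) - b * a * h =
  (g (f (z + h)) - g (f z) - b * k) + b * (k - a * h) by ring.
apply: le_trans (modulusD _ _) _; rewrite modulusM.
have -> : e * modulus h = e / 2 * modulus h + e / 2 * modulus h by field.
apply: lerD.
  apply: le_trans H2 _; apply: le_trans (_ : e1 * (modulus h * (1 + modulus a)) <= _).
    by rewrite ler_pM2l.
  by rewrite le_eqVlt; apply/orP; left; apply/eqP; rewrite /e1; field; rewrite lt0r_neq0.
apply: le_trans (_ : (1 + modulus b) * (e / (2 * (1 + modulus b)) * modulus h) <= _); last first.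
  by rewrite le_eqVlt; apply/orP; left; apply/eqP; field; rewrite lt0r_neq0.
apply: ler_pM; rewrite ?modulus_ge0// ?lerDr//.
apply: le_trans H1 _; apply: ler_wpM2r; first exact: modulus_ge0.
by rewrite ge_min lexx orbT.
Qed.

Lemma derivable_compC (f g : C -> C) (z : C) :
  derivable f z 1 -> derivable g (f z) 1 -> derivable (g \o f) z 1.
Proof.
move=> /derivableCP[a ha] /derivableCP[b hb]; apply/derivableCP.
by exists (b * a); exact: derivative_comp.
Qed.

End Modulus.

(** * Integrals of complex functions of a real variable *)
Section PathIntegral.
Variable R : realType.
Local Notation C := 'CC_R.
Implicit Types (g G : R -> C) (x y t : R).

Lemma real_derivativeP (f : R -> R) (t l : R) :
  (forall e : R, 0 < e -> exists2 d : R, 0 < d &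
    forall h, `|h| < d -> `|f (t + h) - f t - l * h| <= e * `|h|) ->
  is_derive t (1 : R) f l.
Proof.
move=> H.
have cv : h^-1 *: ((f \o shift t) (h *: (1 : R)) - f t) @[h --> (0 : R)^'] --> l.
  apply/cvgrPdist_lt => e e0.
  have e20 : 0 < e / 2 by rewrite divr_gt0.
  have [d d0 dh] := H _ e20.
  apply/nbhs_ballP; exists d => //= k; rewrite -ball_normE /= sub0r normrN => kd k0.
  have -> : l - k^-1 *: (f (k *: (1 : R) + t) - f t)
      = - (k^-1 * (f (t + k) - f t - l * k)).
    have -> : k *: (1 : R) + t = t + k by rewrite [k *: _]mulr1 addrC.
    have -> (a b : R) : a *: b = a * b by [].
    by field.
  rewrite normrN normrM normfV mulrC ltr_pdivrMr ?normr_gt0//.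
  apply: le_lt_trans (dh _ kd) _; rewrite ltr_pM2r ?normr_gt0//.
  by rewrite ltr_pdivrMr// ltr_pMr// ltr1n.
split; first by apply/cvg_ex; exists l.
exact: cvg_lim.
Qed.

Lemma real_primitive_exists (f : R -> R) x y : x <= y ->
  (forall t, x <= t <= y -> {for t, continuous f}) ->
  exists F : R -> R, forall t, x <= t <= y -> is_derive t (1 : R) F (f t).
Proof.
move=> xy cf.
(* [f] is extended by constants, so as to be continuous on a larger interval *)
pose c t := Num.max x (Num.min y t).
have cin t : x <= c t <= y.
  by rewrite /c le_max lexx /= ge_max xy /= ge_min lexx.
have cid t : x <= t <= y -> c t = t.
  by move=> /andP[xt ty]; rewrite /c; move/min_idPr: ty => ->; apply/max_idPr.
have cfc t : {for t, continuous (f \o c)}.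
  apply: continuous_comp; last exact: cf.
  apply: (@continuous_max R R^o (fun=> x) (fun t => Num.min y t)); first exact: cvg_cst.
  apply: (@continuous_min R R^o (fun=> y) id); [exact: cvg_cst|exact: cvg_id].
have xy1 : x - 1 < y + 1 by lra.
pose F t := (\int[lebesgue_measure]_(s in [set` `[x - 1, t]]) (f \o c) s)%R.
exists F => t txy; move: (txy) => /andP[xt ty].
have [||||dF F'] := @continuous_FTC1_closed R (f \o c) (x - 1) t (y + 1).
- by lra.
- apply: continuous_compact_integrable; first exact: segment_compact.
  by apply: continuous_subspaceT => s; exact: cfc.
- by lra.
- exact: cfc.
rewrite -(cid _ txy) -[f _]/((f \o c) t) -F' derive1E {1}(cid _ txy).
exact: derivableP.
Qed.

(** The two components are differentiated apart: real integrals and the mean value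
    theorem apply to each. *)
Definition primitive_on g G x y := forall t, x <= t <= y ->
  is_derive t (1 : R) (fun s => Re (G s)) (Re (g t)) /\
  is_derive t (1 : R) (fun s => Im (G s)) (Im (g t)).

Definition continuous_on g x y :=
  forall t, x <= t <= y -> {for t, continuous g}.

Lemma primitive_exists g x y : x <= y -> continuous_on g x y ->
  exists G, primitive_on g G x y.
Proof.
move=> xy cg.
have [|F1 h1] := @real_primitive_exists (fun t => Re (g t)) x y xy.
  by move=> t /cg ct; apply: (continuous_comp ct); exact: continuous_Re.
have [|F2 h2] := @real_primitive_exists (fun t => Im (g t)) x y xy.
  by move=> t /cg ct; apply: (continuous_comp ct); exact: continuous_Im.
by exists (fun t => (F1 t +i* F2 t)%C) => t txy; split => /=; [exact: h1|exact: h2].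
Qed.

Lemma real_MVT (f f' : R -> R) x y : x <= y ->
  (forall t, x <= t <= y -> is_derive t (1 : R) f (f' t)) ->
  exists2 c, x <= c <= y & f y - f x = f' c * (y - x).
Proof.
move=> xy df.
have [|||c] := @MVT_segment R f f' x y.
- exact: xy.
- by move=> t; rewrite in_itv /= => /andP[a b]; apply: df; rewrite (ltW a) (ltW b).
- apply: derivable_within_continuous => t; rewrite in_itv /= => h.
  by have [] := df _ h.
by rewrite in_itv /=; exists c.
Qed.

(** Of all the primitives, any one defines the same integral. *)
Definition cint g x y : C :=
  xget 0 [set c | exists2 G, primitive_on g G x y & c = G y - G x].

Lemma cintE g G x y : x <= y -> primitive_on g G x y -> cint g x y = G y - G x.
Proof.
move=> xy pG; rewrite /cint; case: xgetP => [c _ [H pH ->]|/(_ (G y - G x))[]]; last first.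
  by exists G.
have dif (p : C -> R) : (forall a b : C, p (a - b) = p a - p b) ->
    (forall t, x <= t <= y -> is_derive t (1 : R) (fun s => p (G s)) (p (g t))) ->
    (forall t, x <= t <= y -> is_derive t (1 : R) (fun s => p (H s)) (p (g t))) ->
    p (H y - H x) = p (G y - G x).
  move=> pB dG dH.
  have [t txy|t _] := @real_MVT (fun s => p (H s) - p (G s)) (fun=> 0) x y xy.
    rewrite -(subrr (p (g t))).
    by apply: (@is_deriveB _ _ _ (fun s => p (H s)) (fun s => p (G s))); [exact: dH|exact: dG].
  rewrite mul0r !pB => /eqP; rewrite subr_eq0 => /eqP h.
  by lra.
apply/eqP; rewrite eq_complex; apply/andP; split; apply/eqP.
- by apply: dif => // [a b|t /pG[]|t /pH[]]//; rewrite raddfB.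
- by apply: dif => // [a b|t /pG[]|t /pH[]]//; rewrite raddfB.
Qed.

Lemma eq_cint g1 g2 x y : (forall t, x <= t <= y -> g1 t = g2 t) ->
  cint g1 x y = cint g2 x y.
Proof.
move=> e12; rewrite /cint; congr (xget 0 _); apply/seteqP.
by split => c [G pG ->]; exists G => // t txy; have := pG t txy; rewrite e12.
Qed.

Lemma cint_chasles g x y z : x <= y -> y <= z -> continuous_on g x z ->
  cint g x z = cint g x y + cint g y z.
Proof.
move=> xy yz cg; have xz := le_trans xy yz.
have [G pG] := primitive_exists xz cg.
rewrite (cintE xz pG) (@cintE g G x y)//; last first.
  by move=> t /andP[xt ty]; apply: pG; rewrite xt (le_trans ty).
rewrite (@cintE g G y z)//; last first.
  by move=> t /andP[xt ty]; apply: pG; rewrite ty (le_trans xy).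
by ring.
Qed.

Lemma cintD g1 g2 x y : x <= y -> continuous_on g1 x y -> continuous_on g2 x y ->
  cint (fun t => g1 t + g2 t) x y = cint g1 x y + cint g2 x y.
Proof.
move=> xy c1 c2.
have [G1 p1] := primitive_exists xy c1; have [G2 p2] := primitive_exists xy c2.
rewrite (cintE xy p1) (cintE xy p2) (@cintE _ (fun t => G1 t + G2 t))//.
  by ring.
move=> t txy; have [a1 b1] := p1 t txy; have [a2 b2] := p2 t txy.
split; rewrite raddfD.
  rewrite (_ : (fun s => Re _) = fun s => Re (G1 s) + Re (G2 s)); last by apply/funext => s; rewrite raddfD.
  exact: (@is_deriveD _ _ _ (fun s => Re (G1 s)) (fun s => Re (G2 s))).
rewrite (_ : (fun s => Im _) = fun s => Im (G1 s) + Im (G2 s)); last by apply/funext => s; rewrite raddfD.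
exact: (@is_deriveD _ _ _ (fun s => Im (G1 s)) (fun s => Im (G2 s))).
Qed.

Lemma cintZ (a : C) g x y : x <= y -> continuous_on g x y ->
  cint (fun t => a * g t) x y = a * cint g x y.
Proof.
move=> xy c1; have [G1 p1] := primitive_exists xy c1.
rewrite (cintE xy p1) (@cintE _ (fun t => a * G1 t))//; first by rewrite mulrBr.
have ReM (u v : C) : Re (u * v) = Re u * Re v - Im u * Im v by case: u v => [? ?] [? ?].
have ImM (u v : C) : Im (u * v) = Re u * Im v + Im u * Re v by case: u v => [? ?] [? ?].
move=> t txy; have [a1 b1] := p1 t txy; split.
  rewrite (_ : (fun s => Re _) = fun s => Re a * Re (G1 s) - Im a * Im (G1 s)); last by apply/funext => s; rewrite ReM.
  rewrite ReM.
  apply: (@is_deriveB _ _ _ (fun s => Re a * Re (G1 s)) (fun s => Im a * Im (G1 s))).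
rewrite (_ : (fun s => Im _) = fun s => Re a * Im (G1 s) + Im a * Re (G1 s)); last by apply/funext => s; rewrite ImM.
rewrite ImM.
apply: (@is_deriveD _ _ _ (fun s => Re a * Im (G1 s)) (fun s => Im a * Re (G1 s))).
Qed.

Lemma cint0 x y : x <= y -> cint (fun=> 0) x y = 0.
Proof.
move=> xy; rewrite (@cintE _ (fun=> 0)) ?subrr// => t _ /=.
by split; exact: is_derive_cst.
Qed.

Lemma cint_Im_mean g x y : x <= y -> continuous_on g x y ->
  exists2 c, x <= c <= y & Im (cint g x y) = Im (g c) * (y - x).
Proof.
move=> xy cg; have [G pG] := primitive_exists xy cg.
have [t /pG[]//|c cxy e] := @real_MVT (fun s => Im (G s)) (fun t => Im (g t)) x y xy.
by exists c => //; rewrite (cintE xy pG) raddfB.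
Qed.

Lemma cint_Re_mean g x y : x <= y -> continuous_on g x y ->
  exists2 c, x <= c <= y & Re (cint g x y) = Re (g c) * (y - x).
Proof.
move=> xy cg; have [G pG] := primitive_exists xy cg.
have [t /pG[]//|c cxy e] := @real_MVT (fun s => Re (G s)) (fun t => Re (g t)) x y xy.
by exists c => //; rewrite (cintE xy pG) raddfB.
Qed.

(** The factor 2 comes from bounding the real and imaginary parts apart. *)
Lemma modulus_cint_le g x y M : x <= y -> continuous_on g x y ->
  (forall t, x <= t <= y -> modulus (g t) <= M) ->
  modulus (cint g x y) <= 2 * M * (y - x).
Proof.
move=> xy cg gM.
have [c1 c1xy e1] := cint_Re_mean xy cg; have [c2 c2xy e2] := cint_Im_mean xy cg.
apply: le_trans (modulus_le _) _; rewrite e1 e2 !normrM.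
have yx : 0 <= y - x by rewrite subr_ge0.
rewrite !(ger0_norm yx) -mulrDl ler_wpM2r// mulr2n mulrDl mul1r.
apply: lerD.
  exact: le_trans (Re_le_modulus _) (gM _ c1xy).
exact: le_trans (Im_le_modulus _) (gM _ c2xy).
Qed.

Lemma path_derivative (F : C -> C) (a v l : C) t :
  complex_derivative F (a + t%:C%C * v) l ->
  is_derive t (1 : R) (fun s => Re (F (a + s%:C%C * v))) (Re (v * l)) /\
  is_derive t (1 : R) (fun s => Im (F (a + s%:C%C * v))) (Im (v * l)).
Proof.
move=> dF.
have H e : 0 < e -> exists2 d : R, 0 < d & forall h, `|h| < d ->
    modulus (F (a + (t + h)%:C%C * v) - F (a + t%:C%C * v) - h%:C%C * (v * l)) <= e * `|h|.
  move=> e0; have v0 : 0 < 1 + modulus v by rewrite ltr_wpDr// modulus_ge0.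
  have [|d d0 dh] := dF (e / (1 + modulus v)); first by rewrite divr_gt0.
  exists (d / (1 + modulus v)) => [|h]; first by rewrite divr_gt0.
  rewrite ltr_pdivlMr// => hd.
  have hv : modulus (h%:C%C * v) <= `|h| * (1 + modulus v).
    by rewrite modulusM modulus_real ler_wpM2l// lerDr.
  have := dh _ (le_lt_trans hv hd).
  have -> : a + t%:C%C * v + h%:C%C * v = a + (t + h)%:C%C * v by rewrite rmorphD /=; ring.
  have -> : l * (h%:C%C * v) = h%:C%C * (v * l) by ring.
  move=> /le_trans; apply.
  by rewrite -mulrA ler_pM2l// mulrC ler_pdivrMr.
have ReZ (h : R) (u : C) : Re (h%:C%C * u) = Re u * h by case: u => p q /=; ring.
have ImZ (h : R) (u : C) : Im (h%:C%C * u) = Im u * h by case: u => p q /=; ring.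
split; apply: real_derivativeP => e e0; have [d d0 dh] := H e e0; exists d => // h hd.
  rewrite -ReZ -!raddfB; exact: le_trans (Re_le_modulus _) (dh _ hd).
rewrite -ImZ -!raddfB; exact: le_trans (Im_le_modulus _) (dh _ hd).
Qed.

Lemma cint_FTC (F f : C -> C) (a v : C) x y : x <= y ->
  (forall t, x <= t <= y -> complex_derivative F (a + t%:C%C * v) (f (a + t%:C%C * v))) ->
  cint (fun t => v * f (a + t%:C%C * v)) x y = F (a + y%:C%C * v) - F (a + x%:C%C * v).
Proof.
move=> xy dF; rewrite (@cintE _ (fun t => F (a + t%:C%C * v)))// => t txy.
by have := dF _ txy; exact: path_derivative.
Qed.

End PathIntegral.

(** * Cauchy's theorem for parallelograms *)
Section Parallelogram.
Variable R : realType.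
Local Notation C := 'CC_R.

Definition orientation (v1 v2 : C) : R := Re v1 * Im v2 - Im v1 * Re v2.

Variables v1 v2 : C.
Hypothesis v12 : 0 < orientation v1 v2.

Local Notation K := (modulus v1 + modulus v2).

Definition pt (s t : R) : C := s%:C%C * v1 + t%:C%C * v2.

Definition coord1 (z : C) : R := orientation z v2 / orientation v1 v2.
Definition coord2 (z : C) : R := orientation v1 z / orientation v1 v2.

Lemma pt_coord (z : C) : pt (coord1 z) (coord2 z) = z.
Proof.
move: v12; rewrite /pt /coord1 /coord2 /orientation.
case: v1 v2 z => [a b] [c d] [x y] /= J0.
apply/eqP; rewrite eq_complex /=; apply/andP; split; apply/eqP; field; exact: lt0r_neq0.
Qed.

Lemma ptB s t s' t' : pt s t - pt s' t' = pt (s - s') (t - t').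
Proof. by rewrite /pt !rmorphB /=; ring. Qed.

Lemma ptD s t s' t' : pt s t + pt s' t' = pt (s + s') (t + t').
Proof. by rewrite /pt !rmorphD /=; ring. Qed.

Lemma coord1_pt s t : coord1 (pt s t) = s.
Proof.
move: v12; rewrite /coord1 /pt /orientation.
case: v1 v2 => [a b] [c d] /= J0; field; exact: lt0r_neq0.
Qed.

Lemma coord2_pt s t : coord2 (pt s t) = t.
Proof.
move: v12; rewrite /coord2 /pt /orientation.
case: v1 v2 => [a b] [c d] /= J0; field; exact: lt0r_neq0.
Qed.

Lemma K_gt0 : 0 < K.
Proof.
rewrite ltr_wpDl ?modulus_ge0// modulus_gt0; apply/eqP => v20.
by move: v12; rewrite v20 /orientation /= !mulr0 subrr ltxx.
Qed.

Lemma modulus_pt s t : modulus (pt s t) <= K * (`|s| + `|t|).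
Proof.
apply: le_trans (modulusD _ _) _; rewrite !modulusM !modulus_real.
have := modulus_ge0 v1; have := modulus_ge0 v2; have := normr_ge0 s; have := normr_ge0 t.
by nra.
Qed.

Lemma orientation_le (z w : C) : `|orientation z w| <= 2 * (modulus z * modulus w).
Proof.
apply: le_trans (ler_normB _ _) _; rewrite !normrM mulr2n mulrDl mul1r.
by apply: lerD; apply: ler_pM; rewrite // ?Re_le_modulus ?Im_le_modulus.
Qed.

(** By Cramer's rule, a coordinate is a quotient of two orientations. *)
Lemma coord_le_modulus s t :
  `|s| + `|t| <= 4 * K / orientation v1 v2 * modulus (pt s t).
Proof.
have h1 : `|s| <= 2 * K / orientation v1 v2 * modulus (pt s t).
  rewrite -{1}(coord1_pt s t) /coord1 normrM normfV (gtr0_norm v12).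
  rewrite mulrAC ler_pM2r ?invr_gt0//; apply: le_trans (orientation_le _ _) _.
  have := modulus_ge0 v1; have := modulus_ge0 v2; have := modulus_ge0 (pt s t); nra.
have h2 : `|t| <= 2 * K / orientation v1 v2 * modulus (pt s t).
  rewrite -{1}(coord2_pt s t) /coord2 normrM normfV (gtr0_norm v12).
  rewrite mulrAC ler_pM2r ?invr_gt0//; apply: le_trans (orientation_le _ _) _.
  have := modulus_ge0 v1; have := modulus_ge0 v2; have := modulus_ge0 (pt s t); nra.
by lra.
Qed.

Definition hor (f : C -> C) s1 s2 t := cint (fun s => v1 * f (pt s t)) s1 s2.
Definition ver (f : C -> C) s t1 t2 := cint (fun t => v2 * f (pt s t)) t1 t2.
(** The integral along the boundary of the parallelogram with opposite corners
    [pt s1 t1] and [pt s2 t2], counterclockwise as [v1, v2] is a direct basis. *)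
Definition oint (f : C -> C) s1 s2 t1 t2 :=
  hor f s1 s2 t1 + ver f s2 t1 t2 - hor f s1 s2 t2 - ver f s1 t1 t2.

Definition in_rect (s1 s2 t1 t2 : R) (z : C) := exists s t,
  [/\ s1 <= s <= s2, t1 <= t <= t2 & z = pt s t].

Definition in_edges (s1 s2 t1 t2 : R) (z : C) := exists s t,
  [/\ s1 <= s <= s2, t1 <= t <= t2, z = pt s t
    & (s = s1 \/ s = s2) \/ (t = t1 \/ t = t2)].

Lemma in_edges_rect s1 s2 t1 t2 z : in_edges s1 s2 t1 t2 z -> in_rect s1 s2 t1 t2 z.
Proof. by move=> [s [t [? ? ? _]]]; exists s, t. Qed.

Lemma continuous_pt1 s t : {for s, continuous (fun s => pt s t : C)}.
Proof.
apply/continuousCP => e e0; apply/nbhs_ballP; exists (e / K); first by rewrite /= divr_gt0// K_gt0.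
move=> y; rewrite -ball_normE /= distrC => h; rewrite ptB subrr.
apply: le_lt_trans (modulus_pt _ _) _.
by rewrite normr0 addr0 mulrC -ltr_pdivlMr// K_gt0.
Qed.

Lemma continuous_pt2 s t : {for t, continuous (fun t => pt s t : C)}.
Proof.
apply/continuousCP => e e0; apply/nbhs_ballP; exists (e / K); first by rewrite /= divr_gt0// K_gt0.
move=> y; rewrite -ball_normE /= distrC => h; rewrite ptB subrr.
apply: le_lt_trans (modulus_pt _ _) _.
by rewrite normr0 add0r mulrC -ltr_pdivlMr// K_gt0.
Qed.

Lemma continuous_scalar (T : topologicalType) (a : C) (f : T -> C) x :
  {for x, continuous f} -> {for x, continuous (fun y => a * f y)}.
Proof.
move=> /continuousCP cf; apply/continuousCP => e e0.
have a0 : 0 < 1 + modulus a by rewrite ltr_wpDr// modulus_ge0.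
apply: filterS (cf (e / (1 + modulus a)) _) => [y|]; last by rewrite divr_gt0.
rewrite -mulrBr modulusM ltr_pdivlMr// => h; apply: le_lt_trans h.
by rewrite mulrC ler_wpM2l ?modulus_ge0// lerDr.
Qed.

Section Edges.
Variables s1 s2 t1 t2 : R.
Hypotheses (s12 : s1 <= s2) (t12 : t1 <= t2).

Definition continuous_edges (f : C -> C) :=
  forall z, in_edges s1 s2 t1 t2 z -> {for z, continuous f}.

Lemma hor_continuous f t : continuous_edges f -> t = t1 \/ t = t2 ->
  continuous_on (fun s => v1 * f (pt s t)) s1 s2.
Proof.
move=> cf tt s ss; apply: continuous_scalar.
apply: (@continuous_comp _ _ _ (fun s => pt s t) f); first exact: continuous_pt1.
apply: cf; exists s, t; split => //; last by right.
by case: tt => ->; rewrite lexx t12.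
Qed.

Lemma ver_continuous f s : continuous_edges f -> s = s1 \/ s = s2 ->
  continuous_on (fun t => v2 * f (pt s t)) t1 t2.
Proof.
move=> cf ss t tt; apply: continuous_scalar.
apply: (@continuous_comp _ _ _ (fun t => pt s t) f); first exact: continuous_pt2.
apply: cf; exists s, t; split => //; last by left.
by case: ss => ->; rewrite lexx s12.
Qed.

(** The factor 4: each direction has two sides, on each of which the modulus of
    an integral is bounded up to a factor 2. *)
Lemma modulus_oint_le f M : continuous_edges f ->
  (forall z, in_edges s1 s2 t1 t2 z -> modulus (f z) <= M) ->
  modulus (oint f s1 s2 t1 t2) <= 4 * M * K * ((s2 - s1) + (t2 - t1)).
Proof.
move=> cf fM.
have M0 : 0 <= M.
  apply: le_trans (fM (pt s1 t1) _); first exact: modulus_ge0.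
  by exists s1, t1; rewrite !lexx s12 t12; split => //; left; left.
have hb t : t = t1 \/ t = t2 -> modulus (hor f s1 s2 t) <= 2 * (K * M) * (s2 - s1).
  move=> tt; apply: modulus_cint_le => //; first exact: hor_continuous.
  move=> s ss; rewrite modulusM.
  apply: ler_pM; rewrite ?modulus_ge0// ?lerDl ?modulus_ge0//.
  apply: fM; exists s, t; split => //; last by right.
  by case: tt => ->; rewrite lexx t12.
have vb s : s = s1 \/ s = s2 -> modulus (ver f s t1 t2) <= 2 * (K * M) * (t2 - t1).
  move=> ss; apply: modulus_cint_le => //; first exact: ver_continuous.
  move=> t tt; rewrite modulusM.
  apply: ler_pM; rewrite ?modulus_ge0// ?lerDr ?modulus_ge0//.
  apply: fM; exists s, t; split => //; last by left.
  by case: ss => ->; rewrite lexx s12.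
rewrite /oint.
have h1 := hb t1 (or_introl erefl); have h2 := hb t2 (or_intror erefl).
have h3 := vb s1 (or_introl erefl); have h4 := vb s2 (or_intror erefl).
set A := hor _ _ _ _ in h1 *; set B := ver _ _ _ _ in h4 *.
set D := hor _ _ _ _ in h2 *; set E := ver _ _ _ _ in h3 *.
have := modulusD (A + B - D) (- E); have := modulusD (A + B) (- D); have := modulusD A B.
rewrite !modulusN; nra.
Qed.

Lemma ointD f g : continuous_edges f -> continuous_edges g ->
  oint (fun z => f z + g z) s1 s2 t1 t2 = oint f s1 s2 t1 t2 + oint g s1 s2 t1 t2.
Proof.
move=> cf cg.
have hD t : t = t1 \/ t = t2 ->
    hor (fun z => f z + g z) s1 s2 t = hor f s1 s2 t + hor g s1 s2 t.
  move=> tt; rewrite /hor -cintD//; try exact: hor_continuous.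
  by apply: eq_cint => s _; rewrite mulrDr.
have vD s : s = s1 \/ s = s2 ->
    ver (fun z => f z + g z) s t1 t2 = ver f s t1 t2 + ver g s t1 t2.
  move=> ss; rewrite /ver -cintD//; try exact: ver_continuous.
  by apply: eq_cint => t _; rewrite mulrDr.
rewrite /oint !hD ?vD; try by [left|right].
by ring.
Qed.

Lemma ointZ a f : continuous_edges f ->
  oint (fun z => a * f z) s1 s2 t1 t2 = a * oint f s1 s2 t1 t2.
Proof.
move=> cf.
have hZ t : t = t1 \/ t = t2 -> hor (fun z => a * f z) s1 s2 t = a * hor f s1 s2 t.
  move=> tt; rewrite /hor -cintZ//; try exact: hor_continuous.
  by apply: eq_cint => s _; rewrite mulrCA.
have vZ s : s = s1 \/ s = s2 -> ver (fun z => a * f z) s t1 t2 = a * ver f s t1 t2.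
  move=> ss; rewrite /ver -cintZ//; try exact: ver_continuous.
  by apply: eq_cint => t _; rewrite mulrCA.
rewrite /oint !hZ ?vZ; try by [left|right].
by ring.
Qed.

Lemma continuous_edgesZ a f : continuous_edges f -> continuous_edges (fun z => a * f z).
Proof. by move=> cf z zE; apply: continuous_scalar; exact: cf. Qed.

Lemma continuous_edgesD f g : continuous_edges f -> continuous_edges g ->
  continuous_edges (fun z => f z + g z).
Proof. by move=> cf cg z zE; exact: (continuousD (cf _ zE) (cg _ zE)). Qed.

Lemma continuous_edgesM f g : continuous_edges f -> continuous_edges g ->
  continuous_edges (fun z => f z * g z).
Proof. by move=> cf cg z zE; exact: (continuousM (cf _ zE) (cg _ zE)). Qed.

Lemma ointB f g : continuous_edges f -> continuous_edges g ->
  oint (fun z => f z - g z) s1 s2 t1 t2 = oint f s1 s2 t1 t2 - oint g s1 s2 t1 t2.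
Proof.
move=> cf cg; have -> : (fun z => f z - g z) = (fun z => f z + (-1) * g z).
  by apply/funext => z; rewrite mulN1r.
by rewrite (ointD cf (continuous_edgesZ (a := -1) cg)) (ointZ _ cg) mulN1r.
Qed.

Lemma eq_oint f g : (forall z, in_edges s1 s2 t1 t2 z -> f z = g z) ->
  oint f s1 s2 t1 t2 = oint g s1 s2 t1 t2.
Proof.
move=> fg.
have hE t : t = t1 \/ t = t2 -> hor f s1 s2 t = hor g s1 s2 t.
  move=> tt; apply: eq_cint => s ss; congr (_ * _); apply: fg.
  exists s, t; split => //; last by right.
  by case: tt => ->; rewrite lexx t12.
have vE s : s = s1 \/ s = s2 -> ver f s t1 t2 = ver g s t1 t2.
  move=> ss; apply: eq_cint => t tt; congr (_ * _); apply: fg.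
  exists s, t; split => //; last by left.
  by case: ss => ->; rewrite lexx s12.
by rewrite /oint !hE ?vE//; by [left|right].
Qed.

Lemma oint_primitive F f :
  (forall z, in_edges s1 s2 t1 t2 z -> complex_derivative F z (f z)) ->
  oint f s1 s2 t1 t2 = 0.
Proof.
move=> dF.
have hE t : t = t1 \/ t = t2 -> hor f s1 s2 t = F (pt s2 t) - F (pt s1 t).
  move=> tt; rewrite /hor /pt ![_ * v1 + _]addrC -(@cint_FTC _ F f)//; last first.
    move=> s ss; apply: dF; exists s, t; split => //; last by right.
      by case: tt => ->; rewrite lexx t12.
    by rewrite /pt addrC.
  by apply: eq_cint => s _; rewrite addrC.
have vE s : s = s1 \/ s = s2 -> ver f s t1 t2 = F (pt s t2) - F (pt s t1).
  move=> ss; rewrite /ver -(@cint_FTC _ F f)// => t tt; apply: dF; exists s, t; split => //; last by left.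
  by case: ss => ->; rewrite lexx s12.
rewrite /oint !hE ?vE; try by [left|right].
by ring.
Qed.

End Edges.
End Parallelogram.

Section Goursat.
Variable R : realType.
Local Notation C := 'CC_R.
Variables v1 v2 : C.
Hypothesis v12 : 0 < orientation v1 v2.
Local Notation K := (modulus v1 + modulus v2).
Local Notation pt := (pt v1 v2).
Local Notation oint := (oint v1 v2).
Local Notation in_rect := (in_rect v1 v2).
Local Notation in_edges := (in_edges v1 v2).
Local Notation continuous_edges := (continuous_edges v1 v2).

Lemma oint_split1 f s1 s s2 t1 t2 : s1 <= s -> s <= s2 -> t1 <= t2 ->
  continuous_edges s1 s2 t1 t2 f ->
  oint f s1 s2 t1 t2 = oint f s1 s t1 t2 + oint f s s2 t1 t2.
Proof.
move=> ss1 ss2 t12 cf; have s12 := le_trans ss1 ss2.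
have hE t : t = t1 \/ t = t2 -> hor v1 v2 f s1 s2 t = hor v1 v2 f s1 s t + hor v1 v2 f s s2 t.
  by move=> tt; apply: cint_chasles => //; exact: (hor_continuous v12 t12 cf tt).
rewrite /oint (hE t1) ?(hE t2); try by [left|right].
by ring.
Qed.

Lemma oint_split2 f s1 s2 t1 t t2 : s1 <= s2 -> t1 <= t -> t <= t2 ->
  continuous_edges s1 s2 t1 t2 f ->
  oint f s1 s2 t1 t2 = oint f s1 s2 t1 t + oint f s1 s2 t t2.
Proof.
move=> s12 tt1 tt2 cf; have t12 := le_trans tt1 tt2.
have vE s : s = s1 \/ s = s2 -> ver v1 v2 f s t1 t2 = ver v1 v2 f s t1 t + ver v1 v2 f s t t2.
  by move=> ss; apply: cint_chasles => //; exact: (ver_continuous v12 s12 cf ss).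
rewrite /oint (vE s1) ?(vE s2); try by [left|right].
by ring.
Qed.

Lemma sub_rect s1 s2 t1 t2 s1' s2' t1' t2' z :
  s1 <= s1' -> s2' <= s2 -> t1 <= t1' -> t2' <= t2 ->
  in_rect s1' s2' t1' t2' z -> in_rect s1 s2 t1 t2 z.
Proof.
move=> h1 h2 h3 h4 [s [t [/andP[? ?] /andP[? ?] ->]]]; exists s, t; split => //.
  by apply/andP; split; lra.
by apply/andP; split; lra.
Qed.

Definition derivable_on (A : set C) (f : C -> C) := forall z, A z -> derivable f z 1.

Lemma derivable_on_edges s1 s2 t1 t2 f :
  derivable_on (in_rect s1 s2 t1 t2) f -> continuous_edges s1 s2 t1 t2 f.
Proof. by move=> df z /in_edges_rect/df; exact: derivable_continuousC. Qed.

Lemma nested_intervals (u w : nat -> R) :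
  (forall n, [/\ u n <= w n, u n <= u n.+1 & w n.+1 <= w n]) ->
  exists c, forall n, u n <= c <= w n.
Proof.
move=> H.
have um n k : u n <= u (n + k)%N.
  by elim: k => [|k IH]; rewrite ?addn0// addnS; apply: le_trans IH _; have [] := H (n + k)%N.
have wm n k : w (n + k)%N <= w n.
  by elim: k => [|k IH]; rewrite ?addn0// addnS; apply: le_trans IH; have [] := H (n + k)%N.
have uw n m : u n <= w m.
  apply: le_trans (um n m) _; apply: le_trans (_ : w (n + m)%N <= _); first by have [] := H (n + m)%N.
  by rewrite addnC; exact: wm.
exists (sup (range u)) => n; apply/andP; split.
  by apply: ub_le_sup; [exists (w 0%N) => _ [m _ <-]; exact: uw|exists n].
by apply: ge_sup; [exists (u 0%N); exists 0%N|move=> _ [m _ <-]; exact: uw].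
Qed.

Lemma half_power_small (c d : R) : 0 < d -> exists n, c * 2^-1 ^+ n < d.
Proof.
move=> d0; pose x := Num.max 0 (c / d).
have x0 : 0 <= x by rewrite le_max lexx.
exists (Num.bound x); rewrite exprVn ltr_pdivrMr ?exprn_gt0// mulrC -ltr_pdivrMr//.
apply: le_lt_trans (_ : x < _); first by rewrite le_max lexx orbT.
apply: lt_le_trans (archi_boundP x0) _.
by rewrite -natrX ler_nat ltnW// ltn_expl.
Qed.

(** The integrals over the four quarters add up to the whole: one of them has at
    least the mean modulus. *)
Lemma oint_quarter f (s t p q : R) : 0 <= p -> 0 <= q ->
  derivable_on (in_rect s (s + 2 * p) t (t + 2 * q)) f ->
  exists s' t', [/\ s' = s \/ s' = s + p, t' = t \/ t' = t + q
    & modulus (oint f s (s + 2 * p) t (t + 2 * q)) <=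
      4 * modulus (oint f s' (s' + p) t' (t' + q))].
Proof.
move=> p0 q0 df.
have sub s' t' : s' = s \/ s' = s + p -> t' = t \/ t' = t + q ->
    continuous_edges s' (s' + p) t' (t' + q) f.
  move=> hs ht; apply: derivable_on_edges => z zr; apply: df.
  by apply: sub_rect zr; lra.
have e : oint f s (s + 2 * p) t (t + 2 * q) =
    (oint f s (s + p) t (t + q) + oint f s (s + p) (t + q) (t + q + q)) +
    (oint f (s + p) (s + p + p) t (t + q) + oint f (s + p) (s + p + p) (t + q) (t + q + q)).
  have -> : t + 2 * q = t + q + q by ring.
  have -> : s + 2 * p = s + p + p by ring.
  have [e1 e2 e3 e4] : [/\ s <= s + p, s + p <= s + p + p, t <= t + q & t + q <= t + q + q] by split; lra.
  have cE s' s'' : s <= s' -> s'' <= s + 2 * p -> continuous_edges s' s'' t (t + q + q) f.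
    by move=> h h'; apply: derivable_on_edges => z zr; apply: df; apply: sub_rect zr; lra.
  rewrite (oint_split1 e1 e2 (le_trans e3 e4)); last by apply: cE; lra.
  by congr (_ + _); apply: oint_split2 => //; apply: cE; lra.
rewrite e; set A := oint _ _ _ _ _; set B := oint _ _ _ _ _;
  set D := oint _ _ _ _ _; set E := oint _ _ _ _ _.
have h1 := modulusD (A + B) (D + E); have h2 := modulusD A B; have h3 := modulusD D E.
set M := modulus (A + B + (D + E)) in h1 *.
have [hA|hA] := leP M (4 * modulus A); first by exists s, t; split => //; left.
have [hB|hB] := leP M (4 * modulus B).
  by exists s, (t + q); split => //; [left|right].
have [hD|hD] := leP M (4 * modulus D).
  by exists (s + p), t; split => //; [right|left].
exists (s + p), (t + q); split; [by right|by right|].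
by rewrite -/E; lra.
Qed.

(** Goursat: no continuity of the derivative is assumed.  Some quarter of a
    parallelogram carries at least a quarter of its integral; near the point
    common to the nested quarters so obtained, [f] is affine up to an error
    too small for the integrals to decrease like the squares of the sides. *)
Theorem goursat f s1 s2 t1 t2 : s1 <= s2 -> t1 <= t2 ->
  derivable_on (in_rect s1 s2 t1 t2) f -> oint f s1 s2 t1 t2 = 0.
Proof.
move=> s12 t12 df; apply/eqP; rewrite -modulus_eq0; apply/negPn/negP => I0.
have {}I0 : 0 < modulus (oint f s1 s2 t1 t2) by rewrite lt_neqAle eq_sym I0 modulus_ge0.
set I := modulus _ in I0.
pose a := s2 - s1; pose b := t2 - t1; pose r n : R := 2^-1 ^+ n.
have a0 : 0 <= a by rewrite subr_ge0.
have b0 : 0 <= b by rewrite subr_ge0.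
have rS n : r n = 2 * r n.+1 by rewrite /r exprS; field.
have r0 n : 0 < r n by rewrite exprn_gt0// invr_gt0.
(* [(n, (s, t))] stands for a parallelogram of the [n]-th generation with lower
   corner [pt s t] *)
pose good (q : nat * (R * R)) := let: (n, (s, t)) := q in
  [/\ s1 <= s, s + a * r n <= s2, t1 <= t, t + b * r n <= t2
    & I * r n ^+ 2 <= modulus (oint f s (s + a * r n) t (t + b * r n))].
pose next (q q' : {q | good q}) := let: (n, (s, t)) := sval q in
  let: (n', (s', t')) := sval q' in
  [/\ n' = n.+1, s <= s', s' + a * r n' <= s + a * r n,
      t <= t' & t' + b * r n' <= t + b * r n].
have good0 : good (0%N, (s1, t1)).
  rewrite /good /r expr0 !mulr1 /a /b [s1 + _]addrC [t1 + _]addrC !subrK expr1n mulr1.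
    by rewrite !lexx.
have step q : {q' | next q q'}.
  case: q => -[n [s t]] gq; apply: cid; move: (gq) => -[h1 h2 h3 h4 h5].
  have arn : 0 <= a * r n.+1 by rewrite mulr_ge0// ltW.
  have brn : 0 <= b * r n.+1 by rewrite mulr_ge0// ltW.
  have aE : a * r n = 2 * (a * r n.+1) by rewrite [r n]rS; ring.
  have bE : b * r n = 2 * (b * r n.+1) by rewrite [r n]rS; ring.
  have [|s' [t' [hs ht hI]]] := @oint_quarter f s t _ _ arn brn.
    by move=> z zr; apply: df; apply: sub_rect zr; lra.
  have gq' : good (n.+1, (s', t')).
    split; try lra.
    have : I * r n ^+ 2 <= 4 * modulus (oint f s' (s' + a * r n.+1) t' (t' + b * r n.+1)).
      by apply: le_trans hI; rewrite -aE -bE.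
    by rewrite [r n]rS; set X := modulus _; lra.
  exists (exist good _ gq'); split => //=; lra.
have [F [F0 FS]] := dependent_choice step (exist good _ good0).
have FE n : (sval (F n)).1 = n.
  elim: n => [|n IH]; first by rewrite F0.
  move: (FS n) IH; rewrite /next; case: (sval (F n)) => [? [? ?]]; case: (sval (F n.+1)) => [? [? ?]] /=.
  by move=> [-> _ _ _ _] ->.
pose s n := (sval (F n)).2.1; pose t n := (sval (F n)).2.2.
have gs n : [/\ s1 <= s n, s n + a * r n <= s2, t1 <= t n, t n + b * r n <= t2
    & I * r n ^+ 2 <= modulus (oint f (s n) (s n + a * r n) (t n) (t n + b * r n))].
  move: (svalP (F n)) (FE n); rewrite /s /t; case: (sval (F n)) => [m [? ?]] /=.
  by move=> h e; rewrite e in h.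
have ns n : [/\ s n <= s n.+1, s n.+1 + a * r n.+1 <= s n + a * r n,
    t n <= t n.+1 & t n.+1 + b * r n.+1 <= t n + b * r n].
  move: (FS n) (FE n) (FE n.+1); rewrite /next /s /t.
  case: (sval (F n)) => [m [? ?]]; case: (sval (F n.+1)) => [m' [? ?]] /=.
  by move=> [_ h1 h2 h3 h4] e e'; rewrite e e' in h2 h4.
have [n|sc Hs] := @nested_intervals s (fun n => s n + a * r n).
  by have [h1 h2 _ _] := ns n; split => //; rewrite lerDl mulr_ge0// ltW.
have [n|tc Ht] := @nested_intervals t (fun n => t n + b * r n).
  by have [_ _ h1 h2] := ns n; split => //; rewrite lerDl mulr_ge0// ltW.
have [l dl] : exists l, complex_derivative f (pt sc tc) l.
  apply/derivableCP; apply: df; exists sc, tc; split => //.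
    have /andP[h1 h2] := Hs 0%N; have [h3 h4 _ _ _] := gs 0%N.
    by apply/andP; split; lra.
  have /andP[h1 h2] := Ht 0%N; have [_ _ h3 h4 _] := gs 0%N.
  by apply/andP; split; lra.
(* the generation [n] lies within [Q * r n] of the common point *)
pose Q := K * (a + b).
have Q0 : 0 <= Q by apply: mulr_ge0; [exact: ltW (K_gt0 v12)|exact: addr_ge0].
have Q1 : 0 < 4 * Q ^+ 2 + 1 by rewrite ltr_wpDl// mulr_ge0// sqr_ge0.
pose e := I / (4 * Q ^+ 2 + 1).
have e0 : 0 < e by rewrite divr_gt0.
have [d d0 dP] := dl _ e0.
have [n nd] := half_power_small Q d0.
have [h1 h2 h3 h4 h5] := gs n.
have /andP[s_lo s_hi] := Hs n; have /andP[t_lo t_hi] := Ht n.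
set S := s n in h1 h2 h5 s_lo s_hi; set T := t n in h3 h4 h5 t_lo t_hi.
have arn : 0 <= a * r n by rewrite mulr_ge0// ltW.
have brn : 0 <= b * r n by rewrite mulr_ge0// ltW.
have sS : S <= S + a * r n by lra.
have tT : T <= T + b * r n by lra.
set z := pt sc tc in dl dP.
have cf : continuous_edges S (S + a * r n) T (T + b * r n) f.
  by apply: derivable_on_edges => w zr; apply: df; apply: sub_rect zr; lra.
(* the affine approximation [A] has the primitive [P], hence a zero integral *)
pose A w : C := f z + l * (w - z).
pose P w : C := f z * w + l / 2 * ((w - z) * (w - z)).
have dP' w : complex_derivative P w (A w).
  have dz : complex_derivative (fun w => w - z) w (1 - 0).
    by apply: derivativeB; [exact: derivative_id|exact: derivative_cst].
  have := derivativeD (derivativeM (derivative_cst (f z) w) (derivative_id w))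
                      (derivativeM (derivative_cst (l / 2) w) (derivativeM dz dz)).
  by congr complex_derivative; rewrite /A; field.
have cA : continuous_edges S (S + a * r n) T (T + b * r n) A.
  move=> w _; apply: derivable_continuousC; apply: (derivative_derivable (l := 0 + (l * (1 - 0) + (w - z) * 0))).
  apply: derivativeD (derivative_cst _ _) (derivativeM (derivative_cst _ _) _).
  by apply: derivativeB; [exact: derivative_id|exact: derivative_cst].
have near w : in_rect S (S + a * r n) T (T + b * r n) w -> modulus (w - z) <= Q * r n.
  move=> [s' [t' [/andP[? ?] /andP[? ?] ->]]]; rewrite ptB.
  apply: le_trans (modulus_pt _ _ _ _) _; rewrite /Q -mulrA ler_wpM2l//.
    exact: ltW (K_gt0 v12).
  rewrite mulrDl; apply: lerD; rewrite ler_norml; apply/andP; split; lra.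
have err w : in_edges S (S + a * r n) T (T + b * r n) w ->
    modulus (f w - A w) <= e * (Q * r n).
  move=> /in_edges_rect/near wz.
  have := dP (w - z) (le_lt_trans wz nd).
  rewrite [z + _]addrC subrK => h.
  have -> : f w - A w = f w - f z - l * (w - z) by rewrite /A; ring.
  by apply: le_trans h _; rewrite ler_pM2l.
have := modulus_oint_le v12 sS tT (f := fun w => f w - A w) (M := e * (Q * r n)).
have oA : oint A S (S + a * r n) T (T + b * r n) = 0.
  by apply: (@oint_primitive _ v1 v2 _ _ _ _ sS tT P) => w _; exact: dP'.
rewrite (ointB v12 sS tT cf cA) oA subr0 => /(_ _ err) H.
have {H} : modulus (oint f S (S + a * r n) T (T + b * r n)) <= 4 * (e * (Q * r n)) * K * (a * r n + b * r n).
  have -> : a * r n + b * r n = S + a * r n - S + (T + b * r n - T) by ring.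
  apply: H => w wE; apply: (@continuousB _ _ C); [exact: cf|exact: cA].
move/(le_trans h5).
have -> : 4 * (e * (Q * r n)) * K * (a * r n + b * r n) = (4 * e * Q ^+ 2) * r n ^+ 2.
  by rewrite /Q; ring.
rewrite ler_pM2r ?exprn_gt0// => H.
have : 4 * e * Q ^+ 2 < I.
  rewrite /e -subr_gt0.
  have -> : I - 4 * (I / (4 * Q ^+ 2 + 1)) * Q ^+ 2 = I / (4 * Q ^+ 2 + 1) by field; exact: lt0r_neq0.
  by rewrite divr_gt0.
by rewrite ltNge H.
Qed.

End Goursat.

(** * Cauchy's integral formula *)
Section CauchyFormula.
Variable R : realType.
Local Notation C := 'CC_R.
Variables v1 v2 : C.
Hypothesis v12 : 0 < orientation v1 v2.
Local Notation K := (modulus v1 + modulus v2).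
Local Notation pt := (pt v1 v2).
Local Notation oint := (oint v1 v2).
Local Notation in_rect := (in_rect v1 v2).
Local Notation in_edges := (in_edges v1 v2).
Local Notation continuous_edges := (continuous_edges v1 v2).

Definition in_interior (s1 s2 t1 t2 : R) (z : C) := exists s t,
  [/\ s1 < s < s2, t1 < t < t2 & z = pt s t].

Lemma continuous_inv (f : C -> C) z : f z != 0 -> {for z, continuous f} ->
  {for z, continuous (fun z => (f z)^-1)}.
Proof. by move=> f0 cf; exact: (continuousV f0 cf). Qed.

Lemma modulus_nat n : modulus (n%:R : C) = n%:R.
Proof.
have -> : (n%:R : C) = (n%:R : R)%:C%C by rewrite rmorph_nat.
by rewrite modulus_real normr_nat.
Qed.

Lemma derivable_inv_sub (w z : C) : z != w -> derivable (fun z : C => (z - w)^-1) z 1.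
Proof.
move=> zw; apply: derivative_derivable.
apply: derivativeV; first by rewrite subr_eq0.
by apply: derivativeB; [exact: derivative_id|exact: derivative_cst].
Qed.

Lemma derivableMC (f g : C -> C) z : derivable f z 1 -> derivable g z 1 ->
  derivable (fun z => f z * g z) z 1.
Proof. by move=> df dg; exact: (derivableM df dg). Qed.

Lemma derivableXC (f : C -> C) n z : derivable f z 1 -> derivable (fun z => f z ^+ n) z 1.
Proof.
move=> df; elim: n => [|n IH]; first exact: (derivable_cst (1 : C)).
by rewrite (_ : (fun y => _) = fun y => f y * f y ^+ n);
  [exact: derivableMC|apply/funext => y; rewrite exprS].
Qed.

Lemma derivable_sub_cst (w z : C) : derivable (fun z : C => z - w) z 1.
Proof.
apply: derivative_derivable.
by apply: derivativeB; [exact: derivative_id|exact: derivative_cst].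
Qed.

Section Rectangle.
Variables s1 s2 t1 t2 : R.
Hypotheses (s12 : s1 <= s2) (t12 : t1 <= t2).

Lemma edges_bounded f : continuous_edges s1 s2 t1 t2 f ->
  exists B, forall z, in_edges s1 s2 t1 t2 z -> modulus (f z) <= B.
Proof.
move=> cf.
have hb t : t = t1 \/ t = t2 -> exists B, forall s, s1 <= s <= s2 -> modulus (f (pt s t)) <= B.
  move=> tt; have [|c _ cM] := @EVT_max R (fun s => modulus (f (pt s t))) s1 s2 s12.
    apply: continuous_in_subspaceT => s; rewrite inE /= in_itv /= => ss.
    apply: continuous_comp; last exact: continuous_modulus.
    apply: (@continuous_comp _ _ _ (fun s => pt s t) f); first exact: continuous_pt1.
    apply: cf; exists s, t; split => //; last by right.
    by case: tt => ->; rewrite lexx t12.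
  by exists (modulus (f (pt c t))) => s ss; apply: cM; rewrite in_itv.
have vb s : s = s1 \/ s = s2 -> exists B, forall t, t1 <= t <= t2 -> modulus (f (pt s t)) <= B.
  move=> ss; have [|c _ cM] := @EVT_max R (fun t => modulus (f (pt s t))) t1 t2 t12.
    apply: continuous_in_subspaceT => t; rewrite inE /= in_itv /= => tt.
    apply: continuous_comp; last exact: continuous_modulus.
    apply: (@continuous_comp _ _ _ (fun t => pt s t) f); first exact: continuous_pt2.
    apply: cf; exists s, t; split => //; last by left.
    by case: ss => ->; rewrite lexx s12.
  by exists (modulus (f (pt s c))) => t tt; apply: cM; rewrite in_itv.
have [B1 h1] := hb t1 (or_introl erefl); have [B2 h2] := hb t2 (or_intror erefl).
have [B3 h3] := vb s1 (or_introl erefl); have [B4 h4] := vb s2 (or_intror erefl).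
exists (Num.max (Num.max B1 B2) (Num.max B3 B4)) => z [s [t [ss tt -> e]]].
rewrite !le_max; case: e => -[] e; rewrite e.
- by rewrite h3 ?orbT.
- by rewrite h4 ?orbT.
- by rewrite h1.
- by rewrite h2 ?orbT.
Qed.

Lemma edges_dist w : in_interior s1 s2 t1 t2 w ->
  exists2 r, 0 < r & forall z, in_edges s1 s2 t1 t2 z -> r <= modulus (z - w).
Proof.
move=> [a [b [/andP[sa as2] /andP[tb bt] ->]]].
pose m := Num.min (Num.min (a - s1) (s2 - a)) (Num.min (b - t1) (t2 - b)).
have m0 : 0 < m by rewrite !lt_min !subr_gt0 sa as2 tb bt.
have [m1 m2 m3 m4] : [/\ m <= a - s1, m <= s2 - a, m <= b - t1 & m <= t2 - b].
  by split; rewrite !ge_min lexx ?orbT.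
have k0 : 0 < 4 * K / orientation v1 v2 by rewrite divr_gt0// mulr_gt0// K_gt0.
exists (m / (4 * K / orientation v1 v2)); first by rewrite divr_gt0.
move=> z [s [t [_ _ -> e]]]; rewrite ler_pdivrMr// mulrC ptB.
apply: le_trans (coord_le_modulus v12 _ _).
have ns := normr_ge0 (s - a); have nt := normr_ge0 (t - b).
have := ler_norm (s - a); have := ler_norm (a - s); rewrite distrC.
have := ler_norm (t - b); have := ler_norm (b - t); rewrite [`|b - t|]distrC.
by case: e => -[] e; rewrite e in ns nt *; lra.
Qed.

Lemma interior_not_edge w z : in_interior s1 s2 t1 t2 w -> in_edges s1 s2 t1 t2 z -> z != w.
Proof.
move=> /edges_dist[r r0 rP] /rP; apply: contraTneq => ->.
by rewrite subrr modulus0 -ltNge.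
Qed.

(** Differentiation under the integral sign, from a second order estimate of the
    integrand that is uniform along the contour. *)
Lemma oint_param_derivative (G : C -> C -> C) (G' : C -> C) w M d : 0 < d ->
  (forall h, modulus h < d -> continuous_edges s1 s2 t1 t2 (G (w + h))) ->
  continuous_edges s1 s2 t1 t2 G' ->
  (forall h z, modulus h < d -> in_edges s1 s2 t1 t2 z ->
    modulus (G (w + h) z - G w z - h * G' z) <= M * modulus h ^+ 2) ->
  complex_derivative (fun w => oint (G w) s1 s2 t1 t2) w (oint G' s1 s2 t1 t2).
Proof.
move=> d0 cG cG' GM e e0.
pose L := 4 * `|M| * K * ((s2 - s1) + (t2 - t1)).
have L0 : 0 <= L.
  apply: mulr_ge0; last by rewrite addr_ge0 ?subr_ge0.
  by apply: mulr_ge0; [rewrite mulr_ge0|exact: ltW (K_gt0 v12)].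
have L1 : 0 < L + 1 by rewrite ltr_wpDl.
exists (Num.min d (e / (L + 1))); first by rewrite lt_min d0 divr_gt0.
move=> h; rewrite lt_min => /andP[hd]; rewrite ltr_pdivlMr// => hL.
have c0 : continuous_edges s1 s2 t1 t2 (G w) by rewrite -[w]addr0; apply: cG; rewrite modulus0.
have c1 := cG _ hd; have c2 := continuous_edgesZ (a := h) cG'.
have c01 : continuous_edges s1 s2 t1 t2 (fun z => G (w + h) z - G w z).
  by move=> z zE; exact: (continuousB (c1 z zE) (c0 z zE)).
have c012 : continuous_edges s1 s2 t1 t2 (fun z => G (w + h) z - G w z - h * G' z).
  by move=> z zE; exact: (continuousB (c01 z zE) (c2 z zE)).
rewrite -(ointB v12 s12 t12 c1 c0) [_ * h]mulrC -(ointZ v12 s12 t12 h cG') -(ointB v12 s12 t12 c01 c2).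
apply: le_trans (modulus_oint_le v12 s12 t12 c012 (M := `|M| * modulus h ^+ 2) _) _.
  move=> z zE; apply: le_trans (GM _ _ hd zE) _.
  by rewrite ler_wpM2r ?exprn_ge0 ?modulus_ge0// ler_norm.
have -> : 4 * (`|M| * modulus h ^+ 2) * K * (s2 - s1 + (t2 - t1)) = L * modulus h * modulus h.
  by rewrite /L; ring.
rewrite ler_wpM2r ?modulus_ge0//; apply: le_trans (ltW hL).
by have := modulus_ge0 h; nra.
Qed.

Section Kernel.
Variables (phi : C -> C) (w : C) (r : R).
Hypotheses (cphi : continuous_edges s1 s2 t1 t2 phi) (r0 : 0 < r).
Hypothesis rP : forall z, in_edges s1 s2 t1 t2 z -> r <= modulus (z - w).

Lemma kernel_shift_ge z h : in_edges s1 s2 t1 t2 z -> modulus h < r / 2 ->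
  r / 2 <= modulus (z - (w + h)).
Proof.
move=> /rP zw hr; have := modulusBle (z - w) h.
by rewrite -addrA -opprD; lra.
Qed.

Lemma continuous_kernel n h : modulus h < r / 2 ->
  continuous_edges s1 s2 t1 t2 (fun z => phi z * (z - (w + h)) ^- n).
Proof.
move=> hr z zE.
have nz : z - (w + h) != 0.
  by rewrite -modulus_gt0; apply: lt_le_trans (kernel_shift_ge zE hr); rewrite divr_gt0.
apply: (continuousM (cphi zE)).
apply: (@continuous_inv (fun z => (z - (w + h)) ^+ n)); first by rewrite expf_neq0.
by apply/derivable_continuousC/derivableXC/derivable_sub_cst.
Qed.

Lemma continuous_kernel0 n :
  continuous_edges s1 s2 t1 t2 (fun z => phi z * (z - w) ^- n).
Proof.
move=> z zE; have hr : modulus 0 < r / 2 by rewrite modulus0 divr_gt0.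
by have := continuous_kernel (n := n) hr zE; rewrite (addr0 w).
Qed.

Lemma oint_kernel_derivative1 :
  complex_derivative (fun w => oint (fun z => phi z / (z - w)) s1 s2 t1 t2) w
    (oint (fun z => phi z / (z - w) ^+ 2) s1 s2 t1 t2).
Proof.
have [B BP] := edges_bounded cphi.
have r20 : 0 < r / 2 by rewrite divr_gt0.
apply: (@oint_param_derivative (fun w z => phi z / (z - w)) _ w (`|B| / (r ^+ 2 * (r / 2))) (r / 2)).
- exact: r20.
- by move=> h hr; exact: (continuous_kernel (n := 1) hr).
- exact: (@continuous_kernel0 2).
move=> h z hr zE.
have m1 := rP zE; have m2 := kernel_shift_ge zE hr.
have n1 : z - w != 0 by rewrite -modulus_gt0; apply: lt_le_trans m1.
have n2 : z - (w + h) != 0 by rewrite -modulus_gt0; apply: lt_le_trans m2.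
have -> : phi z / (z - (w + h)) - phi z / (z - w) - h * (phi z / (z - w) ^+ 2) =
    phi z * h ^+ 2 * ((z - w) ^+ 2 * (z - (w + h)))^-1 by field; rewrite n1 n2.
rewrite !(modulusX, modulusV, modulusM) [leRHS]mulrAC.
apply: ler_pM; rewrite ?mulr_ge0 ?invr_ge0 ?mulr_ge0 ?exprn_ge0 ?modulus_ge0//.
  rewrite ler_wpM2r ?exprn_ge0 ?modulus_ge0//; apply: le_trans (BP _ zE) (ler_norm _).
rewrite lef_pV2 ?posrE ?mulr_gt0 ?exprn_gt0// ?modulus_gt0//.
apply: ler_pM => //; rewrite ?exprn_ge0// ?(ltW r0) ?(ltW r20)//.
by rewrite ler_pXn2r// ?nnegrE ?modulus_ge0// ltW.
Qed.

Lemma oint_kernel_derivative2 :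
  complex_derivative (fun w => oint (fun z => phi z / (z - w) ^+ 2) s1 s2 t1 t2) w
    (oint (fun z => 2 * (phi z / (z - w) ^+ 3)) s1 s2 t1 t2).
Proof.
have [B BP] := edges_bounded cphi.
have r20 : 0 < r / 2 by rewrite divr_gt0.
apply: (@oint_param_derivative (fun w z => phi z / (z - w) ^+ 2) _ w (`|B| * (4 / (r ^+ 2 * (r / 2) ^+ 2))) (r / 2)).
- exact: r20.
- by move=> h hr; exact: (continuous_kernel (n := 2) hr).
- by apply: continuous_edgesZ; exact: (@continuous_kernel0 3).
move=> h z hr zE.
have m1 := rP zE; have m2 := kernel_shift_ge zE hr.
have n1 : z - w != 0 by rewrite -modulus_gt0; apply: lt_le_trans m1.
have n2 : z - (w + h) != 0 by rewrite -modulus_gt0; apply: lt_le_trans m2.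
have -> : phi z / (z - (w + h)) ^+ 2 - phi z / (z - w) ^+ 2 - h * (2 * (phi z / (z - w) ^+ 3)) =
    phi z * ((3 * (z - w) - 2 * h) / (z - w) * ((z - w) ^+ 2 * (z - (w + h)) ^+ 2)^-1) * h ^+ 2.
  by field; rewrite n1 n2.
rewrite !(modulusX, modulusV, modulusM).
apply: ler_wpM2r; first by rewrite exprn_ge0 ?modulus_ge0.
apply: ler_pM; rewrite ?mulr_ge0 ?invr_ge0 ?mulr_ge0 ?exprn_ge0 ?modulus_ge0//.
  exact: le_trans (BP _ zE) (ler_norm _).
apply: ler_pM; rewrite ?mulr_ge0 ?invr_ge0 ?mulr_ge0 ?exprn_ge0 ?modulus_ge0//.
  rewrite ler_pdivrMr ?modulus_gt0//; apply: le_trans (modulusD _ _) _.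
  rewrite modulusN !modulusM.
  rewrite !modulus_nat.
  lra.
rewrite lef_pV2 ?posrE ?mulr_gt0 ?exprn_gt0// ?modulus_gt0//.
apply: ler_pM => //; rewrite ?exprn_ge0// ?(ltW r0) ?(ltW r20)//.
  by rewrite ler_pXn2r// ?nnegrE ?modulus_ge0// ltW.
by rewrite ler_pXn2r// ?nnegrE ?modulus_ge0// ltW.
Qed.

End Kernel.
End Rectangle.
End CauchyFormula.

Section CauchyTheory.
Variable R : realType.
Local Notation C := 'CC_R.
Variables v1 v2 : C.
Hypothesis v12 : 0 < orientation v1 v2.
Local Notation K := (modulus v1 + modulus v2).
Local Notation pt := (pt v1 v2).
Local Notation oint := (oint v1 v2).
Local Notation in_rect := (in_rect v1 v2).
Local Notation in_edges := (in_edges v1 v2).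
Local Notation in_interior := (in_interior v1 v2).
Local Notation continuous_edges := (continuous_edges v1 v2).

Lemma in_interior_rect s1 s2 t1 t2 z : in_interior s1 s2 t1 t2 z -> in_rect s1 s2 t1 t2 z.
Proof.
move=> [s [t [/andP[? ?] /andP[? ?] ->]]]; exists s, t; split => //.
  by apply/andP; split; exact: ltW.
by apply/andP; split; exact: ltW.
Qed.

Lemma nbhs_in_interior s1 s2 t1 t2 z : in_interior s1 s2 t1 t2 z ->
  nbhs z (in_interior s1 s2 t1 t2).
Proof.
move=> zI; move: (zI) => [a [b [/andP[? ?] /andP[? ?] zE]]].
pose m := Num.min (Num.min (a - s1) (s2 - a)) (Num.min (b - t1) (t2 - b)).
have m0 : 0 < m by rewrite !lt_min !subr_gt0; do !(apply/andP; split => //).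
have [m1 m2 m3 m4] : [/\ m <= a - s1, m <= s2 - a, m <= b - t1 & m <= t2 - b].
  by split; rewrite !ge_min lexx ?orbT.
have k0 : 0 < 4 * K / orientation v1 v2 by rewrite divr_gt0// mulr_gt0// K_gt0.
apply/nbhsCP; exists (m / (4 * K / orientation v1 v2)); first by rewrite divr_gt0.
move=> y; rewrite ltr_pdivlMr// mulrC zE -{1}(pt_coord v12 y) ptB => h.
have {}h := le_lt_trans (coord_le_modulus v12 _ _) h.
exists (coord1 v1 v2 y), (coord2 v1 v2 y); rewrite pt_coord//.
set s := coord1 v1 v2 y in h *; set t := coord2 v1 v2 y in h *.
have := ler_norm (s - a); have := ler_norm (a - s); rewrite distrC.
have := ler_norm (t - b); have := ler_norm (b - t); rewrite [`|b - t|]distrC.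
have := normr_ge0 (s - a); have := normr_ge0 (t - b) => *.
by split => //; apply/andP; split; lra.
Qed.

Lemma small_rect (z : C) (P : set C) : nbhs z P -> exists s1 s2 t1 t2,
  [/\ s1 <= s2, t1 <= t2, in_interior s1 s2 t1 t2 z & in_rect s1 s2 t1 t2 `<=` P].
Proof.
move=> /nbhsCP[e e0 eP]; have K0 := K_gt0 v12.
pose d := e / (4 * K).
have d0 : 0 < d by rewrite divr_gt0// mulr_gt0.
exists (coord1 v1 v2 z - d), (coord1 v1 v2 z + d), (coord2 v1 v2 z - d), (coord2 v1 v2 z + d).
split; [lra|lra| |].
  exists (coord1 v1 v2 z), (coord2 v1 v2 z); rewrite pt_coord//.
  by split => //; apply/andP; split; lra.
move=> y [s [t [/andP[? ?] /andP[? ?] ->]]]; apply: eP.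
rewrite -{1}(pt_coord v12 z) ptB.
apply: le_lt_trans (modulus_pt _ _ _ _) _.
have : `|s - coord1 v1 v2 z| + `|t - coord2 v1 v2 z| <= 2 * d.
  have -> : 2 * d = d + d by ring.
  by apply: lerD; rewrite ler_norml; apply/andP; split; lra.
move=> h; apply: le_lt_trans (ler_wpM2l (ltW K0) h) _.
have -> : K * (2 * d) = e / 2 by rewrite /d; field; exact: lt0r_neq0.
lra.
Qed.

Section AroundPoint.
Variables s1 s2 t1 t2 : R.
Hypotheses (s12 : s1 <= s2) (t12 : t1 <= t2).
Local Notation rect := (in_rect s1 s2 t1 t2).
Local Notation interior := (in_interior s1 s2 t1 t2).

(** The four strips cut off by the smaller parallelogram avoid the singularity, so
    that Goursat's theorem applies to them. *)
Lemma oint_shrink g a b p1 p2 q1 q2 :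
  s1 <= p1 < a -> a < p2 <= s2 -> t1 <= q1 < b -> b < q2 <= t2 ->
  (forall z, rect z -> z != pt a b -> derivable g z 1) ->
  oint g s1 s2 t1 t2 = oint g p1 p2 q1 q2.
Proof.
move=> /andP[h1 h2] /andP[h3 h4] /andP[h5 h6] /andP[h7 h8] dg.
have inj s t : pt s t = pt a b -> s = a /\ t = b.
  by move=> e; have := coord1_pt v12 s t; have := coord2_pt v12 s t; rewrite e coord1_pt// coord2_pt.
have cE x1 x2 y1 y2 : s1 <= x1 < a -> a < x2 <= s2 -> t1 <= y1 < b -> b < y2 <= t2 ->
    continuous_edges x1 x2 y1 y2 g.
  move=> /andP[? ?] /andP[? ?] /andP[? ?] /andP[? ?] z [s [t [/andP[? ?] /andP[? ?] -> e]]].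
  apply/derivable_continuousC/dg.
    by exists s, t; split => //; apply/andP; split; lra.
  by apply/eqP => /inj[? ?]; case: e => -[] ?; lra.
have z0 x1 x2 y1 y2 : s1 <= x1 -> x1 <= x2 -> x2 <= s2 -> t1 <= y1 -> y1 <= y2 -> y2 <= t2 ->
    (x2 < a \/ a < x1) \/ (y2 < b \/ b < y1) -> oint g x1 x2 y1 y2 = 0.
  move=> ? ? ? ? ? ? out; apply: (goursat v12) => // z [s [t [/andP[? ?] /andP[? ?] ->]]].
  apply: dg; first by exists s, t; split => //; apply/andP; split; lra.
  by apply/eqP => /inj[? ?]; case: out => -[] ?; lra.
have [l1 l2 l3 l4] : [/\ p1 <= s2, p1 <= p2, q1 <= t2 & q1 <= q2] by split; lra.
have e1 : oint g s1 p1 t1 t2 = 0 by apply: z0; try lra; left; left.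
have e2 : oint g p2 s2 t1 t2 = 0 by apply: z0; try lra; left; right.
have e3 : oint g p1 p2 t1 q1 = 0 by apply: z0; try lra; right; left.
have e4 : oint g p1 p2 q2 t2 = 0 by apply: z0; try lra; right; right.
rewrite (oint_split1 v12 h1 l1 t12) ?e1 ?add0r; last by apply: cE; apply/andP; split; lra.
rewrite (oint_split1 v12 l2 h4 t12) ?e2 ?addr0; last by apply: cE; apply/andP; split; lra.
rewrite (oint_split2 v12 l2 h5 l3) ?e3 ?add0r; last by apply: cE; apply/andP; split; lra.
rewrite (oint_split2 v12 l2 l4 h8) ?e4 ?addr0//; by apply: cE; apply/andP; split; lra.
Qed.

(** Shrunk around the singularity, the contour becomes short while the integrand
    stays bounded. *)
Lemma oint_bounded_singularity g w M d : interior w -> 0 < d ->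
  (forall z, rect z -> z != w -> derivable g z 1) ->
  (forall z, z != w -> modulus (z - w) < d -> modulus (g z) <= M) ->
  oint g s1 s2 t1 t2 = 0.
Proof.
move=> [a [b [/andP[a1 a2] /andP[b1 b2] ->]]] d0 dg gM.
apply/eqP; rewrite -modulus_eq0; apply/negPn/negP => I0.
have {}I0 : 0 < modulus (oint g s1 s2 t1 t2) by rewrite lt_neqAle eq_sym I0 modulus_ge0.
set I := modulus _ in I0; have K0 := K_gt0 v12.
have KM : 0 < 16 * K * `|M| + 1 by rewrite ltr_wpDl// mulr_ge0// mulr_ge0// ltW.
(* half the side of a parallelogram inside the given one, inside the disk of
   radius [d], and on which the integral is less than [I] *)
pose m := Num.min (Num.min (Num.min (a - s1) (s2 - a)) (Num.min (b - t1) (t2 - b)))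
  (Num.min (d / (4 * K)) (I / (16 * K * `|M| + 1))).
have m0 : 0 < m.
  by rewrite !lt_min !subr_gt0 a1 a2 b1 b2 /= !divr_gt0 ?mulr_gt0.
have [[m1 m2 m3 m4] m5 m6] : [/\ [/\ m <= a - s1, m <= s2 - a, m <= b - t1 & m <= t2 - b],
    m <= d / (4 * K) & m <= I / (16 * K * `|M| + 1)].
  by do !split; rewrite !ge_min lexx ?orbT.
have sh : oint g s1 s2 t1 t2 = oint g (a - m) (a + m) (b - m) (b + m).
  by apply: (oint_shrink _ _ _ _ dg); apply/andP; split; lra.
have l1 : a - m <= a + m by lra.
have l2 : b - m <= b + m by lra.
have bI : in_interior (a - m) (a + m) (b - m) (b + m) (pt a b).
  by exists a, b; split => //; apply/andP; split; lra.
have cg : continuous_edges (a - m) (a + m) (b - m) (b + m) g.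
  move=> z zE; apply/derivable_continuousC/dg; last exact: (interior_not_edge v12 bI zE).
  by apply: sub_rect (in_edges_rect zE); lra.
have : modulus (oint g (a - m) (a + m) (b - m) (b + m)) <= 4 * M * K * (a + m - (a - m) + (b + m - (b - m))).
  apply: (modulus_oint_le v12 l1 l2 cg) => z zE.
  apply: gM; first exact: (interior_not_edge v12 bI zE).
  have [s [t [/andP[? ?] /andP[? ?] -> _]]] := zE.
  rewrite ptB; apply: le_lt_trans (modulus_pt _ _ _ _) _.
  have : `|s - a| + `|t - b| <= 2 * m.
    have -> : 2 * m = m + m by ring.
    by apply: lerD; rewrite ler_norml; apply/andP; split; lra.
  move=> h; apply: le_lt_trans (ler_wpM2l (ltW K0) h) _.
  apply: le_lt_trans (_ : K * (2 * (d / (4 * K))) < _); first by rewrite ler_pM2l// ler_pM2l.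
  have -> : K * (2 * (d / (4 * K))) = d / 2 by field; exact: lt0r_neq0.
  lra.
rewrite -sh -/I.
have -> : 4 * M * K * (a + m - (a - m) + (b + m - (b - m))) = 16 * K * M * m by ring.
have M1 : 16 * K * M * m <= 16 * K * `|M| * m.
  apply: ler_wpM2r; first exact: ltW m0.
  by apply: ler_wpM2l; [rewrite mulr_ge0 ?(ltW K0)|exact: ler_norm].
move=> /le_trans /(_ M1) h.
move: m6; rewrite ler_pdivlMr// => m6; nra.
Qed.

(** The number [2 i pi], left unevaluated. *)
Definition wind w := oint (fun z => (z - w)^-1) s1 s2 t1 t2.

(** The quotient [(f z - f w) / (z - w)] is bounded near [w], as [f] has a
    derivative there; so its integral is zero. *)
Theorem cauchy_formula f w : interior w -> derivable_on rect f ->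
  oint (fun z => f z / (z - w)) s1 s2 t1 t2 = f w * wind w.
Proof.
move=> wI df; pose h z := (f z - f w) / (z - w).
have ce (g : C -> C) : (forall z, rect z -> z != w -> derivable g z 1) ->
    continuous_edges s1 s2 t1 t2 g.
  move=> dg z zE; apply/derivable_continuousC/dg; first exact: in_edges_rect.
  exact: (interior_not_edge v12 wI zE).
have dh z : rect z -> z != w -> derivable h z 1.
  move=> zr zw; apply: derivableMC; last exact: derivable_inv_sub.
  by apply: derivableB; [exact: df|exact: derivable_cst].
have dk z : rect z -> z != w -> derivable (fun z => (z - w)^-1) z 1.
  by move=> _ zw; exact: derivable_inv_sub.
have h0 : oint h s1 s2 t1 t2 = 0.
  have [l dl] : exists l, complex_derivative f w l.
    by apply/derivableCP/df/in_interior_rect.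
  have [d d0 dP] := dl 1 ltr01.
  apply: (@oint_bounded_singularity h w (1 + modulus l) d) => // z zw zd.
  rewrite /h modulusM modulusV ler_pdivrMr ?modulus_gt0 ?subr_eq0//.
  have := dP _ zd; rewrite [w + _]addrC subrK => H.
  have -> : f z - f w = (f z - f w - l * (z - w)) + l * (z - w) by rewrite subrK.
  by apply: le_trans (modulusD _ _) _; rewrite modulusM mulrDl lerD2r.
rewrite /wind -(ointZ v12 s12 t12 (f w) (ce _ dk)) -[RHS]add0r -h0.
rewrite -(ointD v12 s12 t12 (ce _ dh) (continuous_edgesZ (ce _ dk))).
by apply: eq_oint => // z _; rewrite /h; ring.
Qed.

Lemma Im_divC (z v : C) : Im (v / z) = orientation z v / (Re z ^+ 2 + Im z ^+ 2).
Proof. by case: z v => [x y] [a b]; rewrite /orientation /=; ring. Qed.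

Lemma norm2_gt0 (z : C) : z != 0 -> 0 < Re z ^+ 2 + Im z ^+ 2.
Proof.
case: z => x y; rewrite eq_complex /= negb_and => /orP[] h.
  by rewrite ltr_pwDl ?sqr_ge0// exprn_even_gt0.
by rewrite ltr_pwDr ?sqr_ge0// exprn_even_gt0.
Qed.

Lemma orientation_pt1 s t : orientation (pt s t) v1 = - t * orientation v1 v2.
Proof. by rewrite /pt /orientation; case: v1 v2 => [? ?] [? ?] /=; ring. Qed.

Lemma orientation_pt2 s t : orientation (pt s t) v2 = s * orientation v1 v2.
Proof. by rewrite /pt /orientation; case: v1 v2 => [? ?] [? ?] /=; ring. Qed.

(** Seen from an interior point, each side turns counterclockwise: this makes
    the imaginary part of its contribution positive. *)
Lemma wind_neq0 w : interior w -> wind w != 0.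
Proof.
move=> wI; move: (wI) => [a [b [/andP[a1 a2] /andP[b1 b2] wE]]].
suff : 0 < Im (wind w).
  by apply: contraTneq => ->; rewrite ltxx.
have ck : continuous_edges s1 s2 t1 t2 (fun z => (z - w)^-1).
  move=> z zE; apply/derivable_continuousC/derivable_inv_sub.
  exact: (interior_not_edge v12 wI zE).
have ne z : in_edges s1 s2 t1 t2 z -> z - w != 0.
  by move=> zE; rewrite subr_eq0; exact: (interior_not_edge v12 wI zE).
have [c1 c1s e1] := cint_Im_mean s12 (hor_continuous v12 t12 ck (or_introl erefl)).
have [c2 c2s e2] := cint_Im_mean s12 (hor_continuous v12 t12 ck (or_intror erefl)).
have [c3 c3s e3] := cint_Im_mean t12 (ver_continuous v12 s12 ck (or_introl erefl)).
have [c4 c4s e4] := cint_Im_mean t12 (ver_continuous v12 s12 ck (or_intror erefl)).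
rewrite /wind /oint !raddfB raddfD /= /hor /ver e1 e2 e3 e4 !Im_divC.
have n1 := norm2_gt0 (ne (pt c1 t1) _); have n2 := norm2_gt0 (ne (pt c2 t2) _).
have n3 := norm2_gt0 (ne (pt s1 c3) _); have n4 := norm2_gt0 (ne (pt s2 c4) _).
rewrite wE !ptB !orientation_pt1 !orientation_pt2 -!ptB -wE.
have p1 : 0 < (- (t1 - b) * orientation v1 v2) / (Re (pt c1 t1 - w) ^+ 2 + Im (pt c1 t1 - w) ^+ 2).
  apply: divr_gt0; first by apply: mulr_gt0 => //; lra.
  by apply: n1; exists c1, t1; rewrite lexx t12; split => //; right; left.
have p2 : 0 < ((t2 - b) * orientation v1 v2) / (Re (pt c2 t2 - w) ^+ 2 + Im (pt c2 t2 - w) ^+ 2).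
  apply: divr_gt0; first by apply: mulr_gt0 => //; lra.
  by apply: n2; exists c2, t2; rewrite lexx t12; split => //; right; right.
have p3 : 0 < (- (s1 - a) * orientation v1 v2) / (Re (pt s1 c3 - w) ^+ 2 + Im (pt s1 c3 - w) ^+ 2).
  apply: divr_gt0; first by apply: mulr_gt0 => //; lra.
  by apply: n3; exists s1, c3; rewrite lexx s12; split => //; left; left.
have p4 : 0 < ((s2 - a) * orientation v1 v2) / (Re (pt s2 c4 - w) ^+ 2 + Im (pt s2 c4 - w) ^+ 2).
  apply: divr_gt0; first by apply: mulr_gt0 => //; lra.
  by apply: n4; exists s2, c4; rewrite lexx s12; split => //; left; right.
have S : 0 < s2 - s1 by lra.
have T : 0 < t2 - t1 by lra.
have q1 := mulr_gt0 p1 S; have q2 := mulr_gt0 p2 S; have q3 := mulr_gt0 p3 T; have q4 := mulr_gt0 p4 T.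
by rewrite !mulNr in q1 q2 q3 q4 *; lra.
Qed.

(** The derivative of [wind] is the integral of [(z - u)^-2], which has a
    primitive; being zero, it can be integrated along a segment. *)
Lemma wind_const w w' : interior w -> interior w' -> wind w = wind w'.
Proof.
move=> wI wI'.
have dW u : interior u -> complex_derivative wind u 0.
  move=> uI; have [r r0 rP] := edges_dist v12 uI.
  have c1 : continuous_edges s1 s2 t1 t2 (fun=> 1) by move=> z _; exact: (derivable_continuousC (derivable_cst _ _ _)).
  have := oint_kernel_derivative1 v12 s12 t12 c1 r0 rP.
  rewrite (@oint_primitive _ v1 v2 _ _ _ _ s12 t12 (fun z => - 1 * (z - u)^-1)).
    rewrite (_ : (fun w => _) = wind)//; apply/funext => y.
    by apply: eq_oint => // z _; rewrite mul1r.
  move=> z zE; have nz : z - u != 0 by rewrite subr_eq0; exact: (interior_not_edge v12 uI zE).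
  have dz : complex_derivative (fun z => z - u) z (1 - 0).
    by apply: derivativeB; [exact: derivative_id|exact: derivative_cst].
  have := derivativeM (derivative_cst (-1) z) (@derivativeV _ (fun z => z - u) z _ nz dz).
  by congr complex_derivative; field.
move: wI wI' => [a [b [/andP[a1 a2] /andP[b1 b2] ->]]] [a' [b' [/andP[a1' a2'] /andP[b1' b2'] ->]]].
have := @cint_FTC _ wind (fun=> 0) (pt a b) (pt a' b' - pt a b) 0 1 ler01 _.
have -> : (fun t : R => (pt a' b' - pt a b) * (0 : C)) = fun=> 0.
  by apply/funext => t; rewrite mulr0.
rewrite cint0// rmorph0 rmorph1 mul0r mul1r addr0 [pt a b + _]addrC subrK => H.
apply/eqP; rewrite eq_sym -subr_eq0; apply/eqP; symmetry; apply: H => t /andP[t0 t1'].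
have conv_gt0 (x y : R) : 0 < x -> 0 < y -> 0 < (1 - t) * x + t * y.
  move=> x0 y0; move: t0; rewrite le_eqVlt => /orP[/eqP <-|t0]; first by lra.
  by rewrite ltr_wpDl ?mulr_gt0// mulr_ge0 ?subr_ge0// ltW.
apply: dW; exists (a + t * (a' - a)), (b + t * (b' - b)).
rewrite ptB; split; last by rewrite /pt !rmorphD !rmorphM /=; ring.
  have c1 := conv_gt0 (a - s1) (a' - s1); have c2 := conv_gt0 (s2 - a) (s2 - a').
  by apply/andP; split; [have := c1 _ _; lra|have := c2 _ _; lra].
have c1 := conv_gt0 (b - t1) (b' - t1); have c2 := conv_gt0 (t2 - b) (t2 - b').
by apply/andP; split; [have := c1 _ _; lra|have := c2 _ _; lra].
Qed.

End AroundPoint.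
End CauchyTheory.

(** * Local theory of holomorphic functions of one variable *)
Section Holomorphic.
Variable R : realType.
Local Notation C := 'CC_R.

Definition holomorphic_at (f : C -> C) (z : C) := \forall w \near z, derivable f w 1.

Lemma holomorphic_at_derivable f z : holomorphic_at f z -> derivable f z 1.
Proof. exact: nbhs_singleton. Qed.

Lemma holomorphic_at_near f z : holomorphic_at f z -> \forall w \near z, holomorphic_at f w.
Proof. by move=> hf; exact: (near_join hf). Qed.

Lemma holomorphic_at_eq f g z : (\forall w \near z, f w = g w) ->
  holomorphic_at f z -> holomorphic_at g z.
Proof.
move=> /near_join fg hf; apply: filterS2 fg hf => w e /derivableCP[l dl].
by apply/derivableCP; exists l; exact: derivative_near_eq dl.
Qed.

Lemma holomorphic_at_cst c z : holomorphic_at (fun=> c) z.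
Proof. by rewrite /holomorphic_at; near=> w; exact: derivable_cst. Unshelve. all: by end_near. Qed.

Lemma holomorphic_at_subr c z : holomorphic_at (fun y => y - c) z.
Proof. by rewrite /holomorphic_at; near=> w; exact: derivable_sub_cst. Unshelve. all: by end_near. Qed.

Lemma holomorphic_atM f g z : holomorphic_at f z -> holomorphic_at g z ->
  holomorphic_at (fun y => f y * g y) z.
Proof. by move=> hf hg; apply: filterS2 hf hg => w; exact: derivableMC. Qed.

Lemma near_neq0 (f : C -> C) z : {for z, continuous f} -> f z != 0 ->
  \forall w \near z, f w != 0.
Proof.
move=> /continuousCP cf f0; have := cf (modulus (f z)); rewrite modulus_gt0 => /(_ f0) H.
apply: filterS H => w; apply: contraTneq => ->.
by rewrite sub0r modulusN ltxx.
Qed.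

Lemma holomorphic_at_continuous f z : holomorphic_at f z -> {for z, continuous f}.
Proof. by move=> /holomorphic_at_derivable; exact: derivable_continuousC. Qed.

Lemma holomorphic_atV f z : holomorphic_at f z -> f z != 0 ->
  holomorphic_at (fun y => (f y)^-1) z.
Proof.
move=> hf f0; have nf := near_neq0 (holomorphic_at_continuous hf) f0.
by apply: filterS2 hf nf => w df fw; exact: derivableV.
Qed.

Lemma holomorphic_at_exprz f z (k : int) : holomorphic_at f z -> f z != 0 ->
  holomorphic_at (fun y => f y ^ k) z.
Proof.
move=> hf f0; case: k => n.
  by apply: filterS hf => w df; exact: derivableXC.
apply: (@holomorphic_atV (fun y => f y ^+ n.+1)); last by rewrite expf_neq0.
by apply: filterS hf => w df; exact: derivableXC.
Qed.

Lemma holomorphic_at_comp f g z : holomorphic_at f z -> holomorphic_at g (f z) ->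
  holomorphic_at (g \o f) z.
Proof.
move=> hf hg; have ng : \forall w \near z, derivable g (f w) 1.
  have /nbhsCP[e e0 eP] := hg.
  have /continuousCP/(_ e e0) := holomorphic_at_continuous hf.
  by apply: filterS => w /eP.
by apply: filterS2 hf ng => w df dg; exact: derivable_compC.
Qed.

Lemma orientation_1i : 0 < orientation (1 : C) ('i)%C.
Proof.
have -> : orientation (1 : C) ('i)%C = 1 * 1 - 0 * 0 by [].
by rewrite !mulr1 mulr0 subr0; exact: ltr01.
Qed.

(** Cauchy's formula around [z]; the winding number, being constant, is a
    normalising constant [c]. *)
Lemma cauchy_representation f z : holomorphic_at f z ->
  exists s1 s2 t1 t2 : R, exists2 c : C, c != 0 &
  [/\ s1 <= s2, t1 <= t2, in_interior 1 ('i)%C s1 s2 t1 t2 z,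
      derivable_on (in_rect 1 ('i)%C s1 s2 t1 t2) f
    & forall g w, in_interior 1 ('i)%C s1 s2 t1 t2 w ->
        derivable_on (in_rect 1 ('i)%C s1 s2 t1 t2) g ->
        g w = c * oint 1 ('i)%C (fun y => g y / (y - w)) s1 s2 t1 t2].
Proof.
move=> /(small_rect orientation_1i)[s1 [s2 [t1 [t2 [s12 t12 zI df]]]]].
have W0 := wind_neq0 orientation_1i s12 t12 zI.
exists s1, s2, t1, t2, (wind 1 ('i)%C s1 s2 t1 t2 z)^-1; first by rewrite invr_eq0.
split => // g w wI dg.
rewrite (cauchy_formula orientation_1i s12 t12 wI dg).
by rewrite (wind_const orientation_1i s12 t12 wI zI) mulrCA mulVf ?mulr1.
Qed.

(** Cauchy's formula can be differentiated twice under the integral sign. *)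
Lemma holomorphic_derive f z : holomorphic_at f z -> holomorphic_at ('D_1 f) z.
Proof.
move=> hf.
have [s1 [s2 [t1 [t2 [c c0 [s12 t12 zI df rep]]]]]] := cauchy_representation hf.
have cf := derivable_on_edges df.
pose F (w : C) : C := c * oint 1 ('i)%C (fun y => f y / (y - w)) s1 s2 t1 t2.
pose G (w : C) : C := c * oint 1 ('i)%C (fun y => f y / (y - w) ^+ 2) s1 s2 t1 t2.
have D w : in_interior 1 ('i)%C s1 s2 t1 t2 w -> 'D_1 f w = G w.
  move=> wI; have [r r0 rP] := edges_dist orientation_1i wI.
  have := derivativeM (derivative_cst c w) (oint_kernel_derivative1 orientation_1i s12 t12 cf r0 rP).
  have fE : \forall y \near w, F y = f y.
    by apply: filterS (nbhs_in_interior orientation_1i wI) => y yI; rewrite (rep f y yI df).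
  by rewrite mulr0 addr0 => dG; exact: complex_derivativeE (derivative_near_eq fE dG).
have I := nbhs_in_interior orientation_1i zI.
apply: (@holomorphic_at_eq G); first by apply: filterS I => y /D ->.
apply: filterS I => w wI; have [r r0 rP] := edges_dist orientation_1i wI.
apply: derivative_derivable.
exact: (derivativeM (derivative_cst c w) (oint_kernel_derivative2 orientation_1i s12 t12 cf r0 rP)).
Qed.

Definition divided_difference (f : C -> C) (z w : C) : C :=
  if w == z then 'D_1 f z else (f w - f z) / (w - z).

Lemma divided_differenceE f z w : f w = f z + (w - z) * divided_difference f z w.
Proof.
rewrite /divided_difference; have [->|wz] := eqVneq w z; first by rewrite subrr mul0r addr0.
by rewrite mulrCA divff ?subr_eq0// mulr1 addrC subrK.
Qed.

(** Removable singularities: Cauchy's formula for [f] gives one for its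
    divided differences, which thus extend holomorphically. *)
Lemma holomorphic_divided_difference f z : holomorphic_at f z ->
  holomorphic_at (divided_difference f z) z.
Proof.
move=> hf.
have [s1 [s2 [t1 [t2 [c c0 [s12 t12 zI df rep]]]]]] := cauchy_representation hf.
have cf := derivable_on_edges df.
have [rz rz0 rzP] := edges_dist orientation_1i zI.
have cphi : continuous_edges 1 ('i)%C s1 s2 t1 t2 (fun y => f y / (y - z)).
  exact: (continuous_kernel0 cf rz0 rzP (n := 1)).
pose F (w : C) : C := c * oint 1 ('i)%C (fun y => f y / (y - w)) s1 s2 t1 t2.
pose G (w : C) : C := c * oint 1 ('i)%C (fun y => f y / (y - z) / (y - w)) s1 s2 t1 t2.
have dG w : in_interior 1 ('i)%C s1 s2 t1 t2 w -> derivable G w 1.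
  move=> wI; have [r r0 rP] := edges_dist orientation_1i wI.
  apply: derivative_derivable.
  exact: (derivativeM (derivative_cst c w) (oint_kernel_derivative1 orientation_1i s12 t12 cphi r0 rP)).
have I := nbhs_in_interior orientation_1i zI.
apply: (@holomorphic_at_eq G); last by apply: filterS I => w /dG.
have fE : \forall y \near z, F y = f y.
  by apply: filterS I => y yI; rewrite (rep f y yI df).
apply: filterS I => w wI; rewrite /divided_difference; case: eqVneq => [->|wz].
  have := derivativeM (derivative_cst c z) (oint_kernel_derivative1 orientation_1i s12 t12 cf rz0 rzP).
  rewrite mulr0 addr0 => dF; symmetry; apply/complex_derivativeE.
  have -> : G z = c * oint 1 ('i)%C (fun y => f y / (y - z) ^+ 2) s1 s2 t1 t2.
    by congr (_ * _); apply: eq_oint => // y _; rewrite expr2 invfM mulrA.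
  exact: derivative_near_eq fE dF.
have [r r0 rP] := edges_dist orientation_1i wI.
have cw : continuous_edges 1 ('i)%C s1 s2 t1 t2 (fun y => f y / (y - w)).
  exact: (continuous_kernel0 cf r0 rP (n := 1)).
have cpw : continuous_edges 1 ('i)%C s1 s2 t1 t2 (fun y => f y / (y - z) / (y - w)).
  exact: (continuous_kernel0 cphi r0 rP (n := 1)).
have nwz : w - z != 0 by rewrite subr_eq0.
apply: (mulfI nwz); rewrite [RHS]mulrCA divff// mulr1.
rewrite (rep f w wI df) (rep f z zI df) /G -mulrBr mulrCA; congr (_ * _).
rewrite -(ointB orientation_1i s12 t12 cw cphi) -(ointZ orientation_1i s12 t12 _ cpw).
apply: eq_oint => // y yE.
have n1 : y - z != 0 by rewrite subr_eq0; exact: (interior_not_edge orientation_1i zI yE).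
have n2 : y - w != 0 by rewrite subr_eq0; exact: (interior_not_edge orientation_1i wI yE).
by field; rewrite n1 n2.
Qed.

Lemma divided_difference_holomorphic_at f z w : holomorphic_at f w ->
  holomorphic_at (divided_difference f z) w.
Proof.
have [->|wz hf] := eqVneq w z; first exact: holomorphic_divided_difference.
have nwz : \forall y \near w, y - z != 0.
  apply: near_neq0; last by rewrite subr_eq0.
  exact/derivable_continuousC/derivable_sub_cst.
apply: (@holomorphic_at_eq (fun y => (f y - f z) * (y - z)^-1)).
  by apply: filterS nwz => y yz; rewrite /divided_difference -subr_eq0 (negPf yz).
apply: holomorphic_atM.
  by apply: filterS hf => y dy; exact: (derivableB dy (derivable_cst _ _ _)).
by apply: holomorphic_atV; [exact: holomorphic_at_subr|rewrite subr_eq0].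
Qed.

(** If every division by [y - z] is possible, then Cauchy's formula bounds the
    [k]-th quotient by a constant times the [-k]-th power of the distance of
    [z] to the contour, so that [f] vanishes near [z]. *)
Theorem order_dichotomy f z : holomorphic_at f z ->
  (\forall w \near z, f w = 0) \/
  exists k u, [/\ holomorphic_at u z, u z != 0 & forall w, f w = (w - z) ^+ k * u w].
Proof.
move=> hf; pose u k := iter k (fun g => divided_difference g z) f.
have hu k : holomorphic_at (u k) z.
  by elim: k => [//|k IH]; exact: holomorphic_divided_difference.
have fu k : (forall j, (j < k)%N -> u j z = 0) -> forall w, f w = (w - z) ^+ k * u k w.
  elim: k => [_ w|k IH H w]; first by rewrite expr0 mul1r.
  rewrite (IH _ w); last by move=> j jk; apply: H; rewrite ltnS ltnW.
  by rewrite (divided_differenceE (u k) z w) H// add0r exprSr mulrA.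
have [[k uk]|all0] := pselect (exists k, u k z != 0).
  right; have ex : exists k, u k z != 0 by exists k.
  case: (ex_minnP ex) => m um mmin; exists m, (u m); split; [exact: hu|exact: um|].
  apply: (fu m) => j jm; apply/eqP/negPn/negP => /mmin.
  by rewrite leqNgt jm.
left; have {}fu k w : f w = (w - z) ^+ k * u k w.
  by apply: (fu k) => j _; apply/eqP/negPn/negP => uj; apply: all0; exists j.
clearbody u => {all0}.
have [s1 [s2 [t1 [t2 [c c0 [s12 t12 zI df rep]]]]]] := cauchy_representation hf.
have [B BP] := edges_bounded orientation_1i s12 t12 (derivable_on_edges df).
have [r r0 rP] := edges_dist orientation_1i zI.
have du k : derivable_on (in_rect 1 ('i)%C s1 s2 t1 t2) (u k).
  move=> w wr; have [->|wz] := eqVneq w z; first exact: holomorphic_at_derivable (hu k).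
  have dq : derivable (fun y => f y * ((y - z) ^+ k)^-1) w 1.
    apply: derivableMC; first exact: df.
    apply: (@derivableV _ _ (fun y => (y - z) ^+ k)); first by rewrite expf_neq0 ?subr_eq0.
    exact/derivableXC/derivable_sub_cst.
  have /derivableCP[l dl] := dq; apply/derivableCP; exists l; apply: derivative_near_eq dl.
  have : \forall y \near w, y - z != 0.
    apply: near_neq0; last by rewrite subr_eq0.
    exact/derivable_continuousC/derivable_sub_cst.
  by apply: filterS => y yz; rewrite (fu k y) mulrAC divff ?mul1r// expf_neq0.
pose K : R := modulus (1 : C) + modulus (('i)%C : C).
pose A := modulus c * (4 * (`|B| / (r / 2)) * K * ((s2 - s1) + (t2 - t1))).
have r20 : 0 < r / 2 by rewrite divr_gt0.
have bound k w : in_interior 1 ('i)%C s1 s2 t1 t2 w -> modulus (w - z) < r / 2 ->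
    modulus (f w) <= A * 2^-1 ^+ k.
  move=> wI wz; rewrite (fu k w) (rep (u k) w wI (du k)) mulrCA modulusM mulrC.
  rewrite modulusM modulusX.
  have rw y : in_edges 1 ('i)%C s1 s2 t1 t2 y -> r / 2 <= modulus (y - w).
    move=> /rP yz; have := modulusBle (y - z) (w - z).
    by rewrite opprB addrA subrK; lra.
  have := modulus_oint_le orientation_1i s12 t12 (f := fun y => u k y / (y - w))
    (M := `|B| / r ^+ k / (r / 2)) _ _.
  have cu : continuous_edges 1 ('i)%C s1 s2 t1 t2 (fun y => u k y / (y - w)).
    exact: (continuous_kernel0 (derivable_on_edges (du k)) r20 rw (n := 1)).
  move=> /(_ cu) H.
  have {}H := H _; set O := modulus (oint _ _ _ _ _ _ _) in H *.
  have {H} : O <= 4 * (`|B| / r ^+ k / (r / 2)) * K * (s2 - s1 + (t2 - t1)).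
    apply: H => y yE; rewrite modulusM modulusV.
    have yz := rP _ yE; have y0 : 0 < modulus (y - z) by exact: lt_le_trans yz.
    have uE : modulus (u k y) = modulus (f y) / modulus (y - z) ^+ k.
      by rewrite (fu k y) modulusM modulusX mulrAC divff ?mul1r// expf_neq0// lt0r_neq0.
    apply: ler_pM; rewrite ?modulus_ge0 ?invr_ge0 ?modulus_ge0//.
      rewrite uE; apply: ler_pM; rewrite ?modulus_ge0 ?invr_ge0 ?exprn_ge0 ?modulus_ge0//.
        exact: le_trans (BP _ yE) (ler_norm _).
      rewrite lef_pV2 ?posrE ?exprn_gt0//.
      by rewrite lerXn2r ?nnegrE ?(ltW r0) ?(ltW y0).
    rewrite lef_pV2 ?posrE//; first exact: rw.
    by apply: lt_le_trans (rw _ yE).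
  move=> H.
  have h1 : modulus (w - z) ^+ k <= (r / 2) ^+ k.
    by rewrite lerXn2r ?nnegrE ?modulus_ge0 ?(ltW r20) ?(ltW wz).
  have O0 : 0 <= O by exact: modulus_ge0.
  have wk0 : 0 <= modulus (w - z) ^+ k by rewrite exprn_ge0 ?modulus_ge0.
  have -> : A * 2^-1 ^+ k = modulus c * ((r / 2) ^+ k * (4 * (`|B| / r ^+ k / (r / 2)) * K * (s2 - s1 + (t2 - t1)))).
    rewrite /A exprMn; field; rewrite ?expf_neq0 ?lt0r_neq0//.
  rewrite mulrC; apply: ler_wpM2l; first exact: modulus_ge0.
  by apply: ler_pM.
have wr : \forall w \near z, modulus (w - z) < r / 2 by apply/nbhsCP; exists (r / 2).
apply: filterS2 (nbhs_in_interior orientation_1i zI) wr => w wI wz.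
apply/eqP; rewrite -modulus_eq0; apply/negPn/negP => fw0.
have {}fw0 : 0 < modulus (f w) by rewrite lt_neqAle eq_sym fw0 modulus_ge0.
have [k] := half_power_small A fw0.
by rewrite ltNge bound.
Qed.

End Holomorphic.

(** * The argument principle *)
Section ArgumentPrinciple.
Variable R : realType.
Local Notation C := 'CC_R.

Definition logarithmic_derivative (f : C -> C) (z l : C) :=
  complex_derivative f z (f z * l).

Lemma logarithmic_derivativeM f g z a b :
  logarithmic_derivative f z a -> logarithmic_derivative g z b ->
  logarithmic_derivative (fun y => f y * g y) z (a + b).
Proof.
move=> df dg; have := derivativeM df dg; rewrite /logarithmic_derivative.
by congr complex_derivative; ring.
Qed.

Lemma logarithmic_derivativeV f z a : f z != 0 ->
  logarithmic_derivative f z a -> logarithmic_derivative (fun y => (f y)^-1) z (- a).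
Proof.
move=> f0 df; have := derivativeV f0 df; rewrite /logarithmic_derivative.
by congr complex_derivative; field.
Qed.

Lemma logarithmic_derivative_exprz (w z : C) (k : int) : z != w ->
  logarithmic_derivative (fun y => (y - w) ^ k) z (k%:~R / (z - w)).
Proof.
move=> zw; have nz : z - w != 0 by rewrite subr_eq0.
have d1 : logarithmic_derivative (fun y => y - w) z (z - w)^-1.
  rewrite /logarithmic_derivative divff//.
  by have := derivativeB (derivative_id z) (derivative_cst w z); rewrite subr0.
have dn n : logarithmic_derivative (fun y => (y - w) ^+ n) z (n%:R / (z - w)).
  elim: n => [|n IH]; first by rewrite mul0r /logarithmic_derivative mulr0; exact: derivative_cst.
  rewrite (_ : (fun y => _) = fun y => (y - w) * (y - w) ^+ n); last first.
    by apply/funext => y; rewrite exprS.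
  have := logarithmic_derivativeM d1 IH; congr logarithmic_derivative.
  by rewrite -natr1 mulrDl mul1r addrC.
case: k => n; first exact: dn.
have := logarithmic_derivativeV (f := fun y => (y - w) ^+ n.+1) _ (dn n.+1).
by rewrite NegzE mulrNz mulNr; apply; rewrite expf_neq0.
Qed.

Lemma logarithmic_derivative_prod (S : seq C) (N : C -> int) z : z \notin S ->
  logarithmic_derivative (fun y => \prod_(a <- S) (y - a) ^ N a) z
    (\sum_(a <- S) (N a)%:~R / (z - a)).
Proof.
elim: S => [|a S IH] zS.
  rewrite big_nil (_ : (fun y => _) = fun=> 1); last by apply/funext => y; rewrite big_nil.
  by rewrite /logarithmic_derivative mulr0; exact: derivative_cst.
move: zS; rewrite inE negb_or => /andP[za zS].
rewrite big_cons (_ : (fun y => _) = fun y => (y - a) ^ N a * \prod_(a <- S) (y - a) ^ N a).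
  exact: logarithmic_derivativeM (logarithmic_derivative_exprz _ za) (IH zS).
by apply/funext => y; rewrite big_cons.
Qed.

Section Count.
Variables v1 v2 : C.
Hypothesis v12 : 0 < orientation v1 v2.
Variables s1 s2 t1 t2 : R.
Hypotheses (s12 : s1 <= s2) (t12 : t1 <= t2).
Local Notation rect := (in_rect v1 v2 s1 s2 t1 t2).
Local Notation edges := (in_edges v1 v2 s1 s2 t1 t2).
Local Notation interior := (in_interior v1 v2 s1 s2 t1 t2).
Local Notation oint f := (oint v1 v2 f s1 s2 t1 t2).
Local Notation wind := (wind v1 v2 s1 s2 t1 t2).

(** The logarithmic derivative of [g] is that of [u], whose integral is zero by
    Goursat's theorem, plus a sum of kernels [N a / (z - a)]. *)
Theorem argument_principle (S : seq C) (N : C -> int) (u g : C -> C) w :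
  interior w -> (forall a, a \in S -> interior a) ->
  (forall z, rect z -> holomorphic_at u z /\ u z != 0) ->
  (forall z, edges z -> \forall y \near z, g y = u y * \prod_(a <- S) (y - a) ^ N a) ->
  oint (fun z => 'D_1 g z / g z) = wind w * (\sum_(a <- S) N a)%:~R.
Proof.
move=> wI SI hu gE.
have nS z : edges z -> z \notin S.
  by move=> zE; apply/negP => /SI zI; have := interior_not_edge v12 zI zE; rewrite eqxx.
have L z : edges z -> 'D_1 g z / g z = 'D_1 u z / u z + \sum_(a <- S) (N a)%:~R / (z - a).
  move=> zE; have [hz uz] := hu _ (in_edges_rect zE).
  have du : logarithmic_derivative u z ('D_1 u z / u z).
    rewrite /logarithmic_derivative mulrCA divff// mulr1.
    exact/derivable_derivative/holomorphic_at_derivable.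
  have d := logarithmic_derivativeM du (logarithmic_derivative_prod N (nS _ zE)).
  have gz := nbhs_singleton (gE _ zE).
  have g0 : g z != 0.
    rewrite gz mulf_neq0//; rewrite prodf_seq_neq0; apply/allP => a aS /=.
    by apply: expfz_neq0; rewrite subr_eq0; apply: contraNneq (nS _ zE) => ->.
  have dg : complex_derivative g z (g z * ('D_1 u z / u z + \sum_(a <- S) (N a)%:~R / (z - a))).
    rewrite gz; apply: derivative_near_eq d.
    by apply: filterS (gE _ zE) => y /esym; exact.
  by rewrite (complex_derivativeE dg) mulrAC divff// mul1r.
have du : derivable_on rect (fun z => 'D_1 u z / u z).
  move=> z /hu[hz uz]; apply: holomorphic_at_derivable; apply: holomorphic_atM.
    exact: holomorphic_derive.
  exact: holomorphic_atV.
have ck a : a \in S -> continuous_edges v1 v2 s1 s2 t1 t2 (fun z => (z - a)^-1).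
  move=> aS z zE; apply/derivable_continuousC/derivable_inv_sub.
  exact: (interior_not_edge v12 (SI _ aS) zE).
have [cS oS] : continuous_edges v1 v2 s1 s2 t1 t2 (fun z => \sum_(a <- S) (N a)%:~R / (z - a)) /\
    oint (fun z => \sum_(a <- S) (N a)%:~R / (z - a)) = wind w * (\sum_(a <- S) N a)%:~R.
  elim: S SI ck {gE nS L} => [|a S IH] SI ck.
    rewrite (_ : (fun z => _) = fun=> 0); last by apply/funext => y; rewrite big_nil.
    have c0 : continuous_edges v1 v2 s1 s2 t1 t2 (fun=> 0).
      by move=> z _; exact: (derivable_continuousC (derivable_cst _ _ _)).
    split => //; rewrite big_nil mulr0.
    apply: (oint_primitive s12 t12 (F := fun=> 0)) => z _; exact: derivative_cst.
  have [||c o] := IH; first by move=> b bS; apply: SI; rewrite inE bS orbT.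
    by move=> b bS; apply: ck; rewrite inE bS orbT.
  have ca := ck a (mem_head _ _).
  have cZ := continuous_edgesZ (a := (N a)%:~R) ca.
  rewrite (_ : (fun z => _) = fun z => (N a)%:~R / (z - a) + \sum_(a <- S) (N a)%:~R / (z - a)); last first.
    by apply/funext => y; rewrite big_cons.
  split; first exact: (continuous_edgesD cZ c).
  rewrite (ointD v12 s12 t12 cZ c) o (ointZ v12 s12 t12 _ ca) big_cons intrD [RHS]mulrDr.
  rewrite (wind_const v12 s12 t12 wI (SI _ (mem_head _ _))).
  by congr (_ + _); exact: mulrC.
rewrite (eq_oint s12 t12 L) (ointD v12 s12 t12 (derivable_on_edges du) cS) oS.
by rewrite (goursat v12 s12 t12 du) add0r.
Qed.

End Count.

(** If [f - f z] vanished at [z] to order [k], then so would, in number, the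
    functions [f - f w] for [w] close to [z]; but these have only one zero, which
    is simple wherever the derivative is nonzero.  If [k] is not 1, then the
    derivative vanishes near [z] and [f] is constant there. *)
Theorem injective_derivative_neq0 (f : C -> C) z (P : set C) : nbhs z P ->
  holomorphic_at f z -> (forall x y, P x -> P y -> f x = f y -> x = y) ->
  'D_1 f z != 0.
Proof.
move=> zP hf finj; apply/negP => /eqP df0.
have zz : P z by exact: nbhs_singleton.
have ncst : ~ (\forall y \near z, f y = f z).
  move=> H; have /nbhsCP[e e0 eP] : \forall y \near z, P y /\ f y = f z by apply: filterS2 zP H.
  pose y := z + (e / 2)%:C%C.
  have yz : y - z = (e / 2)%:C%C by rewrite /y addrC addKr.
  have e2 : 0 < e / 2 by rewrite divr_gt0.
  have [|Py fy] := eP y; first by rewrite yz modulus_real gtr0_norm//; lra.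
  have := finj _ _ Py zz fy => /eqP; rewrite -subr_eq0 yz -modulus_eq0 modulus_real gtr0_norm//.
  by rewrite gt_eqF.
have hfz : holomorphic_at (fun y => f y - f z) z.
  by apply: filterS hf => w dw; exact: (derivableB dw (derivable_cst _ _ _)).
case: (order_dichotomy hfz) => [H|[k [u [hu u0 fE]]]].
  by apply: ncst; apply: filterS H => y /eqP; rewrite subr_eq0 => /eqP.
have k1 : k != 1%N.
  apply/eqP => k1; rewrite k1 in fE.
  have d1 : complex_derivative (fun w => (w - z) * u w) z ((z - z) * 'D_1 u z + u z * (1 - 0)).
    apply: derivativeM; last exact/derivable_derivative/holomorphic_at_derivable.
    by apply: derivativeB; [exact: derivative_id|exact: derivative_cst].
  have d2 : complex_derivative (fun w => f w - f z) z ('D_1 f z - 0).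
    apply: derivativeB; last exact: derivative_cst.
    exact/derivable_derivative/holomorphic_at_derivable.
  have e : (fun w => f w - f z) = (fun w => (w - z) * u w) by apply/funext => w; rewrite fE expr1.
  rewrite e in d2; have := derivative_unique d1 d2.
  by rewrite df0 !subr0 subrr mul0r add0r mulr1 => /eqP; rewrite (negPf u0).
have nice : \forall y \near z, [/\ P y, holomorphic_at f y, holomorphic_at u y & u y != 0].
  have h1 := holomorphic_at_near hf; have h2 := holomorphic_at_near hu.
  have h3 := near_neq0 (holomorphic_at_continuous hu) u0.
  by apply: filterS2 (filterI zP h1) (filterI h2 h3) => y [? ?] [? ?].
have [s1 [s2 [t1 [t2 [s12 t12 zI rP]]]]] := small_rect (orientation_1i R) nice.
set o := orientation_1i R in zI.
pose W := wind 1 ('i)%C s1 s2 t1 t2 z.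
have W0 : W != 0 := wind_neq0 o s12 t12 zI.
have dfc c y : in_rect 1 ('i)%C s1 s2 t1 t2 y -> 'D_1 (fun w => f w - c) y = 'D_1 f y.
  move=> /rP[_ hy _ _]; apply: complex_derivativeE; rewrite -[X in complex_derivative _ _ X]subr0.
  by apply: derivativeB; [exact/derivable_derivative/holomorphic_at_derivable|exact: derivative_cst].
have count0 : oint 1 ('i)%C (fun y => 'D_1 f y / (f y - f z)) s1 s2 t1 t2 = W * k%:R.
  rewrite (@eq_oint _ _ _ _ _ _ _ s12 t12 _ (fun y => 'D_1 (fun w => f w - f z) y / (f y - f z))); last first.
    by move=> y yE; rewrite dfc//; exact: in_edges_rect.
  have := @argument_principle _ _ o _ _ _ _ s12 t12 [:: z] (fun=> k%:Z) u (fun w => f w - f z) z zI.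
  rewrite big_seq1 -pmulrn; apply.
  - by move=> a; rewrite inE => /eqP ->.
  - by move=> y /rP[].
  - by move=> y _; near=> x; rewrite big_seq1 fE mulrC.
have count1 y : in_interior 1 ('i)%C s1 s2 t1 t2 y -> 'D_1 f y != 0 ->
    oint 1 ('i)%C (fun x => 'D_1 f x / (f x - f y)) s1 s2 t1 t2 = W.
  move=> yI dfy; have [Py hy _ _] := rP _ (in_interior_rect yI).
  rewrite (@eq_oint _ _ _ _ _ _ _ s12 t12 _ (fun x => 'D_1 (fun w => f w - f y) x / (f x - f y))); last first.
    by move=> x xE; rewrite dfc//; exact: in_edges_rect.
  have := @argument_principle _ _ o _ _ _ _ s12 t12 [:: y] (fun=> 1) (divided_difference f y) (fun w => f w - f y) z zI.
  rewrite big_seq1 mulr1; apply.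
  - by move=> a; rewrite inE => /eqP ->.
  - move=> x xr; have [Px hx _ _] := rP _ xr.
    split; first exact: divided_difference_holomorphic_at.
    rewrite /divided_difference; have [//|xy] := eqVneq x y.
    rewrite mulf_neq0 ?invr_eq0 ?subr_eq0//.
    by apply: contra_neq xy; exact: finj.
  - by move=> x _; near=> w; rewrite big_seq1 {1}(divided_differenceE f y w) expr1z addrC addKr mulrC.
have ne0 y : in_edges 1 ('i)%C s1 s2 t1 t2 y -> f y - f z != 0.
  move=> yE; rewrite subr_eq0; apply: contraNneq (interior_not_edge o zI yE) => e.
  by apply/eqP; apply: finj e => //; have [] := rP _ (in_edges_rect yE).
have cf : continuous_edges 1 ('i)%C s1 s2 t1 t2 (fun y => f y - f z).
  move=> y yE; apply: derivable_continuousC.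
  have [_ hy _ _] := rP _ (in_edges_rect yE).
  exact: (derivableB (holomorphic_at_derivable hy) (derivable_cst _ _ _)).
have cdf : continuous_edges 1 ('i)%C s1 s2 t1 t2 ('D_1 f).
  move=> y yE; have [_ hy _ _] := rP _ (in_edges_rect yE).
  exact/holomorphic_at_continuous/holomorphic_derive.
have ci : continuous_edges 1 ('i)%C s1 s2 t1 t2 (fun y => (f y - f z)^-1).
  by move=> y yE; apply: continuous_inv; [exact: ne0|exact: cf].
have [B BP] := edges_bounded o s12 t12 ci.
have [B' BP'] := edges_bounded o s12 t12 cdf.
pose b := `|B| + 1; have b0 : 0 < b by rewrite ltr_wpDl.
have lo y : in_edges 1 ('i)%C s1 s2 t1 t2 y -> b^-1 <= modulus (f y - f z).
  move=> yE; rewrite -[leRHS]invrK lef_pV2 ?posrE// ?invr_gt0 ?modulus_gt0 ?ne0//.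
  rewrite -modulusV; apply: le_trans (BP _ yE) _; apply: le_trans (ler_norm _) _.
  by rewrite /b lerDl.
(* [L * modulus (f y - f z)] bounds the difference of the two counting integrals,
   which is a multiple of [W] by a nonzero integer *)
pose L : R := 4 * (`|B'| * b * (2 * b)) * (modulus (1 : C) + modulus (('i)%C : C)) * ((s2 - s1) + (t2 - t1)).
have est y : in_interior 1 ('i)%C s1 s2 t1 t2 y -> 'D_1 f y != 0 ->
    modulus (f y - f z) < b^-1 / 2 -> modulus W <= L * modulus (f y - f z).
  move=> yI dfy ys.
  have lo' x : in_edges 1 ('i)%C s1 s2 t1 t2 x -> b^-1 / 2 <= modulus (f x - f y).
    move=> /lo xz; have := modulusBle (f x - f z) (f y - f z).
    by rewrite opprB addrA subrK; lra.
  have b20 : 0 < b^-1 / 2 by rewrite divr_gt0// invr_gt0.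
  have ne1 x : in_edges 1 ('i)%C s1 s2 t1 t2 x -> f x - f y != 0.
    by move=> xE; rewrite -modulus_gt0; apply: lt_le_trans (lo' _ xE).
  have ci1 : continuous_edges 1 ('i)%C s1 s2 t1 t2 (fun x => (f x - f y)^-1).
    move=> x xE; apply: continuous_inv; first exact: ne1.
    apply: derivable_continuousC; have [_ hy _ _] := rP _ (in_edges_rect xE).
    exact: (derivableB (holomorphic_at_derivable hy) (derivable_cst _ _ _)).
  have cz : continuous_edges 1 ('i)%C s1 s2 t1 t2 (fun x => 'D_1 f x / (f x - f z)).
    exact: (continuous_edgesM cdf ci).
  have cy : continuous_edges 1 ('i)%C s1 s2 t1 t2 (fun x => 'D_1 f x / (f x - f y)).
    exact: (continuous_edgesM cdf ci1).
  have := modulus_oint_le o s12 t12 (f := fun x => 'D_1 f x / (f x - f z) - 'D_1 f x / (f x - f y))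
    (M := `|B'| * b * (2 * b) * modulus (f y - f z)) _ _.
  rewrite (ointB o s12 t12 cz cy) count0 (count1 _ yI dfy) => H.
  have {}H := H _ _.
  have W1 : modulus W <= modulus (W * k%:R - W).
    rewrite -[X in _ - X]mulr1 -mulrBr modulusM ler_peMr ?modulus_ge0//.
    case: (k) k1 => [|[//|m]] _; first by rewrite sub0r modulusN modulus1.
    by rewrite -[m.+2%:R]natr1 addrK modulus_nat ler1n.
  apply: le_trans W1 _; rewrite /L.
  have -> : 4 * (`|B'| * b * (2 * b)) * (modulus (1 : C) + modulus (('i)%C : C)) * (s2 - s1 + (t2 - t1)) * modulus (f y - f z)
     = 4 * (`|B'| * b * (2 * b) * modulus (f y - f z)) * (modulus (1 : C) + modulus (('i)%C : C)) * (s2 - s1 + (t2 - t1)) by ring.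
  apply: H => [x xE|x xE]; first exact: (continuousB (cz x xE) (cy x xE)).
  have n0 := ne0 _ xE; have n1 := ne1 _ xE.
  have -> : 'D_1 f x / (f x - f z) - 'D_1 f x / (f x - f y) =
      'D_1 f x * (f x - f z)^-1 * (f x - f y)^-1 * - (f y - f z) by field; rewrite n0 n1.
  rewrite !modulusM modulusN !modulusV ler_wpM2r ?modulus_ge0//.
  apply: ler_pM; rewrite ?mulr_ge0 ?invr_ge0 ?modulus_ge0//.
    apply: ler_pM; rewrite ?invr_ge0 ?modulus_ge0//.
      exact: le_trans (BP' _ xE) (ler_norm _).
    by rewrite invf_ple ?posrE ?modulus_gt0// lo.
  rewrite invf_ple ?posrE ?modulus_gt0 ?mulr_gt0// invfM mulrC; exact: lo'.
have L0 : 0 <= L.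
  rewrite /L; apply: mulr_ge0; last by rewrite addr_ge0 ?subr_ge0.
  apply: mulr_ge0; last by rewrite addr_ge0 ?modulus_ge0.
  by do !apply: mulr_ge0 => //; exact: ltW.
have df_near : \forall y \near z, 'D_1 f y = 0.
  have /continuousCP/(_ (Num.min (b^-1 / 2) (modulus W / (L + 1)))) := holomorphic_at_continuous hf.
  rewrite lt_min !divr_gt0 ?invr_gt0 ?modulus_gt0// ?ltr_wpDl// => /(_ isT) cl.
  apply: filterS2 cl (nbhs_in_interior o zI) => y + yI.
  rewrite lt_min => /andP[y1 y2]; apply/eqP/negPn/negP => dfy.
  have := est _ yI dfy y1; move: y2; rewrite ltr_pdivlMr ?ltr_wpDl// => y2 y3.
  have := modulus_ge0 (f y - f z); lra.
apply: ncst; have /nbhsCP[e e0 eP] : \forall y \near z, 'D_1 f y = 0 /\ holomorphic_at f y.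
  by apply: filterS2 df_near (holomorphic_at_near hf).
apply/nbhsCP; exists e => // y ye.
have := @cint_FTC _ f (fun=> 0) z (y - z) 0 1 ler01 _.
have -> : (fun t : R => (y - z) * (0 : C)) = fun=> 0 by apply/funext => t; rewrite mulr0.
rewrite cint0// rmorph0 rmorph1 mul0r mul1r addr0 [z + _]addrC subrK => H.
apply/eqP; rewrite -subr_eq0; apply/eqP; symmetry; apply: H => t /andP[t0 t1'].
have [|d0 hy] := eP (z + t%:C%C * (y - z)).
  rewrite addrC addKr modulusM modulus_real ger0_norm//.
  by apply: le_lt_trans ye; rewrite ler_piMl ?modulus_ge0.
by rewrite -d0; exact/derivable_derivative/holomorphic_at_derivable.
Unshelve. all: by end_near.
Qed.

End ArgumentPrinciple.

(** * Doubly periodic functions *)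
Section DoublyPeriodic.
Variable R : realType.
Local Notation C := 'CC_R.

Definition agrees_near (g u : C -> C) (z : C) := \forall w \near z, w != z -> g w = u w.

(** The value at [z] that makes [g] continuous there, if there is one. *)
Definition regular_value (g : C -> C) (z : C) : C := lim (g w @[w --> z^']).

Lemma regular_valueE g u z : agrees_near g u z -> {for z, continuous u} ->
  regular_value g z = u z.
Proof.
move=> gu /continuousCP cu; apply/cvg_lim; first exact: norm_hausdorff.
move=> P /nbhsCP[e e0 eP]; rewrite /= nbhs_filterE.
have H : \forall w \near z, w != z -> P (g w).
  by apply: filterS2 gu (cu _ e0) => w h we wz; rewrite h//; exact: eP.
exact: H.
Qed.

Lemma agrees_near_open g u z : agrees_near g u z ->
  \forall w \near z, agrees_near g u w.
Proof.
move=> gu; have := near_join gu; apply: filterS => w Hw.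
have [->|wz] := eqVneq w z.
  exact: gu.
have : \forall y \near w, y - z != 0.
  apply: near_neq0; last by rewrite subr_eq0.
  exact/derivable_continuousC/derivable_sub_cst.
by move=> ny; apply: filterS2 ny Hw => y yz h _; apply: h; rewrite -subr_eq0.
Qed.

Lemma regular_value_near g u z : agrees_near g u z -> holomorphic_at u z ->
  \forall w \near z, regular_value g w = u w.
Proof.
move=> /agrees_near_open gu hu; apply: filterS2 gu hu => w gw du.
by apply: (regular_valueE gw); exact: derivable_continuousC.
Qed.

Lemma regularization g : exists G : C -> C, forall u z,
  agrees_near g u z -> holomorphic_at u z -> \forall w \near z, G w = u w.
Proof. by exists (regular_value g) => u z; exact: regular_value_near. Qed.

(** The order in the plane, with punctured neighbourhoods as for [has_order]. *)
Definition plane_order (g : C -> C) (z : C) (k : int) := exists u : C -> C,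
  [/\ holomorphic_at u z, u z != 0 & agrees_near g (fun w => (w - z) ^ k * u w) z].

Lemma holomorphic_at_prod (S : seq C) (N : C -> int) z (Q : pred C) :
  (forall a, a \in S -> Q a -> a != z) ->
  holomorphic_at (fun w => \prod_(a <- S | Q a) (w - a) ^ N a) z /\
  \prod_(a <- S | Q a) (z - a) ^ N a != 0.
Proof.
elim: S => [|a S IH] H.
  rewrite (_ : (fun w => _) = fun=> 1); last by apply/funext => w; rewrite big_nil.
  by split; [exact: holomorphic_at_cst|rewrite big_nil oner_eq0].
have [|h n] := IH; first by move=> b bS; apply: H; rewrite inE bS orbT.
case Qa : (Q a); last first.
  rewrite (_ : (fun w => _) = fun w => \prod_(a <- S | Q a) (w - a) ^ N a).
    by rewrite big_cons Qa.
  by apply/funext => w; rewrite big_cons Qa.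
have za : z - a != 0 by rewrite subr_eq0 eq_sym; apply: H; rewrite ?mem_head.
rewrite (_ : (fun w => _) = fun w => (w - a) ^ N a * \prod_(a <- S | Q a) (w - a) ^ N a); last first.
  by apply/funext => w; rewrite big_cons Qa.
split; last by rewrite big_cons Qa mulf_neq0// expfz_neq0.
apply: holomorphic_atM h.
by apply: (@holomorphic_at_exprz _ (fun w => w - a)); [exact: holomorphic_at_subr|].
Qed.

Section Periods.
Variables v1 v2 : C.
Hypothesis v12 : 0 < orientation v1 v2.
Local Notation coord1 := (coord1 v1 v2).
Local Notation coord2 := (coord2 v1 v2).
Local Notation pt := (pt v1 v2).

Definition in_cell (z : C) := (0 <= coord1 z < 1) && (0 <= coord2 z < 1).

Lemma coord1D z w : coord1 (z + w) = coord1 z + coord1 w.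
Proof. by rewrite -[z](pt_coord v12) -[w](pt_coord v12) ptD !coord1_pt. Qed.

Lemma coord2D z w : coord2 (z + w) = coord2 z + coord2 w.
Proof. by rewrite -[z](pt_coord v12) -[w](pt_coord v12) ptD !coord2_pt. Qed.

Lemma pt_add1 s t : pt (s + 1) t = pt s t + v1.
Proof. by rewrite /pt rmorphD rmorph1 mulrDl mul1r addrAC. Qed.

Lemma pt_add2 s t : pt s (t + 1) = pt s t + v2.
Proof. by rewrite /pt rmorphD rmorph1 mulrDl mul1r addrA. Qed.

(** The zeros and poles in a cell avoid a strip along its far sides, so that a
    slight translation of the cell has none on its boundary; the logarithmic
    derivative then has the same values on opposite sides. *)
Theorem doubly_periodic_degree (g : C -> C) (N : C -> int) (S : seq C) : uniq S ->
  (forall z, g (z + v1) = g z) -> (forall z, g (z + v2) = g z) ->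
  (forall z, N (z + v1) = N z) -> (forall z, N (z + v2) = N z) ->
  (forall z, plane_order g z (N z)) ->
  (forall z, z \in S -> in_cell z) ->
  (forall z, in_cell z -> N z != 0 -> z \in S) ->
  \sum_(a <- S) N a = 0.
Proof.
move=> uS g1 g2 N1 N2 gN Scell NS.
have [d [d0 d1 dS]] : exists d : R, [/\ 0 < d, d < 1 &
    forall a, a \in S -> coord1 a < 1 - 2 * d /\ coord2 a < 1 - 2 * d].
  elim: (S) Scell => [|a S' IH] H; first by exists (1 / 2); split => //; lra.
  have [|d [d0 d1 dS]] := IH; first by move=> z zS; apply: H; rewrite inE zS orbT.
  have /andP[/andP[_ c1] /andP[_ c2]] := H a (mem_head _ _).
  pose m := Num.min d (Num.min ((1 - coord1 a) / 4) ((1 - coord2 a) / 4)).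
  have [m1 m2 m3] : [/\ m <= d, m <= (1 - coord1 a) / 4 & m <= (1 - coord2 a) / 4].
    by split; rewrite !ge_min lexx ?orbT.
  have m0 : 0 < m by rewrite !lt_min d0 !divr_gt0// subr_gt0.
  exists m; split; [exact: m0|lra|] => b; rewrite inE => /orP[/eqP ->|/dS[? ?]]; split; lra.
(* the cell translated by [d] towards the origin *)
set o := - d; set e := 1 - d.
have oe : o <= e by rewrite /o /e; lra.
pose rect := in_rect v1 v2 o e o e; pose inner := in_interior v1 v2 o e o e.
have Sinner a : a \in S -> inner a.
  move=> aS; have [c1 c2] := dS _ aS; have /andP[/andP[? _] /andP[? _]] := Scell _ aS.
  exists (coord1 a), (coord2 a); rewrite (pt_coord v12) /o /e.
  by split; [apply/andP; split; lra|apply/andP; split; lra|].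
have N0 z : rect z -> z \notin S -> N z = 0.
  move=> [s [t [/andP[s1 s2] /andP[t1 t2] zE]]] zS; apply/eqP/negPn/negP => Nz.
  pose s' := if s < 0 then s + 1 else s; pose t' := if t < 0 then t + 1 else t.
  have Ns : N (pt s' t) = N z.
    by rewrite /s' zE; case: ifP => // _; rewrite pt_add1 N1.
  have Nt : N (pt s' t') = N z.
    by rewrite -Ns /t'; case: ifP => // _; rewrite pt_add2 N2.
  have s'b : 0 <= s' < 1 by rewrite /s' /o /e in s1 s2 *; case: ltP => h; apply/andP; split; lra.
  have t'b : 0 <= t' < 1 by rewrite /t' /o /e in t1 t2 *; case: ltP => h; apply/andP; split; lra.
  have := NS (pt s' t'); rewrite /in_cell (coord1_pt v12) (coord2_pt v12) s'b t'b Nt => /(_ isT Nz) S'.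
  have [] := dS _ S'; rewrite (coord1_pt v12) (coord2_pt v12) => h1 h2.
  move: S' h1 h2; rewrite /s' /t'; case: ltP => hs; case: ltP => ht S' h1 h2; try (rewrite /o in s1 t1; lra).
  by move: zS; rewrite zE S'.
(* [g] without its zeros and poles in the cell *)
pose h w := g w * (\prod_(a <- S) (w - a) ^ N a)^-1.
have hP z : rect z -> exists u, [/\ holomorphic_at u z, u z != 0 & agrees_near h u z].
  move=> zr; have [u [hu u0 gu]] := gN z.
  have [|hp p0] := @holomorphic_at_prod S N z (fun a => a != z); first by [].
  exists (fun w => u w * (\prod_(a <- S | a != z) (w - a) ^ N a)^-1); split.
  - by apply: holomorphic_atM hu _; exact: holomorphic_atV.
  - by rewrite mulf_neq0// invr_eq0.
  apply: filterS gu => w gw wz; rewrite /h (gw wz).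
  have wz0 : (w - z) ^ N z != 0 by rewrite expfz_neq0 // subr_eq0.
  have [zS|zS] := boolP (z \in S).
    rewrite (bigD1_seq z)//= invfM mulrACA divff// mul1r//.
  rewrite N0// expr0z mul1r; congr (_ * _^-1).
  rewrite big_seq_cond [RHS]big_seq_cond; apply: eq_bigl => a.
  by case aS : (a \in S) => //=; apply/esym; apply: contraNneq zS => <-.
(* [g] and [h] may have wrong values at isolated points; [G] and [u] do not *)
have [u uP] := regularization h; have [G GP] := regularization g.
have hu z : rect z -> holomorphic_at u z /\ u z != 0.
  move=> /hP[U [hU U0 hUz]]; have uU := uP _ _ hUz hU; split.
    by apply: holomorphic_at_eq hU; apply: filterS uU => w /esym; exact.
  by rewrite (nbhs_singleton uU).
have Gloc z : rect z -> z \notin S -> exists U, [/\ holomorphic_at U z, U z != 0, agrees_near g U z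
    & forall w, agrees_near g (fun y => U (y - w)) (z + w) -> 'D_1 G (z + w) / G (z + w) = 'D_1 G z / G z].
  move=> zr zS; have [U [hU U0 gU]] := gN z.
  have {}gU : agrees_near g U z.
    by apply: filterS gU => y gy yz; rewrite gy// N0// expr0z mul1r.
  exists U; split; [exact: hU|exact: U0|exact: gU|move=> w gUw].
  have dU := derivable_derivative (holomorphic_at_derivable hU).
  have GU : \forall y \near z, G y = U y by exact: GP gU hU.
  have hUw : holomorphic_at (fun y => U (y - w)) (z + w).
    apply: (@holomorphic_at_comp _ (fun y => y - w) U); first exact: holomorphic_at_subr.
    by rewrite addrK.
  have GUw : \forall y \near z + w, G y = U (y - w) by exact: GP gUw hUw.
  have dG : complex_derivative G z ('D_1 U z).
    by apply: derivative_near_eq dU; apply: filterS GU => y /esym; exact.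
  have dGw : complex_derivative G (z + w) ('D_1 U z).
    apply: (@derivative_near_eq _ (fun y => U (y - w))).
      by apply: filterS GUw => y /esym; exact.
    rewrite -[X in complex_derivative _ _ X]mulr1 -[X in _ * X]subr0.
    apply: (@derivative_comp _ (fun y => y - w) U); last by rewrite addrK.
    by apply: derivativeB; [exact: derivative_id|exact: derivative_cst].
  have Gz : G z = U z by exact: nbhs_singleton GU.
  have Gzw : G (z + w) = U z by have := nbhs_singleton GUw; rewrite addrK.
  by rewrite (complex_derivativeE dG) (complex_derivativeE dGw) Gz Gzw.
have Gper z w : rect z -> z \notin S -> (forall y, g (y + w) = g y) ->
    'D_1 G (z + w) / G (z + w) = 'D_1 G z / G z.
  move=> zr zS gw; have [U [hU U0 gU H]] := Gloc z zr zS; apply: H.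
  move/nbhsCP: gU => [r r0 rU]; apply/nbhsCP; exists r => // y yr yz.
  rewrite -[y](subrK w) gw addrK; apply: rU.
    by rewrite opprD addrA addrAC in yr.
  by apply: contra_neq yz => <-; rewrite subrK.
have wI : inner (pt 0 0).
  by exists 0, 0; split => //; rewrite /o /e; apply/andP; split; lra.
have Su a : in_edges v1 v2 o e o e a -> a \notin S.
  by move=> aE; apply/negP => /Sinner aI; have := interior_not_edge v12 aI aE; rewrite eqxx.
have := argument_principle v12 oe oe (S := S) (N := N) (u := u) (g := G) wI Sinner hu.
have -> : oint v1 v2 (fun z => 'D_1 G z / G z) o e o e = 0.
  have eo : e = o + 1 by rewrite /e /o; ring.
  have hE : hor v1 v2 (fun z => 'D_1 G z / G z) o e e = hor v1 v2 (fun z => 'D_1 G z / G z) o e o.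
    apply: eq_cint => s ss; congr (_ * _).
    have pE : in_edges v1 v2 o e o e (pt s o).
      by exists s, o; rewrite lexx oe; split => //; right; left.
    have -> : pt s e = pt s o + v2 by rewrite eo pt_add2.
    exact: (Gper _ _ (in_edges_rect pE) (Su _ pE) g2).
  have vE : ver v1 v2 (fun z => 'D_1 G z / G z) e o e = ver v1 v2 (fun z => 'D_1 G z / G z) o o e.
    apply: eq_cint => t tt; congr (_ * _).
    have pE : in_edges v1 v2 o e o e (pt o t).
      by exists o, t; rewrite lexx oe; split => //; left; left.
    have -> : pt e t = pt o t + v1 by rewrite eo pt_add1.
    exact: (Gper _ _ (in_edges_rect pE) (Su _ pE) g1).
  have cancel (A B : C) : A + B - A - B = 0 by ring.
  by rewrite /oint hE vE cancel.
have W0 := wind_neq0 v12 oe oe wI.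
move=> H; have {}H := H _; apply/eqP; rewrite -(intr_eq0 R[i]).
have -> : (\sum_(a <- S) N a)%:~R = 0 :> C; last by rewrite eqxx.
apply: (mulfI W0); rewrite mulr0 -H// => z zE.
have zS := Su _ zE; have zr := in_edges_rect zE.
have [U [hU U0 gU _]] := Gloc z zr zS.
have GU := GP _ _ gU hU.
have hagree : agrees_near h (fun w => U w * (\prod_(a <- S) (w - a) ^ N a)^-1) z.
  by apply: filterS gU => w gw wz; rewrite /h gw.
have [|hp p0] := @holomorphic_at_prod S N z xpredT.
  by move=> a aS _; apply: contraNneq zS => <-.
have hUp : holomorphic_at (fun w => U w * (\prod_(a <- S) (w - a) ^ N a)^-1) z.
  by apply: holomorphic_atM hU _; exact: holomorphic_atV.
have uU := uP _ _ hagree hUp.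
have pn := near_neq0 (holomorphic_at_continuous hp) p0.
apply: filterS2 (filterI GU uU) pn => w [-> ->] pw.
by rewrite mulfVK.
Qed.

End Periods.
End DoublyPeriodic.

(** * Principal divisors on an elliptic curve *)
Section Elliptic.
Variables (R : realType) (X : curve R).
Local Notation C := 'CC_R.

Lemma nbhs_cdom (a : atlas_ix X) (x : X) : cdom (atlas X a) x -> nbhs x (cdom (atlas X a)).
Proof. by move=> ax; apply: open_nbhs_nbhs; split => //; exact: cdom_open. Qed.

Lemma holomorphic_pullback (f : C -> X) (U : set X) (u : X -> C) z :
  holomorphic_from_plane f -> open U -> U (f z) -> holomorphic_on U u ->
  holomorphic_at (u \o f) z.
Proof.
move=> [cf df] oU Uz hu; have [a az] := atlas_cover X (f z).
have nU : \forall w \near z, U (f w).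
  by apply: cf; apply: open_nbhs_nbhs.
have na : \forall w \near z, cdom (atlas X a) (f w).
  by apply: cf; exact: nbhs_cdom.
apply: filterS2 nU (near_join na) => w Uw nw.
have aw : cdom (atlas X a) (f w) := nbhs_singleton nw.
have /derivableCP[l dl] := derivable_compC (df w a aw) (hu _ a Uw aw).
apply/derivableCP; exists l; apply: derivative_near_eq dl.
by apply: filterS nw => y ay /=; rewrite cmapK.
Qed.

Section Lattice.
Variables w1 w2 : C.
Hypothesis w12 : 0 < orientation w1 w2.
Local Notation coord1 := (coord1 w1 w2).
Local Notation coord2 := (coord2 w1 w2).

Variable f : C -> X.
Hypotheses (hf : holomorphic_from_plane f) (fsurj : forall x : X, exists z, f z = x).
Hypothesis fE : forall z w, f z = f w <-> exists m n : int, z - w = m%:~R * w1 + n%:~R * w2.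

Lemma lattice_pt (m n : int) : m%:~R * w1 + n%:~R * w2 = pt w1 w2 m%:~R n%:~R.
Proof. by rewrite /pt !rmorph_int. Qed.

Lemma f_period (z : C) (m n : int) : f (z + pt w1 w2 m%:~R n%:~R) = f z.
Proof. by apply/fE; exists m, n; rewrite addrAC subrr add0r lattice_pt. Qed.

(** The coordinates of a short period are integers of modulus less than 1. *)
Lemma f_locally_injective : exists2 d : R, 0 < d &
  forall z w, modulus (z - w) < d -> f z = f w -> z = w.
Proof.
have k0 : 0 < 4 * (modulus w1 + modulus w2) / orientation w1 w2.
  by rewrite divr_gt0// mulr_gt0// K_gt0.
exists (4 * (modulus w1 + modulus w2) / orientation w1 w2)^-1; first by rewrite invr_gt0.
move=> z w zw /fE[m [n e]].
move: zw; rewrite e lattice_pt => zw.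
have : `|m%:~R| + `|n%:~R| < 1 :> R.
  apply: le_lt_trans (coord_le_modulus w12 _ _) _.
  by rewrite mulrC -ltr_pdivlMr// div1r.
rewrite -!intr_norm -intrD -[1]/(1%:~R) ltr_int => mn.
have [m0 n0] : m = 0 /\ n = 0 by lia.
by apply/eqP; rewrite -subr_eq0 e m0 n0 !mul0r addr0.
Qed.

(** Read in a chart, [f] is locally injective, so that its derivative is nonzero:
    the local coordinate pulls back to [w - z] times a nonvanishing factor. *)
Lemma plane_order_pullback (g : X -> C) z k :
  has_order g (f z) k -> plane_order (g \o f) z k.
Proof.
move=> [a [V [u [[oV Vz] Va hu u0 gE]]]].
pose phi : C -> C := cmap (atlas X a) \o f.
have az : cdom (atlas X a) (f z) by exact: Va.
have hphi : holomorphic_at phi z.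
  apply: (holomorphic_pullback hf (cdom_open (atlas X a)) az).
  exact: holomorphic_on_cmap.
have [d d0 finj] := f_locally_injective.
have nV : \forall w \near z, V (f w) by apply: hf.1; apply: open_nbhs_nbhs.
have nd : nbhs z [set w | V (f w) /\ modulus (w - z) < d / 2].
  apply: filterI nV _; apply/nbhsCP; exists (d / 2); first by rewrite divr_gt0.
  by [].
have dphi : 'D_1 phi z != 0.
  apply: (injective_derivative_neq0 nd hphi) => x y [Vx xd] [Vy yd] e.
  apply: finj.
    have -> : x - y = (x - z) - (y - z) by ring.
    by apply: le_lt_trans (modulusD _ _) _; rewrite modulusN; lra.
  rewrite -(cmapK (Va _ Vx)) -(cmapK (Va _ Vy)); congr (cinv _ _); exact: e.
pose q := divided_difference phi z.
have hq : holomorphic_at q z by exact: holomorphic_divided_difference.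
have q0 : q z != 0 by rewrite /q /divided_difference eqxx.
exists (fun w => q w ^ k * (u \o f) w); split.
- apply: holomorphic_atM; first exact: holomorphic_at_exprz.
  exact: (holomorphic_pullback hf oV Vz hu).
- by rewrite mulf_neq0// expfz_neq0.
apply: filterS nd => w [Vw wd] wz /=.
rewrite gE//; last first.
  apply: contra_neq wz; apply: finj; apply: lt_le_trans wd _; lra.
have -> : cmap (atlas X a) (f w) - cmap (atlas X a) (f z) = (w - z) * q w.
  have e := divided_differenceE phi z w.
  by rewrite -[cmap _ (f w)]/(phi w) e addrAC subrr add0r.
by rewrite expfzMl mulrA.
Qed.

Lemma coord1_int_shift z (m n : int) : coord1 (z + pt w1 w2 m%:~R n%:~R) = coord1 z + m%:~R.
Proof. by rewrite coord1D// coord1_pt. Qed.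

Lemma coord2_int_shift z (m n : int) : coord2 (z + pt w1 w2 m%:~R n%:~R) = coord2 z + n%:~R.
Proof. by rewrite coord2D// coord2_pt. Qed.

Lemma cell_surjective (x : X) : exists2 z, in_cell w1 w2 z & f z = x.
Proof.
have [z <-] := fsurj x.
exists (z + pt w1 w2 (- Num.floor (coord1 z))%:~R (- Num.floor (coord2 z))%:~R).
  rewrite /in_cell coord1_int_shift coord2_int_shift !rmorphN /=.
  have /andP[h1 h2] := floor_itv (coord1 z); have /andP[h3 h4] := floor_itv (coord2 z).
  rewrite intrD in h2; rewrite intrD in h4.
  by apply/andP; split; apply/andP; split; lra.
exact: f_period.
Qed.

Lemma cell_injective z w : in_cell w1 w2 z -> in_cell w1 w2 w -> f z = f w -> z = w.
Proof.
move=> /andP[/andP[z1 z2] /andP[z3 z4]] /andP[/andP[a1 a2] /andP[a3 a4]] /fE[m [n e]].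
have zE : z = w + pt w1 w2 m%:~R n%:~R by rewrite -lattice_pt -e addrC subrK.
rewrite zE coord1_int_shift coord2_int_shift in z1 z2 z3 z4.
have hm : `|m%:~R| < 1 :> R by rewrite ltr_norml; apply/andP; split; lra.
have hn : `|n%:~R| < 1 :> R by rewrite ltr_norml; apply/andP; split; lra.
rewrite -intr_norm -[1]/(1%:~R) ltr_int in hm; rewrite -intr_norm -[1]/(1%:~R) ltr_int in hn.
have [m0 n0] : m = 0 /\ n = 0 by lia.
by apply/eqP; rewrite -subr_eq0 e m0 n0 !mul0r addr0.
Qed.

Lemma degree_of_principal_divisor_lattice (g : X -> C) (N : X -> int) :
  (forall x, has_order g x (N x)) -> finite_set [set x | N x != 0] ->
  \sum_(x \in [set: X]) N x = 0.
Proof.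
move=> gN /finite_seqP[r0 r0E].
pose r := undup r0; have ur : uniq r := undup_uniq r0.
have rE x : (x \in r) = (N x != 0).
  rewrite mem_undup; apply/idP/idP => h.
    by have : [set` r0] x by []; rewrite -r0E.
  by have : [set x | N x != 0] x by []; rewrite r0E.
have rep x : {z | in_cell w1 w2 z & f z = x}.
  by have /cid2 := cell_surjective x.
pose s x : C := s2val (rep x).
have s1 x : in_cell w1 w2 (s x) by exact: (s2valP (rep x)).
have s2 x : f (s x) = x by exact: (s2valP' (rep x)).
have <- : \sum_(a <- map s r) N (f a) = \sum_(x \in [set: X]) N x.
  rewrite big_map (eq_bigr N); last by move=> x _; rewrite s2.
  rewrite (fsbigE r)//; first by apply: eq_bigl => x; rewrite in_setT.
  by move=> x _; rewrite rE negbK => /eqP.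
apply: (doubly_periodic_degree w12 (g := g \o f) (N := N \o f)).
- by rewrite map_inj_uniq// => x y e; rewrite -(s2 x) e s2.
- by move=> z /=; have := f_period z 1 0; rewrite rmorph1 rmorph0 /pt rmorph1 rmorph0 mul1r mul0r addr0 => ->.
- by move=> z /=; have := f_period z 0 1; rewrite rmorph1 rmorph0 /pt rmorph1 rmorph0 mul1r mul0r add0r => ->.
- by move=> z /=; have := f_period z 1 0; rewrite rmorph1 rmorph0 /pt rmorph1 rmorph0 mul1r mul0r addr0 => ->.
- by move=> z /=; have := f_period z 0 1; rewrite rmorph1 rmorph0 /pt rmorph1 rmorph0 mul1r mul0r add0r => ->.
- by move=> z; exact: plane_order_pullback.
- by move=> z /mapP[x _ ->].
move=> z zc Nz; apply/mapP; exists (f z); first by rewrite rE.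
by apply: cell_injective => //; rewrite s2.
Qed.

End Lattice.

Lemma orientation_neq0 (w1 w2 : C) :
  (forall a b : R, a%:C%C * w1 + b%:C%C * w2 = 0 -> a = 0 /\ b = 0) -> orientation w1 w2 != 0.
Proof.
move=> ind; apply/eqP => J0.
(* this combination is minus the orientation times [i w1] *)
have [] := ind (Re w1 * Re w2 + Im w1 * Im w2) (- (Re w1 ^+ 2 + Im w1 ^+ 2)).
  move: J0; rewrite /orientation; case: (w1) (w2) => [a b] [c d] /= J0.
  apply/eqP; rewrite eq_complex /=; apply/andP; split; apply/eqP.
    transitivity (b * (a * d - b * c)); first by ring.
    by rewrite J0 mulr0.
  transitivity (- a * (a * d - b * c)); first by ring.
  by rewrite J0 mulr0.
move=> _ /eqP; rewrite oppr_eq0 paddr_eq0 ?sqr_ge0// !sqrf_eq0 => /andP[/eqP a0 /eqP b0].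
have [|/eqP] := ind 1 0; last by rewrite oner_eq0.
apply/eqP; rewrite rmorph0 rmorph1 mul0r mul1r addr0 eq_complex.
by rewrite a0 b0 /= eqxx.
Qed.

Theorem degree_of_principal_divisor (g : X -> C) (N : X -> int) : elliptic X ->
  (forall x, has_order g x (N x)) -> finite_set [set x | N x != 0] ->
  \sum_(x \in [set: X]) N x = 0.
Proof.
move=> [w1 [w2 [f [ind hf fsurj fE]]]] gN finN.
have := orientation_neq0 ind; rewrite neq_lt => /orP[J|J].
  apply: (@degree_of_principal_divisor_lattice w2 w1 _ f hf fsurj _ g N gN finN).
    by move: J; rewrite /orientation; lra.
  move=> z w; rewrite fE; split => -[m [n e]]; exists n, m; by rewrite e addrC.
exact: (@degree_of_principal_divisor_lattice w1 w2 J f hf fsurj fE g N gN finN).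
Qed.

End Elliptic.

(** * Meromorphic functions on a curve *)
Section Meromorphic.
Variables (R : realType) (X : curve R).
Local Notation C := 'CC_R.
Implicit Types (x y : X) (a b : atlas_ix X).

Lemma holomorphic_onS (U V : set X) (f : X -> C) :
  V `<=` U -> holomorphic_on U f -> holomorphic_on V f.
Proof. by move=> VU hf x a Vx; apply: hf; exact: VU. Qed.

Lemma holomorphic_onM (U : set X) (f g : X -> C) :
  holomorphic_on U f -> holomorphic_on U g -> holomorphic_on U (fun x => f x * g x).
Proof. by move=> hf hg x a Ux ax; exact: (derivableM (hf x a Ux ax) (hg x a Ux ax)). Qed.

Lemma holomorphic_onD (U : set X) (f g : X -> C) :
  holomorphic_on U f -> holomorphic_on U g -> holomorphic_on U (fun x => f x + g x).
Proof. by move=> hf hg x a Ux ax; exact: (derivableD (hf x a Ux ax) (hg x a Ux ax)). Qed.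

Lemma near_eq_continuous (f g : X -> C) x : (\forall y \near x, f y = g y) ->
  {for x, continuous f} -> {for x, continuous g}.
Proof.
move=> fg /continuousCP cf; apply/continuousCP => e e0.
have fx := nbhs_singleton fg.
by apply: filterS2 fg (cf e e0) => y <-; rewrite fx.
Qed.

Lemma near_comp (T : topologicalType) (f : T -> C) (t : T) (P : set C) :
  {for t, continuous f} -> nbhs (f t) P -> \forall y \near t, P (f y).
Proof.
move=> /continuousCP cf /nbhsCP[e e0 eP].
by apply: filterS (cf _ e0) => y /eP.
Qed.

Lemma chart_pullback_continuous a (w : C -> C) x : cdom (atlas X a) x ->
  {for cmap (atlas X a) x, continuous w} ->
  {for x, continuous (w \o cmap (atlas X a))}.
Proof. by move=> ax cw; exact: (continuous_comp (cmap_cts ax) cw). Qed.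

Lemma holomorphic_on_continuous (U : set X) (f : X -> C) x : open U -> U x ->
  holomorphic_on U f -> {for x, continuous f}.
Proof.
move=> oU Ux hf; have [a ax] := atlas_cover X x.
have cf := derivable_continuousC (hf x a Ux ax).
apply: near_eq_continuous (chart_pullback_continuous ax cf).
by apply: filterS (nbhs_cdom ax) => y ay /=; rewrite cmapK.
Qed.

Lemma holomorphic_in_chart a (U : set X) (f : X -> C) x : open U -> U x ->
  cdom (atlas X a) x -> holomorphic_on U f ->
  holomorphic_at (f \o cinv (atlas X a)) (cmap (atlas X a) x).
Proof.
move=> oU Ux ax hf; have cx := cmap_ccod ax.
have n1 : nbhs (cmap (atlas X a) x) (ccod (atlas X a)).
  by apply: open_nbhs_nbhs; split => //; exact: ccod_open.
have n2 : nbhs (cmap (atlas X a) x) (cinv (atlas X a) @^-1` U).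
  by apply: (cinv_cts cx); rewrite /= cmapK//; apply: open_nbhs_nbhs.
apply: filterS2 n1 n2 => w cw Uw.
by have := hf _ a Uw (cinv_cdom cw); rewrite cinvK.
Qed.

Lemma holomorphic_on_chart a (W : set X) (w : C -> C) :
  (forall y, W y -> cdom (atlas X a) y) ->
  (forall y, W y -> holomorphic_at w (cmap (atlas X a) y)) ->
  holomorphic_on W (w \o cmap (atlas X a)).
Proof.
move=> Wa hw y b Wy yb.
apply: (@derivable_compC _ (cmap (atlas X a) \o cinv (atlas X b)) w).
  apply: atlas_compatible; first exact: cmap_ccod.
  by rewrite cmapK//; exact: Wa.
by rewrite /= (cmapK yb); exact: holomorphic_at_derivable (hw y Wy).
Qed.

(** Charts are open in the plane, which has no isolated points. *)
Lemma curve_not_isolated x (P : set X) : nbhs x P -> exists2 y, P y & y != x.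
Proof.
move=> xP; have [a ax] := atlas_cover X x; pose c := atlas X a.
have cx : ccod c (cmap c x) by exact: cmap_ccod.
have n1 : nbhs (cmap c x) (ccod c) by apply: open_nbhs_nbhs; split => //; exact: ccod_open.
have n2 : nbhs (cmap c x) (cinv c @^-1` P).
  by apply: (cinv_cts cx); rewrite /= cmapK.
have : nbhs (cmap c x) (ccod c `&` cinv c @^-1` P) by exact: filterI.
move=> /nbhsCP[e e0 eP].
have e2 : 0 < e / 2 by rewrite divr_gt0.
have [|z1 z2] := eP (cmap c x + (e / 2)%:C%C).
  by rewrite addrC addKr modulus_real gtr0_norm//; lra.
exists (cinv c (cmap c x + (e / 2)%:C%C)) => //; apply/eqP => h.
have := cinvK z1; rewrite h => /eqP; rewrite -subr_eq0 opprD addrA subrr sub0r oppr_eq0.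
by rewrite -modulus_eq0 modulus_real gtr0_norm// gt_eqF.
Qed.

Lemma eq_at_limit (f g : X -> C) x : {for x, continuous f} -> {for x, continuous g} ->
  (\forall y \near x, y != x -> f y = g y) -> f x = g x.
Proof.
move=> /continuousCP cf /continuousCP cg fg; apply/eqP; rewrite -subr_eq0 -modulus_eq0.
apply/negPn/negP => n0; have {}n0 : 0 < modulus (f x - g x) by rewrite lt_neqAle eq_sym n0 modulus_ge0.
have e0 : 0 < modulus (f x - g x) / 2 by rewrite divr_gt0.
have [y [[h1 h2] h3] yx] := curve_not_isolated (filterI (filterI (cf _ e0) (cg _ e0)) fg).
rewrite /= (h3 yx) modulusB in h1; rewrite /= in h2.
have := modulusD (f x - g y) (g y - g x); rewrite addrA subrK.
by set m := modulus (f x - g x) in h1 h2 *; lra.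
Qed.

Lemma near_neq x y : y != x -> \forall z \near y, z != x.
Proof.
move=> yx; have oC : open (~` [set x]).
  apply: closed_openC; apply: accessible_closed_set1.
  exact: hausdorff_accessible (@cpt_hausdorff _ X).
have : nbhs y (~` [set x]) by apply: open_nbhs_nbhs; split => // /eqP; rewrite (negPf yx).
by apply: filterS => z /eqP.
Qed.

(** Functions that vanish near [x] are included, for every [k]. *)
Definition order_at_least (g : X -> C) x (k : int) := exists a (V : set X) (u : X -> C),
  [/\ open V /\ V x, V `<=` cdom (atlas X a), holomorphic_on V u
    & forall y, V y -> y != x -> g y = (cmap (atlas X a) y - cmap (atlas X a) x) ^ k * u y].

Lemma cmap_neq a x y : cdom (atlas X a) x -> cdom (atlas X a) y -> y != x ->
  cmap (atlas X a) y - cmap (atlas X a) x != 0.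
Proof.
move=> ax ay; apply: contra_neq => /subr0_eq e.
by rewrite -(cmapK ay) e cmapK.
Qed.

Lemma order_at_least_dichotomy g x k : order_at_least g x k ->
  (\forall y \near x, y != x -> g y = 0) \/ exists2 m, k <= m & has_order g x m.
Proof.
move=> [a [V [u [[oV Vx] Va hu gE]]]]; pose c := atlas X a; have ax := Va _ Vx.
have nV : nbhs x V by apply: open_nbhs_nbhs.
have cc : {for x, continuous (cmap c)} by exact: cmap_cts.
have hU := holomorphic_in_chart oV Vx ax hu.
have [U0|[n [U [hU' U0 UE]]]] := order_dichotomy hU.
  left; apply: filterS2 nV (near_comp cc U0) => y Vy uy yx.
  by rewrite gE//; have := uy; rewrite /= (cmapK (Va _ Vy)) => ->; rewrite mulr0.
right; exists (k + n%:Z); first by rewrite lerDl.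
pose W := [set y | V y /\ holomorphic_at U (cmap c y)].
exists a, W, (U \o cmap c); split.
- split; last by [].
  rewrite openE => y [Vy hy]; rewrite /interior.
  have nVy : nbhs y V by apply: open_nbhs_nbhs.
  have ny : \forall z \near y, holomorphic_at U (cmap c z).
    exact: (near_comp (cmap_cts (Va _ Vy)) (holomorphic_at_near hy)).
  exact: filterI nVy ny.
- by move=> y [/Va].
- by apply: holomorphic_on_chart => y [Vy hy]; [exact: Va|].
- by [].
move=> y [Vy hy] yx; have t0 := cmap_neq ax (Va _ Vy) yx.
rewrite gE// expfzDr// -mulrA; congr (_ * _).
by have := UE (cmap c y); rewrite /= (cmapK (Va _ Vy)).
Qed.

(** A function of order [k] at [x] is continuous and nonzero at the other points
    near [x], which leaves no room for a zero or a pole. *)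
Lemma has_order_near g x k : has_order g x k ->
  \forall y \near x, y != x -> forall m, has_order g y m -> m = 0.
Proof.
move=> [a [V [u [[oV Vx] Va hu u0 gE]]]]; pose c := atlas X a; have ax := Va _ Vx.
have nV : nbhs x V by apply: open_nbhs_nbhs.
have cu y : V y -> {for y, continuous u} by move=> Vy; exact: (holomorphic_on_continuous oV Vy hu).
have nu : \forall y \near x, u y != 0.
  have /continuousCP/(_ (modulus (u x))) := cu x Vx; rewrite modulus_gt0 => /(_ u0).
  by apply: filterS => y; apply: contraTneq => ->; rewrite sub0r modulusN ltxx.
apply: filterS2 nV nu => y Vy uy yx m [b [V' [u' [[oV' V'y] V'b hu' u'0 gE']]]].
have ay := Va _ Vy; have yb := V'b _ V'y; have t0 := cmap_neq ax ay yx.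
pose h z := (cmap c z - cmap c x) ^ k * u z.
have hE z : V z -> z != x -> h z = g z by move=> Vz zx; rewrite (gE z Vz zx).
have h0 : h y != 0 by rewrite mulf_neq0// expfz_neq0.
have ch : {for y, continuous h}.
  have ct : {for y, continuous (fun z => (cmap c z - cmap c x) ^ k)}.
    apply: (@chart_pullback_continuous a (fun w => (w - cmap c x) ^ k) _ ay).
    apply: holomorphic_at_continuous.
    by apply: (@holomorphic_at_exprz _ (fun w => w - cmap c x) _ _ (holomorphic_at_subr _ _)).
  exact: (continuousM ct (cu y Vy)).
have cu' := holomorphic_on_continuous oV' V'y hu'.
pose t z := cmap (atlas X b) z - cmap (atlas X b) y.
have ct n : {for y, continuous (fun z => t z ^+ n)}.
  apply: (@chart_pullback_continuous b (fun w => (w - cmap (atlas X b) y) ^+ n) _ yb).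
  exact/derivable_continuousC/derivableXC/derivable_sub_cst.
have tn n : t y ^+ n.+1 = 0 by rewrite /t subrr expr0n.
have near_y : \forall z \near y, [/\ V z, V' z & z != x].
  have n1 : nbhs y V by apply: open_nbhs_nbhs.
  have n2 : nbhs y V' by apply: open_nbhs_nbhs.
  by apply: filterS2 (filterI n1 n2) (near_neq yx) => z [].
case: m gE' => [[//|n]|n] gE'; exfalso.
  have e : h y = t y ^+ n.+1 * u' y.
    apply: (eq_at_limit ch (continuousM (ct n.+1) cu')).
    by apply: filterS near_y => z [Vz V'z zx] zy /=; rewrite hE// gE'.
  by move: h0; rewrite e tn mul0r eqxx.
have e : u' y = t y ^+ n.+1 * h y.
  apply: (eq_at_limit cu' (continuousM (ct n.+1) ch)).
  apply: filterS near_y => z [Vz V'z zx] zy /=; rewrite hE// gE'// mulrA.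
  by rewrite NegzE -exprnN /t divff ?mul1r// expf_neq0// (cmap_neq yb (V'b _ V'z) zy).
by move: u'0; rewrite e tn mul0r eqxx.
Qed.

Lemma compact_cover_compact (T : topologicalType) (t : T) (A : set T) :
  compact A -> cover_compact A.
Proof.
pose T' : ptopologicalType := HB.pack (Topological.sort T) (isPointed.Build T t).
have : @compact T' A -> @cover_compact T' A by rewrite compact_cover.
exact.
Qed.

(** The identity theorem, from the connectedness of the curve: a function that
    does not vanish identically has an order everywhere; from its compactness,
    all but finitely many of these orders are 0. *)
Theorem exists_divisor (g : X -> C) (D : X -> int) :
  (forall x, order_at_least g x (D x)) ->
  (exists x, ~ (\forall y \near x, y != x -> g y = 0)) ->
  exists N : X -> int, [/\ forall x, D x <= N x, forall x, has_order g x (N x)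
    & finite_set [set x | N x != 0]].
Proof.
move=> gD [x0 gx0]; pose Z := [set x | \forall y \near x, y != x -> g y = 0].
have oZ : open Z.
  rewrite openE => x xZ; rewrite /interior; apply: filterS (near_join xZ) => y Hy.
  have [yx|yx] := eqVneq y x; first by rewrite yx.
  by apply: filterS2 Hy (near_neq yx) => z h zx _; exact: h.
have noZ x : ~ Z x -> exists2 m, D x <= m & has_order g x m.
  by move=> nZ; case: (order_at_least_dichotomy (gD x)).
have oC : open (~` Z).
  rewrite openE => x nZ; have [m _ gm] := noZ x nZ; rewrite /interior.
  move: (gm) => [a [V [u [[oV Vx] Va hu u0 gE]]]].
  have nu : \forall y \near x, u y != 0.
    have /continuousCP/(_ (modulus (u x))) := holomorphic_on_continuous oV Vx hu.
    rewrite modulus_gt0 => /(_ u0).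
    by apply: filterS => y; apply: contraTneq => ->; rewrite sub0r modulusN ltxx.
  have ng : \forall y \near x, y != x -> g y != 0.
    have nV : nbhs x V by apply: open_nbhs_nbhs.
    apply: filterS2 nV nu => y Vy uy yx.
    by rewrite gE// mulf_neq0// expfz_neq0 ?(cmap_neq (Va _ Vx) (Va _ Vy) yx).
  apply: filterS (near_join ng) => y Hy yZ.
  have [yx|yx] := eqVneq y x; first by apply: nZ; rewrite -yx.
  have [z [[h1 h2] zx] zy] := curve_not_isolated (filterI (filterI Hy yZ) (near_neq yx)).
  by have := h1 zx; rewrite h2// eqxx.
have Z0 x : ~ Z x.
  move=> Zx; have ZT : Z = [set: X].
    apply: (@cpt_connected _ X); first by exists x.
      by exists Z => //; rewrite setTI.
    exists Z; first by rewrite -[Z]setCK; exact: open_closedC.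
    by rewrite setTI.
  by apply: gx0; have : [set: X] x0 by []; rewrite -ZT.
have nx x : {m | D x <= m & has_order g x m} by exact: cid2 (noZ x (Z0 x)).
pose N x := s2val (nx x).
have DN x : D x <= N x by exact: (s2valP (nx x)).
have gN x : has_order g x (N x) by exact: (s2valP' (nx x)).
exists N; split => //.
have nbN x : exists V, [/\ open V, V x & forall y, V y -> y != x -> N y = 0].
  have : nbhs x [set y | y != x -> forall m, has_order g y m -> m = 0] := has_order_near (gN x).
  rewrite nbhsE => -[V [oV Vx] VP].
  by exists V; split => // y Vy yx; exact: (VP y Vy yx _ (gN y)).
pose V x := projT1 (cid (nbN x)).
have VP x : [/\ open (V x), V x x & forall y, V x y -> y != x -> N y = 0].
  exact: (projT2 (cid (nbN x))).
have : cover_compact [set: X] by exact: (compact_cover_compact x0 (@cpt_compact _ X)).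
move=> /(_ X [set: X] V)[x _|x _|D' _ cov].
- by have [] := VP x.
- by exists x => //; have [] := VP x.
apply: sub_finite_set (finite_fset D').
move=> x /= Nx; have [i iD Vi] := cov x I.
have [xi|xi] := eqVneq x i; first by rewrite /= xi.
by have [_ _ /(_ x Vi xi)] := VP i; move/eqP: Nx.
Qed.

(** A line bundle with a nonzero map to the trivial one has nonpositive degree:
    the image of a meromorphic section is a function, whose divisor has degree 0
    and is at least that of the section.  More generally [h], given in local
    trivialisations, is a section of the dual of det M. *)
Theorem degree_le0 r (M : bundle X r) (h : bix M -> X -> C) (d : int) : elliptic X ->
  (forall i j x, bdom M i x -> bdom M j x -> h i x = h j x * \det (btrans M i j x)) ->
  (forall i, holomorphic_on (bdom M i) (h i)) ->
  (exists i x, bdom M i x /\ h i x != 0) -> has_degree M d -> d <= 0.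
Proof.
move=> ell htr hol [i0 [x0 [ix0 hx0]]] [s [D [sE finD sD <-]]].
pose ix x := projT1 (cid (bdom_cover M x)).
have ixP x : bdom M (ix x) x by exact: (projT2 (cid (bdom_cover M x))).
pose g x := h (ix x) x * s (ix x) x.
have gE i x : bdom M i x -> g x = h i x * s i x.
  by move=> ib; rewrite /g (htr _ _ _ (ixP x) ib) (sE _ _ _ (ixP x) ib) mulrA.
have gD x : order_at_least g x (D x).
  have [a [V [u [[oV Vx] Va hu u0 sV]]]] := sD _ x (ixP x).
  exists a, (V `&` bdom M (ix x)), (fun y => h (ix x) y * u y); split.
  - by split; [apply: openI => //; exact: bdom_open|split].
  - by move=> y [/Va].
  - apply: holomorphic_onM; first exact: holomorphic_onS (@subIsetr _ _ _) (hol _).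
    exact: holomorphic_onS (@subIsetl _ _ _) hu.
  move=> y [Vy iy] yx; rewrite (gE _ _ iy) sV// mulrCA //.
have gx0 : ~ (\forall y \near x0, y != x0 -> g y = 0).
  move=> g0; have [a [V [u [[oV Vx] Va hu u0 sV]]]] := sD _ x0 ix0.
  have cu := holomorphic_on_continuous oV Vx hu.
  have ch := holomorphic_on_continuous (bdom_open i0) ix0 (hol i0).
  have nV : nbhs x0 V by apply: open_nbhs_nbhs.
  have ni : nbhs x0 (bdom M i0) by apply: open_nbhs_nbhs; split => //; exact: bdom_open.
  have cz : {for x0, continuous (fun=> 0 : C)}.
    by apply/continuousCP => e e0; near=> y; rewrite subrr modulus0.
  have := eq_at_limit (continuousM ch cu) cz.
  have H : \forall y \near x0, y != x0 -> h i0 y * u y = 0.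
    apply: filterS2 g0 (filterI nV ni) => y gy [Vy iy] yx.
    have := gy yx; rewrite (gE _ _ iy) sV// mulrCA => /eqP.
    rewrite mulf_eq0 expfz_eq0 (negPf (cmap_neq (Va _ Vx) (Va _ Vy) yx)) andbF => /eqP.
    by [].
  by move=> /(_ H) /eqP; rewrite mulf_eq0 (negPf hx0) (negPf u0).
have [N [DN gN finN]] := exists_divisor gD (ex_intro _ x0 gx0).
have degN := degree_of_principal_divisor ell gN finN.
move: finD finN => /finite_seqP[r1 r1E] /finite_seqP[r2 r2E].
pose r' := undup (r1 ++ r2); have ur : uniq r' := undup_uniq _.
have r'D x : x \notin r' -> D x = 0.
  rewrite mem_undup mem_cat negb_or => /andP[xr _]; apply/eqP/negPn/negP => Dx.
  by have : [set x | D x != 0] x by []; rewrite r1E /= (negPf xr).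
have r'N x : x \notin r' -> N x = 0.
  rewrite mem_undup mem_cat negb_or => /andP[_ xr]; apply/eqP/negPn/negP => Dx.
  by have : [set x | N x != 0] x by []; rewrite r2E /= (negPf xr).
have sumE (F : X -> int) : (forall x, x \notin r' -> F x = 0) ->
    \sum_(x \in [set: X]) F x = \sum_(x <- r') F x.
  move=> F0; rewrite (fsbigE r')//; first by apply: eq_bigl => x; rewrite in_setT.
  by move=> x _; exact: F0.
rewrite (sumE _ r'D); rewrite (sumE _ r'N) in degN.
apply: le_trans (_ : \sum_(x <- r') N x <= 0); last by rewrite degN.
by apply: ler_sum.
Unshelve. all: by end_near.
Qed.

End Meromorphic.

(** * Line subbundles of the trivial bundle of rank 2 *)
Section TrivialRank2.
Variables (R : realType) (X : curve R).
Local Notation C := 'CC_R.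
Local Notation O := (trivial_line X).
Local Notation E := (direct_sum O O : bundle X 2).

Lemma btriv_surj r (F : bundle X r) i x (w : 'cV[R[i]]_r) : bdom F i x ->
  exists v, btriv F i x v = w.
Proof. by move=> ix; have [g _ gK] := btriv_bij ix; exists (g w); rewrite gK. Qed.

(** Trivialisations being onto, a bundle map determines its matrices; hence the
    rule of change of trivialisation. *)
Lemma bundle_map_matrix r s (F : bundle X r) (G : bundle X s)
    (f : forall x, 'Hom(fib F x, fib G x)) (j : bix G) : bundle_map f ->
  exists M : bix F -> X -> 'M[R[i]]_(s, r),
    [/\ forall i, holomorphic_mx_on (bdom F i `&` bdom G j) (M i),
        forall i x v, bdom F i x -> bdom G j x -> btriv G j x (f x v) = M i x *m btriv F i x v
      & forall i k x, bdom F i x -> bdom F k x -> bdom G j x ->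
          M i x = M k x *m btrans F i k x].
Proof.
move=> bf; pose M i := projT1 (cid (bf i j)).
have MP i := projT2 (cid (bf i j)).
exists M; split => [i|i x v ix jx|i k x ix kx jx].
- by have [] := MP i.
- by have [_] := MP i; exact.
apply/matrixP => a b; have [v vE] := btriv_surj (delta_mx b 0) ix.
have [_ /(_ x v ix jx)] := MP i; have [_ /(_ x v kx jx)] := MP k.
rewrite (btransE v ix kx) vE mulmxA => -> /(congr1 (fun A : 'cV[R[i]]_s => A a 0)).
by rewrite -!colE !mxE.
Qed.

(** Some component of an injective map is nonzero; it is a map to the trivial
    line bundle. *)
Lemma line_subbundle_degree_le0 (M : bundle X 1) (f : forall x, 'Hom(fib M x, fib E x)) d
    (x0 : X) : elliptic X -> subbundle f -> has_degree M d -> d <= 0.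
Proof.
move=> ell [bf finj] Md.
have [h [hol hE htr]] := bundle_map_matrix ((tt, tt) : bix E) bf.
have [i0 ix0] := bdom_cover M x0.
have [k hk] : exists k, h i0 x0 k ord0 != 0.
  apply/existsP; apply: contraT; rewrite negb_exists => /forallP h0.
  have [v vE] := btriv_surj (const_mx 1 : 'cV[R[i]]_1) ix0.
  have fv : btriv E (tt, tt) x0 (f x0 v) = 0.
    rewrite (hE _ _ _ ix0)//.
    have -> : h i0 x0 = 0; last by rewrite mul0mx.
    by apply/matrixP => a b; rewrite mxE ord1; apply/eqP/negPn; exact: h0.
  have [g gK _] := @btriv_bij _ _ _ E (tt, tt) x0 (conj I I).
  have f0 : f x0 v = f x0 0 by rewrite linear0 -(gK (f x0 v)) fv -(linear0 (btriv E (tt, tt) x0)) gK.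
  have := vE; rewrite (finj _ _ _ f0) linear0 => /matrixP/(_ 0 0); rewrite !mxE => /eqP.
  by rewrite eq_sym oner_eq0.
apply: (degree_le0 (h := fun i x => h i x k ord0) ell _ _ _ Md) => [i j x ix jx|i|].
- by rewrite (htr i j x ix jx)// det_mx11 mxE big_ord1.
- by move=> x a ix; apply: (hol i); split.
- by exists i0, x0.
Qed.

(** The constant 1 trivialises the determinant: its meromorphic sections are
    functions. *)
Lemma degree_trivial_rank2 d : elliptic X -> has_degree E d -> d = 0.
Proof.
move=> ell [s [D [_ finD sD <-]]].
by apply: (degree_of_principal_divisor ell (g := s (tt, tt))) => // x; exact: sD.
Qed.

Lemma has_degree0 r (F : bundle X r) :
  (forall i j x, bdom F i x -> bdom F j x -> \det (btrans F i j x) = 1) -> has_degree F 0.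
Proof.
move=> det1; exists (fun _ _ => 1), (fun=> 0); split.
- by move=> i j x ix jx; rewrite det1// mulr1.
- by rewrite (_ : [set x | _] = set0)//; apply/seteqP; split => x //=; rewrite eqxx.
- move=> i x ix; have [a ax] := atlas_cover X x.
  exists a, (cdom (atlas X a)), (fun=> 1); split => //.
  + by split => //; exact: cdom_open.
  + exact: holomorphic_on_cst.
  + by move=> y _ _; rewrite expr0z mulr1.
- by rewrite fsbig1.
Qed.

Lemma trivial_line_degree : has_degree O 0.
Proof. by apply: has_degree0 => i j x _ _; rewrite det1. Qed.

Lemma trivial_rank2_degree : has_degree E 0.
Proof.
apply: has_degree0 => i j x _ _.
by rewrite (det_ublock (btrans O i.1 j.1 x) 0 (btrans O i.2 j.2 x)) !det1 mulr1.
Qed.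

Definition constant_line (v : (C * C)%type) (x : X) : 'Hom(fib O x, fib E x) :=
  linfun (fun c : C => (c *: v : (C * C)%type)).

Lemma constant_lineE v x c : constant_line v x c = c *: v.
Proof.
pose p (c : C) : (C * C)%type := c *: v.
have lin : linear p by move=> k u w; rewrite /p scalerDl scalerA.
pose h := GRing.isLinear.Build _ _ _ _ _ lin.
pose l : {linear C -> (C * C)%type} := HB.pack p h.
by rewrite /constant_line (lfunE l).
Qed.

Lemma btriv_trivial_rank2 k x (v : fib E x) :
  btriv E k x v = col_mx ((v.1 : R[i])%:M : 'M[R[i]]_1) ((v.2 : R[i])%:M : 'M[R[i]]_1).
Proof.
apply: etrans (pair_cVE (scale_cV 1) (scale_cV 1) v) _.
by rewrite !scale_cVE !mul1r.
Qed.

Lemma constant_line_subbundle v : v != 0 -> subbundle (constant_line v).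
Proof.
move=> v0; split => [i j|x c d].
  exists (fun=> col_mx ((v.1 : R[i])%:M : 'M[R[i]]_1) ((v.2 : R[i])%:M : 'M[R[i]]_1)); split.
    by move=> a b; exact: holomorphic_on_cst.
  move=> x c _ _; rewrite btriv_trivial_rank2 constant_lineE /= scale_cVE mul1r.
  by rewrite (@mul_col_mx _ 1 1 1 1) -!scalar_mxM (mulrC (v.1 : R[i])) (mulrC (v.2 : R[i])).
rewrite !constant_lineE => /eqP; rewrite -subr_eq0 -scalerBl scaler_eq0 (negPf v0) orbF.
by rewrite subr_eq0 => /eqP.
Qed.

Lemma constant_line_maximal (x0 : X) v : elliptic X -> v != 0 ->
  maximal_line_subbundle (constant_line v) 0.
Proof.
move=> ell v0; split; [exact: constant_line_subbundle|exact: trivial_line_degree|].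
by move=> M' f' d'; exact: line_subbundle_degree_le0.
Qed.

Definition second_projection (x : X) : 'Hom(fib E x, fib O x) :=
  linfun (snd : (C * C)%type -> C).

Lemma second_projectionE x v : second_projection x v = v.2.
Proof. by rewrite /second_projection lfunE. Qed.

Lemma constant_line_quotient :
  quotient_bundle (constant_line ((1 : C), (0 : C))) second_projection.
Proof.
have v0 : ((1 : C), (0 : C)) != 0.
  by apply/eqP => -[/eqP]; rewrite oner_eq0.
split; first exact: constant_line_subbundle.
- move=> i j; exists (fun=> row_mx (0 : 'M[R[i]]_1) (1%:M : 'M[R[i]]_1)); split.
    by move=> a b; exact: holomorphic_on_cst.
  move=> x v _ _; rewrite btriv_trivial_rank2 (@mul_row_col _ 1 1 1 1) mul0mx add0r mul1mx.
  by rewrite /= scale_cVE mul1r second_projectionE.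
- move=> x; apply/vspaceP => w; rewrite memvf; apply/memv_imgP.
  by exists (0, w); rewrite ?memvf ?second_projectionE.
move=> x; apply/vspaceP => -[a b]; rewrite memv_ker second_projectionE /=.
apply/eqP/memv_imgP => [->|[c _]].
  exists a; rewrite ?memvf// constant_lineE; congr (_, _); last by rewrite /= scaler0.
  by rewrite /= [a *: _]mulr1.
by rewrite constant_lineE => -[_ ->]; rewrite scaler0.
Qed.

Lemma all_lines_bad (p : X) (l : {vspace fib E p}) : elliptic X -> \dim l = 1%N -> bad_line l.
Proof.
move=> ell l1; pose v : (C * C)%type := vpick l.
have v0 : v != 0 by rewrite vpick0 -dimv_eq0 l1.
exists O, (constant_line v), 0; split; first exact: constant_line_maximal.
have -> : l = <[v]>%VS.
  apply/eqP; rewrite eq_sym eqEdim dim_vline v0 l1 leqnn andbT -memvE.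
  exact: memv_pick.
apply/vspaceP => w; apply/memv_imgP/vlineP => [[c _ ->]|[c ->]].
  by exists c; rewrite constant_lineE.
by exists c; rewrite ?memvf// constant_lineE.
Qed.

Lemma trivial_rank2_strictly_semistable (x0 : X) : elliptic X -> strictly_semistable E.
Proof.
move=> ell; split => [s F f dF dE s12 sf Fd Ed|st].
  have s1 : s = 1%N by case: s s12 {F f sf Fd} => [|[|]].
  subst s; rewrite (degree_trivial_rank2 ell Ed) mul0r.
  by have := line_subbundle_degree_le0 x0 ell sf Fd; lia.
have v0 : ((1 : C), (0 : C)) != 0 by apply/eqP => -[/eqP]; rewrite oner_eq0.
have := st 1%N _ _ 0 0 isT (constant_line_subbundle v0) trivial_line_degree trivial_rank2_degree.
by rewrite !mul0r ltxx.
Qed.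

Lemma trivial_rank2_instability_degree (x0 : X) : elliptic X -> has_instability_degree E 0.
Proof.
move=> ell; have v0 : ((1 : C), (0 : C)) != 0 by apply/eqP => -[/eqP]; rewrite oner_eq0.
exists O, O, (constant_line ((1 : C), (0 : C))), second_projection, 0, 0; split.
- exact: constant_line_maximal.
- exact: constant_line_quotient.
- exact: trivial_line_degree.
- by rewrite subrr.
Qed.

End TrivialRank2.

(** * Hecke modifications of the trivial bundle of rank 2 *)
Section Hecke.
Variables (R : realType) (X : curve R).
Local Notation C := 'CC_R.
Local Notation O := (trivial_line X).
Local Notation E := (direct_sum O O : bundle X 2).

Lemma holomorphic_on_near (U : set X) (f : X -> C) :
  (forall x, U x -> exists V g, [/\ open V, V x, holomorphic_on V g & forall y, V y -> g y = f y]) ->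
  holomorphic_on U f.
Proof.
move=> loc x a Ux ax; have [V [g [oV Vx hg gf]]] := loc x Ux.
have /derivableCP[l dl] := hg x a Vx ax; apply/derivableCP; exists l.
apply: derivative_near_eq dl.
have cx : ccod (atlas X a) (cmap (atlas X a) x) by exact: cmap_ccod.
have nV : nbhs (cmap (atlas X a) x) (cinv (atlas X a) @^-1` V).
  by apply: (cinv_cts cx); rewrite /= cmapK//; apply: open_nbhs_nbhs.
by apply: filterS nV => w Vw; exact: gf.
Qed.

Lemma holomorphic_mxM (U : set X) m n q (A : X -> 'M[R[i]]_(m, n)) (B : X -> 'M[R[i]]_(n, q)) :
  holomorphic_mx_on U A -> holomorphic_mx_on U B -> holomorphic_mx_on U (fun x => A x *m B x).
Proof.
move=> hA hB i j; rewrite (_ : (fun x => _) = fun x => \sum_k A x i k * B x k j); last first.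
  by apply/funext => x; rewrite mxE.
elim: (index_enum _) => [|k s IH].
  rewrite (_ : (fun x => _) = fun=> 0); first exact: holomorphic_on_cst.
  by apply/funext => x; rewrite big_nil.
rewrite (_ : (fun x => _) = fun x => A x i k * B x k j + \sum_(l <- s) A x i l * B x l j).
  by apply: holomorphic_onD IH; exact: holomorphic_onM (hA i k) (hB k j).
by apply/funext => x; rewrite big_cons.
Qed.

Lemma holomorphic_mx_cst (U : set X) m n (A : 'M[R[i]]_(m, n)) : holomorphic_mx_on U (fun=> A).
Proof. by move=> i j; exact: holomorphic_on_cst. Qed.

Lemma det2E (A : 'M[R[i]]_2) : \det A = A 0 0 * A 1 1 - A 0 1 * A 1 0.
Proof.
rewrite (expand_det_row _ 0) !big_ord_recl big_ord0 addr0 /cofactor !det_mx11 !mxE /=.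
have e01 : lift ord0 ord0 = 1 :> 'I_2 by apply/val_inj.
have e00 : lift (1 : 'I_2) ord0 = 0 by apply/val_inj.
rewrite e01 e00 /= expr0 expr1 mul1r mulN1r mulrN.
by [].
Qed.

Lemma holomorphic_det (U : set X) (A : X -> 'M[R[i]]_2) : holomorphic_mx_on U A ->
  holomorphic_on U (fun x => \det (A x)).
Proof.
move=> hA x a Ux ax.
rewrite (_ : (fun x => _) = fun x => A x 0 0 * A x 1 1 - A x 0 1 * A x 1 0); last first.
  by apply/funext => y; exact: det2E.
exact: (derivableB (holomorphic_onM (hA 0 0) (hA 1 1) Ux ax) (holomorphic_onM (hA 0 1) (hA 1 0) Ux ax)).
Qed.

(** The quotient is the divided difference of [b] read in the chart. *)
Lemma holomorphic_division (p : X) (U : set X) (b : X -> C) : open U -> U p ->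
  U `<=` cdom (atlas X (chart_at p)) -> holomorphic_on U b -> b p = 0 ->
  exists d, holomorphic_on U d /\ forall x, U x -> b x = centered p x * d x.
Proof.
move=> oU Up Ua hb b0; pose a := chart_at p; pose c := cmap (atlas X a) p.
pose bc := b \o cinv (atlas X a).
have bcc : bc c = 0 by rewrite /bc /c /= (cmapK (Ua _ Up)).
exists (divided_difference bc c \o cmap (atlas X a)); split.
  apply: holomorphic_on_chart => // x Ux; apply: divided_difference_holomorphic_at.
  exact: holomorphic_in_chart oU Ux (Ua _ Ux) hb.
move=> x Ux; have := divided_differenceE bc c (cmap (atlas X a) x).
by rewrite bcc add0r {1}/bc /= (cmapK (Ua _ Ux)).
Qed.

(** The chain rule, applied to the two changes of coordinates. *)
Lemma coordinate_derivative_neq0 (z : chart R X) a (p : X) : local_coordinate z ->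
  cdom z p -> cdom (atlas X a) p ->
  'D_1 (cmap z \o cinv (atlas X a)) (cmap (atlas X a) p) != 0.
Proof.
move=> zloc zp ap; have [za az] := zloc a; pose c := cmap (atlas X a) p.
have cc : ccod (atlas X a) c by exact: cmap_ccod.
have cK : cinv (atlas X a) c = p by exact: cmapK.
have d1 : derivable (cmap z \o cinv (atlas X a)) c 1 by apply: az; rewrite ?cK.
have d2 : derivable (cmap (atlas X a) \o cinv z) (cmap z p) 1.
  by apply: za; rewrite ?cmapK//; exact: cmap_ccod.
have zE : (cmap z \o cinv (atlas X a)) c = cmap z p by rewrite /= cK.
rewrite -zE in d2.
have := derivative_comp (derivable_derivative d1) (derivable_derivative d2).
move: ('D_1 (cmap (atlas X a) \o cinv z) _) => l' d.
have : complex_derivative id c (l' * 'D_1 (cmap z \o cinv (atlas X a)) c).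
  apply: derivative_near_eq d.
  have n1 : nbhs c (ccod (atlas X a)) by apply: open_nbhs_nbhs; split => //; exact: ccod_open.
  have n2 : nbhs c (cinv (atlas X a) @^-1` cdom z).
    apply: (cinv_cts cc); rewrite /= cK; apply: open_nbhs_nbhs; split => //; exact: cdom_open.
  by apply: filterS2 n1 n2 => w cw zw /=; rewrite cmapK// cinvK.
move=> /derivative_unique /(_ (derivative_id c)) e.
by apply: contra_eq_neq e => ->; rewrite mulr0 eq_sym oner_eq0.
Qed.

Lemma mulmx_bijective n (A : 'M[R[i]]_n) : A \in unitmx ->
  bijective (fun v : 'cV[R[i]]_n => A *m v).
Proof.
by move=> uA; exists (fun v : 'cV_n => invmx A *m v) => v; rewrite mulmxA ?mulVmx ?mulmxV ?mul1mx.
Qed.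

Lemma bijective_unitmx n (A : 'M[R[i]]_n) :
  injective (fun v : 'cV[R[i]]_n => A *m v) -> A \in unitmx.
Proof.
move=> iA; rewrite -unitmx_tr unitmxE unitfE; apply/det0P => -[v v0 vA].
have : A *m v^T = A *m 0 by rewrite mulmx0 -[A]trmxK -trmx_mul vA trmx0.
by move/iA/(congr1 trmx); rewrite trmxK trmx0 => e; rewrite e eqxx in v0.
Qed.

Lemma complete_row (l : 'rV[R[i]]_2) : l != 0 ->
  exists2 A : 'M[R[i]]_2, A \in unitmx & row 1 A = l.
Proof.
(* [m] is a unit row, with its entry 1 away from a nonzero entry of [l] *)
move=> l0; pose m (j : 'I_2) : R[i] := (j == (l 0 0 != 0) :> nat)%:R.
exists (\matrix_(i, j) if i == 0 then m j else l 0 j).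
  rewrite unitmxE unitfE det2E !mxE /= /m; have [l00|l00] := eqVneq (l 0 0) 0 => /=.
    rewrite mul1r mul0r subr0; apply: contra_neq l0 => l01.
    by apply/rowP => j; rewrite mxE; case: j => -[|[|//]] jP;
      [rewrite -[RHS]l00|rewrite -[RHS]l01]; congr (l _ _); apply/val_inj.
  by rewrite mul0r mul1r sub0r oppr_eq0.
by apply/rowP => j; rewrite !mxE.
Qed.

Section Modification.
Variables (p : X) (F : bundle X 2) (alpha : forall x, 'Hom(fib F x, fib E x)).
Hypothesis hecke : hecke_modification p alpha.
Local Notation a := (chart_at p).
Local Notation L := (direct_sum O (ideal_line p) : bundle X 2).

Variable A : bix F -> X -> 'M[R[i]]_2.
Hypothesis Ahol : forall i, holomorphic_mx_on (bdom F i `&` bdom E (tt, tt)) (A i).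
Hypothesis AE : forall i x v, bdom F i x -> bdom E (tt, tt) x ->
  btriv E (tt, tt) x (alpha x v) = A i x *m btriv F i x v.
Hypothesis Atr : forall i k x, bdom F i x -> bdom F k x -> bdom E (tt, tt) x ->
  A i x = A k x *m btrans F i k x.
Variable i0 : bix F.
Hypothesis pi0 : bdom F i0 p.
Let U := bdom F i0 `&` cdom (atlas X a).
Let oU : open U. Proof. by apply: openI; [exact: bdom_open|exact: cdom_open]. Qed.
Let Up : U p. Proof. by split => //; exact: chart_atP. Qed.
Local Notation det_alpha := (fun x => \det (A i0 x) : C).

(** In the trivialisations that exhibit the Hecke modification, [alpha] is
    diag(1, z).  So, up to nonvanishing factors, its determinant is the local
    coordinate [z]. *)
Lemma det_alpha_simple_zero : det_alpha p = 0 /\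
  'D_1 (det_alpha \o cinv (atlas X a)) (cmap (atlas X a) p) != 0.
Proof.
have [_ _ [z [V [tF [tE [[zloc zp0] [oV Vp Vz] [tFb tFl] [tEb tEl] tEF]]]]]] := hecke.
have [gE [hgE gEE]] := tEl (tt, tt); have [gF [hgF gFE]] := tFl i0.
have I2 x : bdom E (tt, tt) x by [].
have key x : V x -> bdom F i0 x -> \det (gE x) * \det (A i0 x) = cmap z x * \det (gF x).
  move=> Vx ix.
  have e : gE x *m A i0 x = diag_mx (\row_(k < 2) if k == ord0 then 1 else cmap z x) *m gF x.
    apply/matrixP => b c; have [v vE] := btriv_surj (delta_mx c 0 : 'cV[R[i]]_2) ix.
    have := tEF x v Vx; rewrite (gEE _ _ Vx (I2 x)) (AE v ix (I2 x)) (gFE _ _ Vx ix) vE !mulmxA.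
    by move=> /(congr1 (fun B : 'cV[R[i]]_2 => B b 0)); rewrite -!colE !mxE.
  rewrite -det_mulmx e det_mulmx det_diag; congr (_ * _).
  by rewrite !big_ord_recl big_ord0 !mxE /= mul1r mulr1.
have unit_of r (G : bundle X r) i x (t : forall x, 'Hom(fib G x, 'cV[R[i]]_r)) (B : 'M[R[i]]_r) :
    bdom G i x -> bijective (t x) -> (forall v, t x v = B *m btriv G i x v) -> \det B != 0.
  move=> ix bt tB; rewrite -unitfE -unitmxE; apply: bijective_unitmx => v w /= Bvw.
  have [v' v'E] := btriv_surj v ix; have [w' w'E] := btriv_surj w ix.
  by rewrite -v'E -w'E in Bvw *; rewrite -!tB in Bvw; rewrite (bij_inj bt Bvw).
have gE0 : \det (gE p) != 0 by apply: (unit_of _ E (tt, tt) p tE) => // [|v]; [exact: tEb|exact: gEE].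
have gF0 : \det (gF p) != 0 by apply: (unit_of _ F i0 p tF) => // [|v]; [exact: tFb|exact: gFE].
have ap : cdom (atlas X a) p by exact: chart_atP.
have zp : cdom z p by exact: Vz.
have dz := coordinate_derivative_neq0 zloc zp ap.
have A0 : \det (A i0 p) = 0.
  by have := key p Vp pi0; rewrite zp0 mul0r => /eqP; rewrite mulf_eq0 (negPf gE0) => /eqP.
split; [exact: A0|pose c := cmap (atlas X a) p].
have cK : cinv (atlas X a) c = p by exact: cmapK.
have der (W : set X) (u : X -> C) : W p -> holomorphic_on W u ->
    exists l, complex_derivative (u \o cinv (atlas X a)) c l.
  by move=> Wp hu; apply/derivableCP; exact: hu.
have [lE dE] := der (V `&` bdom E (tt, tt)) (fun x => \det (gE x)) (conj Vp (I2 p)) (holomorphic_det hgE).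
have [lF dF] := der (V `&` bdom F i0) (fun x => \det (gF x)) (conj Vp pi0) (holomorphic_det hgF).
have [lA dA] := der (bdom F i0 `&` bdom E (tt, tt)) det_alpha (conj pi0 (I2 p)) (holomorphic_det (@Ahol i0)).
have [lz dz'] : exists l, complex_derivative (cmap z \o cinv (atlas X a)) c l.
  by apply/derivableCP; apply: (zloc a).2; rewrite ?cK//; exact: cmap_ccod.
have d1 := derivativeM dE dA; have d2 := derivativeM dz' dF.
have keyn : \forall w \near c, (cmap z \o cinv (atlas X a)) w * ((fun x => \det (gF x) : C) \o cinv (atlas X a)) w =
    ((fun x => \det (gE x) : C) \o cinv (atlas X a)) w * (det_alpha \o cinv (atlas X a)) w.
  have cc : ccod (atlas X a) c by exact: cmap_ccod.
  have n2 : nbhs c (cinv (atlas X a) @^-1` (V `&` bdom F i0)).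
    apply: (cinv_cts cc); rewrite /= cK; apply: open_nbhs_nbhs; split => //.
    by apply: openI => //; exact: bdom_open.
  by apply: filterS n2 => w [Vw iw] /=; rewrite key.
rewrite (complex_derivativeE dz') in dz; rewrite (complex_derivativeE dA).
have := derivative_unique (derivative_near_eq keyn d2) d1.
rewrite /= cK zp0 A0 (mul0r lF) (mul0r lE) add0r addr0 => e.
apply: contra_neq dz => lA0; move: e; rewrite lA0 mulr0 => /eqP.
by rewrite mulf_eq0 (negPf gF0) => /eqP.
Qed.

Variable C0 : 'M[R[i]]_2.
Hypothesis C0u : C0 \in unitmx.
Hypothesis C0p : row 1 (C0 *m A i0 p) = 0.

(** In coordinates of the fibre of the trivial bundle where the image of
    [alpha] at [p] is the first axis, the second row of [alpha] is divisible by
    the local coordinate.  The determinant of the quotient is nonzero at [p], for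
    otherwise that of [alpha] would have a multiple zero. *)
Lemma reduced_matrix : exists B : X -> 'M[R[i]]_2,
  [/\ holomorphic_mx_on U B, B p \in unitmx
    & forall x, U x -> C0 *m A i0 x =
        diag_mx (\row_(k < 2) if k == 0 then 1 else centered p x) *m B x].
Proof.
have hCA : holomorphic_mx_on U (fun x => C0 *m A i0 x).
  apply: holomorphic_mxM; first exact: holomorphic_mx_cst.
  by move=> i j; apply: holomorphic_onS (@Ahol i0 i j) => x [].
have divide j : exists d, holomorphic_on U d /\
    forall x, U x -> (C0 *m A i0 x) 1 j = centered p x * d x.
  apply: (holomorphic_division oU Up _ (hCA 1 j)); first by move=> x [].
  have := congr1 (fun w : 'rV[R[i]]_2 => w 0 j) C0p.
  by rewrite mxE [in RHS]mxE.
pose d j := projT1 (cid (divide j)); have dP j := projT2 (cid (divide j)).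
pose B x : 'M[R[i]]_2 := \matrix_(i, j) if i == 0 then (C0 *m A i0 x) 0 j else d j x.
have BE x : U x -> C0 *m A i0 x =
    diag_mx (\row_(k < 2) if k == 0 then 1 else centered p x) *m B x.
  move=> Ux; apply/matrixP => i j; rewrite mul_diag_mx [RHS]mxE [X in X * _]mxE [X in _ * X]mxE.
  have [->|i0'] := eqVneq i 0; first by rewrite mul1r.
  have -> : i = 1 by case: (i) i0' => -[|[|//]] iP // _; exact/val_inj.
  by have [_ /(_ x Ux)] := dP j.
have hB : holomorphic_mx_on U B.
  move=> i j; case: (eqVneq i 0) => [->|i0'].
      rewrite (_ : (fun x => _) = fun x => (C0 *m A i0 x) 0 j); first exact: hCA.
    by apply/funext => x; rewrite [LHS]mxE.
  rewrite (_ : (fun x => _) = d j); first by have [] := dP j.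
  by apply/funext => x; rewrite [LHS]mxE (negPf i0').
exists B; split; [exact: hB| |exact: BE].
have [A0 dA0] := det_alpha_simple_zero.
rewrite unitmxE unitfE; apply: contra_neq dA0 => B0.
pose c := cmap (atlas X a) p; have cK : cinv (atlas X a) c = p by apply: cmapK; exact: chart_atP.
have detE x : U x -> \det C0 * \det (A i0 x) = centered p x * \det (B x).
  move=> Ux; rewrite -det_mulmx BE// det_mulmx det_diag; congr (_ * _).
  by rewrite !big_ord_recl big_ord0 !mxE /= mul1r mulr1.
have [lA dA] : exists l, complex_derivative (det_alpha \o cinv (atlas X a)) c l.
  apply/derivableCP; apply: (holomorphic_det (@Ahol i0)); last exact: chart_atP.
  by split.
have [lB dB] : exists l, complex_derivative ((fun x => \det (B x) : C) \o cinv (atlas X a)) c l.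
  apply/derivableCP; apply: (holomorphic_det hB); last exact: chart_atP.
  exact: Up.
have dc : complex_derivative (fun w => w - c) c (1 - 0).
  by apply: derivativeB; [exact: derivative_id|exact: derivative_cst].
have d1 := derivativeM (derivative_cst (\det C0) c) dA; have d2 := derivativeM dc dB.
have cc : ccod (atlas X a) c by apply: cmap_ccod; exact: chart_atP.
have keyn : \forall w \near c, (w - c) * ((fun x => \det (B x) : C) \o cinv (atlas X a)) w =
    \det C0 * (det_alpha \o cinv (atlas X a)) w.
  have n1 : nbhs c (ccod (atlas X a)) by apply: open_nbhs_nbhs; split => //; exact: ccod_open.
  have n2 : nbhs c (cinv (atlas X a) @^-1` U).
    by apply: (cinv_cts cc); rewrite /= cK; apply: open_nbhs_nbhs.
  by apply: filterS2 n1 n2 => w cw Uw /=; rewrite detE// /centered cinvK.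
rewrite (complex_derivativeE dA).
have := derivative_unique (derivative_near_eq keyn d2) d1.
rewrite /= cK B0 subrr (mul0r lB) mul0r mulr0 !addr0 => /esym/eqP.
have C00 : \det C0 != 0 by rewrite -unitfE -unitmxE.
by rewrite mulf_eq0 (negPf C00) => /eqP.
Qed.

Variable B : X -> 'M[R[i]]_2.
Hypothesis hB : holomorphic_mx_on U B.
Hypothesis Bp : B p \in unitmx.
Hypothesis BE : forall x, U x -> C0 *m A i0 x =
  diag_mx (\row_(k < 2) if k == 0 then 1 else centered p x) *m B x.

Definition pair_of_cV (w : 'cV[R[i]]_2) : (C * C)%type := (w 0 0, w 1 0).

Lemma pair_of_cV_bij : bijective pair_of_cV.
Proof.
exists (fun v : (C * C)%type => \col_i if i == 0 then v.1 else v.2).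
  move=> w; apply/colP => i; rewrite mxE; case: (eqVneq i 0) => [->//|i0'] /=.
  by congr (w _ _); case: (i) i0' => -[|[|//]] iP // _; exact/val_inj.
by move=> [u v]; rewrite /pair_of_cV !mxE.
Qed.

(** Off [p] this is [alpha], in the coordinates [C0].  At [p], where the fibre of
    the ideal sheaf is identified through the local coordinate, it is the limit
    of [alpha] with its second component divided by that coordinate. *)
Definition reduced_map (x : X) (v : fib F x) : 'cV[R[i]]_2 :=
  if x == p then B p *m btriv F i0 x v else C0 *m btriv E (tt, tt) x (alpha x v).

Definition hecke_iso (x : X) : 'Hom(fib F x, fib L x) :=
  linfun (fun v : fib F x => pair_of_cV (reduced_map v)).

Lemma hecke_isoE x v : hecke_iso x v = pair_of_cV (reduced_map v).
Proof.
pose f (v : fib F x) : (C * C)%type := pair_of_cV (reduced_map v).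
have lin : linear f.
  move=> k u w; rewrite /f /reduced_map.
  have -> : (if x == p then B p *m btriv F i0 x (k *: u + w)
             else C0 *m btriv E (tt, tt) x (alpha x (k *: u + w))) =
    k *: (if x == p then B p *m btriv F i0 x u else C0 *m btriv E (tt, tt) x (alpha x u)) +
    (if x == p then B p *m btriv F i0 x w else C0 *m btriv E (tt, tt) x (alpha x w)).
    by case: ifP => _; rewrite !linearP.
  by rewrite /pair_of_cV !mxE.
pose h := GRing.isLinear.Build _ _ _ _ _ lin.
pose l : {linear fib F x -> (C * C)%type} := HB.pack f h.
by rewrite /hecke_iso (lfunE l).
Qed.

Lemma hecke_iso_bijective x : bijective (hecke_iso x).
Proof.
suff br : bijective (@reduced_map x).
  apply: (eq_bij (bij_comp pair_of_cV_bij br)) => v.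
  by rewrite hecke_isoE.
rewrite /reduced_map; case: (eqVneq x p) => [->|xp].
  exact: (bij_comp (mulmx_bijective Bp) (btriv_bij pi0)).
have [_ balx _] := hecke.
have bE := @btriv_bij _ _ _ E (tt, tt) x (conj I I).
exact: (bij_comp (mulmx_bijective C0u) (bij_comp bE (balx x xp))).
Qed.

Lemma btriv_ideal (b : bool) x (v : fib L x) : btriv L (tt, b) x v =
  diag_mx (\row_(k < 2) if k == 0 then 1 else if b && (x != p) then (centered p x)^-1 else 1) *m
  \col_k (if k == 0 then v.1 else v.2).
Proof.
apply: etrans (pair_cVE (scale_cV 1) (ideal_triv p b x) v) _.
apply/colP => k; rewrite mul_diag_mx !mxE !scale_cVE.
case: (fintype.splitP k) => j jE; rewrite !mxE !ord1 eqxx mulr1n.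
  by have -> : k == 0 by apply/eqP/val_inj; rewrite /= jE ord1.
by have -> : k == 0 = false by apply/eqP => k0; move: jE; rewrite k0.
Qed.

Lemma col_pair (w : 'cV[R[i]]_2) :
  \col_k (if k == 0 then (pair_of_cV w).1 else (pair_of_cV w).2) = w.
Proof.
apply/colP => i; rewrite mxE; case: (eqVneq i 0) => [->//|i0'] /=.
by congr (w _ _); case: (i) i0' => -[|[|//]] iP // _; exact/val_inj.
Qed.

(** Off [p], the matrix is that of [alpha] in the coordinates [C0], with its
    second row divided by the local coordinate in one of the trivialisations of
    the ideal sheaf.  Near [p], it agrees with [B] up to a transition matrix. *)
Lemma hecke_iso_bundle_map : bundle_map hecke_iso.
Proof.
move=> i [[] b].
have I2 x : bdom E (tt, tt) x by [].
pose M x : 'M[R[i]]_2 := if x == p then B p *m btrans F i i0 p else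
  diag_mx (\row_(k < 2) if k == 0 then 1 else if b then (centered p x)^-1 else 1) *m (C0 *m A i x).
exists M; split; last first.
  move=> x v ix [_ jx]; rewrite btriv_ideal hecke_isoE col_pair /reduced_map /M.
  case: (eqVneq x p) jx v ix => [->|xp] jx v ix.
    have -> : diag_mx (\row_(k < 2) if k == 0 then 1 else if b && false then (centered p p)^-1 else 1) = 1%:M :> 'M[R[i]]_2.
      rewrite andbF -[RHS]/(1%:M) -diag_const_mx; congr diag_mx.
      by apply/rowP => k; rewrite !mxE; case: ifP.
    by rewrite mul1mx (btransE v ix pi0) mulmxA.
  by rewrite andbT (AE v ix (I2 x)) !mulmxA.
move=> k l; apply: holomorphic_on_near => x [ix [_ jx]].
have hdiag : holomorphic_mx_on (ideal_dom p b `&` ~` [set p])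
    (fun x => diag_mx (\row_(k < 2) if k == 0 then 1 else if b then (centered p x)^-1 else 1) : 'M[R[i]]_2).
  move=> k' l'.
  rewrite (_ : (fun x => _) = fun x => if k' == l' then (if l' == 0 then 1 else if b then (centered p x)^-1 else 1) else 0); last first.
    apply/funext => y; rewrite mxE [X in X *+ _]mxE.
    by have [->|_] := eqVneq k' l'; rewrite ?mulr1n ?mulr0n.
  case: (k' == l'); last exact: holomorphic_on_cst.
  case: (l' == 0); first exact: holomorphic_on_cst.
  case: (b); last exact: holomorphic_on_cst.
  apply: holomorphic_on_inv; first by apply: holomorphic_on_centered => y [].
  by move=> y [dy /eqP yp]; exact: centered_neq0.
have op : open (~` [set p]).
  apply: closed_openC; apply: accessible_closed_set1.
  exact: hausdorff_accessible (@cpt_hausdorff _ X).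
have ob : open (ideal_dom p b) by exact: (@bdom_open _ _ _ (ideal_line p) b).
have [xp|xp] := eqVneq x p; last first.
  exists (bdom F i `&` (ideal_dom p b `&` ~` [set p])).
  exists (fun x => (diag_mx (\row_(k < 2) if k == 0 then 1 else if b then (centered p x)^-1 else 1) *m (C0 *m A i x)) k l).
  split.
  - by apply: openI; [exact: bdom_open|exact: openI].
  - by split => //; split => //; exact/eqP.
  - apply: (holomorphic_mxM (A := fun x => diag_mx (\row_(k < 2) if k == 0 then 1 else if b then (centered p x)^-1 else 1))).
      by move=> k' l'; apply: holomorphic_onS (hdiag k' l') => y [].
    apply: holomorphic_mxM; first exact: holomorphic_mx_cst.
    by move=> k' l'; apply: holomorphic_onS (@Ahol i k' l') => y [].
  by move=> y [_ [_ /eqP yp]]; rewrite /M (negPf yp).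
rewrite xp in ix jx *.
have bt : b = true by case: (b) jx => // /(_ erefl).
exists (bdom F i `&` U), (fun x => (B x *m btrans F i i0 x) k l); split.
- by apply: openI => //; exact: bdom_open.
- by [].
- apply: (holomorphic_mxM (A := B)).
    by move=> k' l'; apply: holomorphic_onS (@hB k' l') => y [].
  move=> k' l'; have h := @btrans_hol _ _ _ F i i0 k' l'.
  by apply: holomorphic_onS h => y [? []].
move=> y [iy Uy]; rewrite /M; case: eqVneq => [->//|yp]; congr (fun_of_matrix _ k l).
rewrite (Atr iy Uy.1 (I2 y)) (mulmxA C0) (BE Uy) !mulmxA; congr (_ *m _).
rewrite -[LHS]mul1mx; congr (_ *m _).
rewrite mulmx_diag -diag_const_mx; congr diag_mx; apply/rowP => j; rewrite !mxE bt.
by case: ifP => _; rewrite ?mulr1// mulVf// centered_neq0//; exact: Uy.2.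
Qed.

End Modification.

Theorem hecke_modification_iso (p : X) (F : bundle X 2) (alpha : forall x, 'Hom(fib F x, fib E x)) :
  hecke_modification p alpha -> bundle_iso F (direct_sum O (ideal_line p)).
Proof.
move=> hecke; have [balpha _ _] := hecke.
have [A [Ahol AE Atr]] := bundle_map_matrix ((tt, tt) : bix E) balpha.
have [i0 pi0] := bdom_cover F p.
have [A0 _] := det_alpha_simple_zero hecke Ahol AE pi0.
have /eqP/det0P[l l0 lA] := A0.
have [C0 C0u C0l] := complete_row l0.
have C0p : row 1 (C0 *m A i0 p) = 0 by rewrite row_mul C0l.
have [B [hB Bp BE]] := reduced_matrix hecke Ahol AE pi0 C0u C0p.
exists (hecke_iso p alpha i0 C0 B); split.
  exact: (hecke_iso_bundle_map Ahol AE Atr pi0 hB BE).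
exact: (hecke_iso_bijective hecke pi0 C0u Bp).
Qed.

End Hecke.

Theorem theorem5p20 (R : realType) (X : curve R) (p : X) (hX : elliptic X) :
  let E : bundle X 2 := direct_sum (trivial_line X) (trivial_line X) in
  [/\ strictly_semistable E,
      has_instability_degree E 0%R,
      (forall l : {vspace fib E p}, \dim l = 1%N -> bad_line l)
    & (forall (F : bundle X 2) (alpha : forall x, 'Hom(fib F x, fib E x)),
         hecke_modification p alpha ->
         bundle_iso F (direct_sum (trivial_line X) (ideal_line p)))].
Proof.
move=> E; split.
- exact: trivial_rank2_strictly_semistable p hX.
- exact: trivial_rank2_instability_degree p hX.
- by move=> l l1; exact: all_lines_bad hX l1.
- by move=> F alpha hecke; exact: hecke_modification_iso hecke.
Qed.
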